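(* Let $S\subset\mathbb{Z}_{\geq0}^n$ be a finite set. Assume that there exist a real closed field $R$ and $p\in\mathrm{P}_+(S,R)$ such that $p$ is not a sum of squares of elements from $R[\mathbb{Q}^n]$. Then $\mathrm{P}_+(S)$ does not have a positive definition over the relational structure with domain $\mathbb{R}$ whose relations consist of all spectrahedra and the inequality relation $\neq$.
   Context: For a real closed field $R$ and a finite set $S\subset\mathbb{Z}_{\ge0}^n$, $\mathrm{P}(S,R)$ is the finite-dimensional $R$-vector space of all polynomials in $R[x_1,\dots,x_n]$ whose support is contained in $S$, identified with $R^S$ via coefficients; $\mathrm{P}_+(S,R)$ is the convex cone of all $p\in\mathrm{P}(S,R)$ with $p(x)\ge0$ for all $x\in R^n$; $\mathrm{P}_+(S)=\mathrm{P}_+(S,\mathbb{R})$. $R[\mathbb{Q}^n]$ is the group ring of the additive group $\mathbb{Q}^n$ over $R$, whose elements are finite sums $\sum_a c_a\epsilon^a$ with $a\in\mathbb{Q}^n$, $c_a\in R$, and $\epsilon^a=\epsilon_1^{a_1}\cdots\epsilon_n^{a_n}$. The polynomial ring $R[x_1,\dots,x_n]$ is regarded as a subring by replacing $x_i$ by $\epsilon_i$. A set $K\subseteq\mathbb{R}^m$ is a spectrahedron if $K=\{x\in\mathbb{R}^m\mid A_0+x_1A_1+\cdots+x_mA_m\succeq0\}$ for some real symmetric matrices $A_0,\dots,A_m$ of the same size ($\succeq0$ means positive semidefinite). A first-order formula is positive if it is built from atomic formulas (including equalities) by existential and universal quantification, conjunction, and disjunction (no negation). A set has a positive definition over a relational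 structure if it is the set of tuples satisfying some positive formula in the signature of that structure. *)

(* Defs.v *)
(* The field of real numbers is any [realType]: these are all isomorphic. *)
(* The notations of [monalg] clash with those of [mpoly]. *)
From mathcomp Require Import all_boot all_order all_algebra.
From mathcomp Require Import -(notations) monalg.
From mathcomp Require Import finmap mpoly reals.

Set Implicit Arguments.
Unset Strict Implicit.
Unset Printing Implicit Defensive.

Import GRing.Theory Num.Theory.

Local Open Scope ring_scope.

Definition supported_in (F : rcfType) (n : nat) (S : {fset 'X_{1..n}})
    (p : {mpoly F[n]}) : Prop :=
  {subset msupp p <= S}.

Definition in_Pplus (F : rcfType) (n : nat) (S : {fset 'X_{1..n}})
    (p : {mpoly F[n]}) : Prop :=
  supported_in S p /\ forall x : 'I_n -> F, 0 <= p.@[x].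

(* The cone P_+(S,F) inside F^S: the coefficient families of its elements. *)
Definition Pplus_coef (F : rcfType) (n : nat) (S : {fset 'X_{1..n}})
    (c : S -> F) : Prop :=
  exists2 p : {mpoly F[n]}, in_Pplus S p & forall s : S, c s = p@_(val s).

(* The group ring F[Q^n]: finitely supported functions from Q^n to F, with
   convolution product. The ring instance of [monalg] is not available, because
   [monomType] excludes nontrivial groups; only the additive group is reused. *)
Notation qmonalg F n := (monalg.malg 'rV[rat]_n F).

(* The element c epsilon^a. *)
Definition qterm (F : rcfType) (n : nat) (c : F) (a : 'rV[rat]_n)
    : qmonalg F n :=
  monalg.mkmalgU a c.

Definition qmul (F : rcfType) (n : nat) (f g : qmonalg F n) : qmonalg F n :=
  \sum_(a <- monalg.msupp f) \sum_(b <- monalg.msupp g)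
    qterm (monalg.mcoeff a f * monalg.mcoeff b g) (a + b).

(* The embedding of F[x_1,...,x_n] sending x_i to epsilon_i. *)
Definition qmonalg_of_mpoly (F : rcfType) (n : nat) (p : {mpoly F[n]})
    : qmonalg F n :=
  \sum_(m <- msupp p) qterm p@_m (\row_i (m i)%:R).

Definition qsos (F : rcfType) (n : nat) (f : qmonalg F n) : Prop :=
  exists (k : nat) (g : 'I_k -> qmonalg F n), f = \sum_i qmul (g i) (g i).

Definition psdmx (R : realType) (d : nat) (A : 'M[R]_d) : Prop :=
  forall v : 'cV[R]_d, 0 <= (v^T *m A *m v) 0 0.

Definition spectrahedron (R : realType) (m : nat) (K : ('I_m -> R) -> Prop)
    : Prop :=
  exists (d : nat) (A0 : 'M[R]_d) (A : 'I_m -> 'M[R]_d),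
    [/\ A0^T = A0,
        forall i, (A i)^T = A i
      & forall x, K x <-> psdmx (A0 + \sum_i x i *: A i)].

Record rel_structure := RelStructure {
  domain : Type;
  relsym : Type;
  arity : relsym -> nat;
  interp : forall r : relsym, ('I_(arity r) -> domain) -> Prop
}.

(* Positive formulas with free variables in V; a quantifier binds the variable
   [None] of [option V]. *)
Inductive pos_formula (M : rel_structure) (V : Type) : Type :=
  | PEq of V & V
  | PRel (r : relsym M) of ('I_(arity r) -> V)
  | PAnd of pos_formula M V & pos_formula M V
  | POr of pos_formula M V & pos_formula M V
  | PExists of pos_formula M (option V)
  | PForall of pos_formula M (option V).

Fixpoint sat (M : rel_structure) (V : Type) (phi : pos_formula M V)
    (e : V -> domain M) {struct phi} : Prop :=
  match phi with
  | PEq x y => e x = e y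
  | PRel r xs => interp (fun i => e (xs i))
  | PAnd f g => sat f e /\ sat g e
  | POr f g => sat f e \/ sat g e
  | PExists f => exists a, sat f (oapp e a)
  | PForall f => forall a, sat f (oapp e a)
  end.

Definition positive_definition (M : rel_structure) (V : Type)
    (X : (V -> domain M) -> Prop) : Prop :=
  exists phi : pos_formula M V, forall e, X e <-> sat phi e.

(* One relation symbol for each spectrahedron of each dimension m, and [None]
   for the relation <>. *)
Definition spec_sym (R : realType) : Type :=
  option {m : nat & {K : ('I_m -> R) -> Prop | spectrahedron K}}.

Definition spec_arity (R : realType) (r : spec_sym R) : nat :=
  if r is Some K then projT1 K else 2.

Definition spec_interp (R : realType) (r : spec_sym R) :
    ('I_(spec_arity r) -> R) -> Prop :=
  match r return ('I_(spec_arity r) -> R) -> Prop with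
  | Some K => proj1_sig (projT2 K)
  | None => fun x => x ord0 <> x ord_max
  end.

Definition spectrahedra_neq (R : realType) : rel_structure :=
  {| domain := R; relsym := spec_sym R; arity := @spec_arity R;
     interp := @spec_interp R |}.

(* Main.v *)
(* Let K be a field of generalized power series over a real closed extension k of
   the reals, with exponents in Q^n. A functional la on the group ring k[Q^n] which
   is nonnegative on squares acts on K by multiplying the coefficient of epsilon^a
   by la(epsilon^a). By Schur's product theorem this map preserves psd matrices; if
   moreover la(1) = 1 it fixes the reals, hence it preserves spectrahedra, and if all
   la(epsilon^a) are nonzero it is bijective. It then preserves every positive
   formula over the spectrahedra and <>. If such a formula defined P_+(S), Tarski's
   principle would let it define P_+(S,K) too; it would hold of the coefficients of
   p(epsilon x), where p is in P_+(S,k), hence of their images, and evaluating the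
   image polynomial at x = epsilon^-1 yields la(p) >= 0.

   A pair with la(p) < 0 is obtained as follows. For every finite set E of exponents,
   Tarski's principle moves a counterexample from F to the reals: some p_E in P_+(S)
   has no psd Gram matrix indexed by E. The cone of polynomials with such a matrix is
   closed, so it is separated from p_E by a functional; take k to be an ultrapower of
   the reals and (p, la) to be the class of these pairs.

   For K one can take series with left-finite support: Q^n is embedded in the reals
   using powers of 2^(1/n). They form a real closed field by Hensel's lemma. *)

(* The map on K is additive but not multiplicative: it respects conditions that are affine in the
   variables, such as linear matrix inequalities, while it may destroy nonnegativity of a
   polynomial. Universal quantifiers require it to be surjective and the relation <> requires it to
   be injective; both follow once la vanishes at no epsilon^a. Rational exponents matter here: every
   a is a/2 + a/2, so la(epsilon^a) is the value of la at a square, hence nonnegative, and it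
   becomes positive after adding a small multiple of the evaluation at (1, ..., 1), which is 1 at
   every epsilon^a. There is room for this because la(p) < 0 is strict at each finite stage. The
   ultrapower gathers the stages, since the real polynomial p_E varies with E. The substitution of
   epsilon x for x puts the coefficients of p at different exponents, so that the map acts on each
   of them by its own factor. Divisibility of the exponents is used once more to rescale polynomials
   over K by the slopes of their Newton polygon. *)
Require Import Defs.
From HB Require Import structures.
From mathcomp Require Import all_boot all_order all_algebra generic_quotient.
From mathcomp Require Import boolp ring lra.
From mathcomp Require Import -(notations) classical_sets filter monalg.
From mathcomp Require Import polyrcf qe_rcf_th qe_rcf.
From mathcomp Require Import finmap mpoly reals.

Set Implicit Arguments.
Unset Strict Implicit.
Unset Printing Implicit Defensive.

Import Order.TTheory GRing.Theory Num.Theory.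

Local Open Scope ring_scope.

(** * Quantifier elimination, uniformly in the real closed field *)

(* The formulas computed by [CcountGt0] commute with a change of base field, so
   that quantifiers are eliminated by one formula valid in all real closed
   extensions of an ordered field [F]. *)
Section Naturality.

Variables (F K : realFieldType) (h : {rmorphism F -> K}).

Fixpoint tmap (t : qe_rcf.term F) : qe_rcf.term K :=
  match t with
  | Var i => Var K i
  | Const c => Const (h c)
  | NatConst m => NatConst K m
  | Add t u => Add (tmap t) (tmap u)
  | Opp t => Opp (tmap t)
  | NatMul t m => NatMul (tmap t) m
  | Mul t u => Mul (tmap t) (tmap u)
  | Exp t m => Exp (tmap t) m
  end.

Fixpoint fmap (f : qe_rcf.formula F) : qe_rcf.formula K :=
  match f with
  | Bool b => Bool b
  | Equal t u => Equal (tmap t) (tmap u)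
  | Lt t u => Lt (tmap t) (tmap u)
  | Le t u => Le (tmap t) (tmap u)
  | And f g => And (fmap f) (fmap g)
  | Or f g => Or (fmap f) (fmap g)
  | Implies f g => Implies (fmap f) (fmap g)
  | Not f => Not (fmap f)
  end.

Local Notation pmap := (map tmap).

(** The procedures of the elimination are in continuation-passing style. Each commutation lemma
    therefore takes two continuations related by the change of field, and these lemmas compose as
    the procedures do. *)
Lemma fmap_Size p k k' : (forall m, fmap (k m) = k' m) ->
  fmap (Size p k) = Size (pmap p) k'.
Proof.
elim: p k k' => [|c p IHp] k k' kk' /=; first exact: kk'.
by apply: IHp => -[|m] /=; rewrite ?kk'.
Qed.

Lemma fmap_Isnull p k k' : (forall b, fmap (k b) = k' b) ->
  fmap (Isnull p k) = Isnull (pmap p) k'.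
Proof. by move=> kk'; apply: fmap_Size => m; apply: kk'. Qed.

Lemma fmap_LtSize p q k k' : (forall b, fmap (k b) = k' b) ->
  fmap (LtSize p q k) = LtSize (pmap p) (pmap q) k'.
Proof. by move=> kk'; apply: fmap_Size => m; apply: fmap_Size => l; apply: kk'. Qed.

Lemma fmap_LeadCoef p k k' : (forall t, fmap (k t) = k' (tmap t)) ->
  fmap (LeadCoef p k) = LeadCoef (pmap p) k'.
Proof.
elim: p k k' => [|c p IHp] k k' kk' /=; first by rewrite kk' /= rmorph0.
by apply: IHp => l /=; rewrite !kk'.
Qed.

Lemma pmap_AmulXn a m : pmap (AmulXn a m) = AmulXn (tmap a) m.
Proof. by elim: m => //= m ->; rewrite rmorph0. Qed.

Lemma pmap_AddPoly p q : pmap (AddPoly p q) = AddPoly (pmap p) (pmap q).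
Proof. by elim: p q => [|a p IHp] [|b q] //=; rewrite IHp. Qed.

Lemma pmap_ScalPoly c p : pmap (ScalPoly c p) = ScalPoly (tmap c) (pmap p).
Proof. by rewrite /ScalPoly -!map_comp. Qed.

Lemma pmap_MulPoly p q : pmap (MulPoly p q) = MulPoly (pmap p) (pmap q).
Proof. by elim: p => [|a p IHp] //=; rewrite pmap_AddPoly pmap_ScalPoly /= IHp. Qed.

Lemma pmap_ExpPoly p m : pmap (ExpPoly p m) = ExpPoly (pmap p) m.
Proof.
rewrite /ExpPoly; case: m => //= m; elim: m => //= m.
by rewrite /iterop /= => <-; rewrite pmap_MulPoly.
Qed.

Lemma pmap_OppPoly p : pmap (OppPoly p) = OppPoly (pmap p).
Proof. by rewrite /OppPoly pmap_ScalPoly /= rmorphN1. Qed.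

Lemma pmap_Deriv p : pmap (Deriv p) = Deriv (pmap p).
Proof. by elim: p => [|a p IHp] //=; rewrite pmap_AddPoly /= IHp. Qed.

Definition dmap (d : nat * polyF F * polyF F) : nat * polyF K * polyF K :=
  (d.1.1, pmap d.1.2, pmap d.2).

Lemma fmap_Rediv_rec_loop q sq cq c qq r m k k' :
  (forall d, fmap (k d) = k' (dmap d)) ->
  fmap (Rediv_rec_loop q sq cq c qq r m k) =
    Rediv_rec_loop (pmap q) sq (tmap cq) c (pmap qq) (pmap r) m k'.
Proof.
elim: m c qq r => [|m IHm] c qq r kk' /=; apply: fmap_Size => sr;
  (case: ifP => _; first exact: kk'); apply: fmap_LeadCoef => lr.
  by rewrite kk' /dmap /= !(pmap_AddPoly, pmap_MulPoly, pmap_OppPoly, pmap_AmulXn).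
by rewrite IHm //= !(pmap_AddPoly, pmap_MulPoly, pmap_OppPoly, pmap_AmulXn).
Qed.

Lemma fmap_Rediv p q k k' : (forall d, fmap (k d) = k' (dmap d)) ->
  fmap (Rediv p q k) = Rediv (pmap p) (pmap q) k'.
Proof.
move=> kk'; apply: fmap_Isnull => -[]; first by rewrite kk' /dmap /= rmorph0.
apply: fmap_Size => sq; apply: fmap_Size => sp; apply: fmap_LeadCoef => lq.
by rewrite (fmap_Rediv_rec_loop _ _ _ _ _ _ _ kk') /= rmorph0.
Qed.

Lemma fmap_Rmod p q k k' : (forall r, fmap (k r) = k' (pmap r)) ->
  fmap (Rmod p q k) = Rmod (pmap p) (pmap q) k'.
Proof. by move=> kk'; apply: fmap_Rediv => d; apply: kk'. Qed.

Lemma fmap_Rscal p q k k' : (forall c, fmap (k c) = k' c) ->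
  fmap (Rscal p q k) = Rscal (pmap p) (pmap q) k'.
Proof. by move=> kk'; apply: fmap_Rediv => d; apply: kk'. Qed.

Lemma fmap_Rgcd_loop m p q k k' : (forall r, fmap (k r) = k' (pmap r)) ->
  fmap (Rgcd_loop m p q k) = Rgcd_loop m (pmap p) (pmap q) k'.
Proof.
move=> kk'; elim: m p q => [|m IHm] p q; apply: fmap_Rmod => r;
  by apply: fmap_Isnull => -[].
Qed.

Lemma fmap_Rgcd p q k k' : (forall r, fmap (k r) = k' (pmap r)) ->
  fmap (Rgcd p q k) = Rgcd (pmap p) (pmap q) k'.
Proof.
move=> kk'; apply: fmap_LtSize => -[]; apply: fmap_Isnull => -[] //;
  by apply: fmap_Size => m; apply: fmap_Rgcd_loop.
Qed.

Lemma fmap_BigRgcd ps k k' : (forall r, fmap (k r) = k' (pmap r)) ->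
  fmap (BigRgcd ps k) = BigRgcd (map pmap ps) k'.
Proof.
elim: ps k k' => [|p ps IHps] k k' kk' /=; first by rewrite kk' /= rmorph0.
by apply: IHps => r; apply: fmap_Rgcd.
Qed.

Lemma fmap_Changes s k k' : (forall m, fmap (k m) = k' m) ->
  fmap (Changes s k) = Changes (map tmap s) k'.
Proof.
elim: s k k' => [|a s IHs] k k' kk' //=.
by apply: IHs => v /=; rewrite !kk'; case: s.
Qed.

Lemma fmap_SeqPInfty ps k k' : (forall s, fmap (k s) = k' (map tmap s)) ->
  fmap (SeqPInfty ps k) = SeqPInfty (map pmap ps) k'.
Proof.
elim: ps k k' => [|p ps IHps] k k' kk' /=; first exact: kk'.
by apply: fmap_LeadCoef => lp; apply: IHps => lps; apply: kk'.
Qed.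

Lemma fmap_SeqMInfty ps k k' : (forall s, fmap (k s) = k' (map tmap s)) ->
  fmap (SeqMInfty ps k) = SeqMInfty (map pmap ps) k'.
Proof.
elim: ps k k' => [|p ps IHps] k k' kk' /=; first exact: kk'.
apply: fmap_LeadCoef => lp; apply: fmap_Size => sp; apply: IHps => lps.
by rewrite kk' /= rmorphN1.
Qed.

Lemma fmap_ChangesPoly ps k k' : (forall z, fmap (k z) = k' z) ->
  fmap (ChangesPoly ps k) = ChangesPoly (map pmap ps) k'.
Proof.
move=> kk'; apply: fmap_SeqMInfty => mps; apply: fmap_SeqPInfty => pps.
by apply: fmap_Changes => vm; apply: fmap_Changes => vp; apply: kk'.
Qed.

Lemma fmap_NextMod p q k k' : (forall r, fmap (k r) = k' (pmap r)) ->
  fmap (NextMod p q k) = NextMod (pmap p) (pmap q) k'.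
Proof.
move=> kk'; apply: fmap_LeadCoef => lq; apply: fmap_Rscal => spq.
by apply: fmap_Rmod => rpq; rewrite kk' pmap_ScalPoly.
Qed.

Lemma fmap_ModsAux p q m k k' : (forall ps, fmap (k ps) = k' (map pmap ps)) ->
  fmap (ModsAux p q m k) = ModsAux (pmap p) (pmap q) m k'.
Proof.
elim: m p q k k' => [|m IHm] p q k k' kk' /=; first exact: kk'.
apply: fmap_Isnull => -[]; first exact: kk'.
by apply: fmap_NextMod => npq; apply: IHm => ps; apply: kk'.
Qed.

Lemma fmap_Mods p q k k' : (forall ps, fmap (k ps) = k' (map pmap ps)) ->
  fmap (Mods p q k) = Mods (pmap p) (pmap q) k'.
Proof.
move=> kk'; apply: (@fmap_Size p) => sp; apply: (@fmap_Size q) => sq.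
exact: fmap_ModsAux.
Qed.

Lemma pmap_PolyComb sq sc : pmap (PolyComb sq sc) = PolyComb (map pmap sq) sc.
Proof.
rewrite /PolyComb size_map; elim: (iota _ _) => //= i s IHs.
rewrite pmap_MulPoly IHs pmap_ExpPoly; congr (MulPoly (ExpPoly _ _) _).
have [lti|gei] := ltnP i (size sq); first by rewrite (nth_map [::]).
by rewrite !nth_default // size_map.
Qed.

Lemma pmap_Pcq sq i : pmap (Pcq sq i) = Pcq (map pmap sq) i.
Proof.
rewrite /Pcq size_map; have [lti|gei] := ltnP i (size (sg_tab (size sq))).
  by rewrite !(nth_map [::]) // pmap_PolyComb.
by rewrite !nth_default // size_map.
Qed.

Lemma fmap_TaqR p q k k' : (forall z, fmap (k z) = k' z) ->
  fmap (TaqR p q k) = TaqR (pmap p) (pmap q) k'.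
Proof.
move=> kk'; rewrite /TaqR -pmap_Deriv -pmap_MulPoly.
by apply: fmap_Mods => r; apply: fmap_ChangesPoly.
Qed.

Lemma fmap_TaqsR p sq i k k' : (forall t, fmap (k t) = k' (tmap t)) ->
  fmap (TaqsR p sq i k) = TaqsR (pmap p) (map pmap sq) i k'.
Proof.
move=> kk'; rewrite /TaqsR -pmap_Pcq; apply: fmap_TaqR => z.
by rewrite kk' /= rmorph_int.
Qed.

Lemma pmap_BoundingPoly sq : pmap (BoundingPoly sq) = BoundingPoly (map pmap sq).
Proof.
rewrite /BoundingPoly pmap_Deriv; congr Deriv.
by elim: sq => //= q sq IHsq; rewrite pmap_MulPoly IHsq.
Qed.

(** These constants are entries of the inverse of an integer matrix, and field morphisms commute
    with matrix inversion. *)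
Lemma rmorph_coefs m i : h (coefs F m i) = coefs K m i.
Proof.
rewrite /coefs; move: (enum _) => s.
have [lti|gei] := ltnP i (size s); last first.
  by rewrite !nth_default ?rmorph0 // size_map.
have j0 : 'I_(3 ^ m) by exact: (nth (cast_ord (esym (exp3n m)) ord0) s i).
rewrite !(nth_map j0) // !castmxE.
have -> A B : h (invmx (map_mx intr A) B (cast_ord (esym (exp3n m)) ord0)) =
  (map_mx h (invmx (map_mx intr A))) B (cast_ord (esym (exp3n m)) ord0).
  by rewrite mxE.
rewrite map_invmx -map_mx_comp; congr (invmx _ _ _).
by apply/matrixP => a b; rewrite !mxE /= rmorph_int.
Qed.

Lemma tmap_Coefs m i : tmap (Coefs F m i) = Coefs K m i.
Proof.
case: m => [|[|m]] /=; rewrite ?rmorph_coefs ?rmorph_nat //.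
congr Const; case: i => [|[|[|i]]] /=;
  by rewrite ?nth_nil ?(fmorphV h) ?(rmorph_nat h) ?(rmorph0 h).
Qed.

Lemma fmap_CcountWeak p sq k k' : (forall t, fmap (k t) = k' (tmap t)) ->
  fmap (CcountWeak p sq k) = CcountWeak (pmap p) (map pmap sq) k'.
Proof.
move=> kk'; rewrite /CcountWeak size_map -[NatConst K 0]/(tmap (NatConst F 0)).
elim: (3 ^ _)%N k k' kk' (NatConst F 0) => [|i IHi] k k' kk' s; first exact: kk'.
apply: fmap_TaqsR => x; rewrite -(tmap_Coefs (size sq) i).
exact: (IHi _ _ kk' (Add (Mul x _) s)).
Qed.

Lemma fmap_CcountGt0 sp sq :
  fmap (CcountGt0 sp sq) = CcountGt0 (map pmap sp) (map pmap sq).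
Proof.
apply: fmap_BigRgcd => p; apply: fmap_Isnull => -[] /=; last first.
  exact: fmap_CcountWeak.
rewrite -pmap_BoundingPoly; apply: fmap_CcountWeak => cw /=; congr (Or _ (Or _ _)).
  elim: sq => //= q sq ->; congr (And _ _); exact: fmap_LeadCoef.
elim: sq => //= q sq ->; congr (And _ _).
by apply: fmap_Size => n; apply: fmap_LeadCoef.
Qed.

End Naturality.

Lemma pmap_abstrX (F K : realFieldType) (h : {rmorphism F -> K}) i t :
  map (tmap h) (abstrX i t) = abstrX i (tmap h t).
Proof.
elim: t => //= [j|t IHt u IHu|t IHt|t IHt m|t IHt u IHu|t IHt m].
- by case: eqP.
- by rewrite pmap_AddPoly IHt IHu.
- by rewrite pmap_OppPoly IHt.
- by rewrite /NatMulPoly pmap_ScalPoly IHt.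
- by rewrite pmap_MulPoly IHt IHu.
- by rewrite pmap_ExpPoly IHt.
Qed.

Section Substitution.

Variable F : realFieldType.

Fixpoint tsubst (s : nat -> qe_rcf.term F) (t : qe_rcf.term F) : qe_rcf.term F :=
  match t with
  | Var i => s i
  | Const c => Const c
  | NatConst m => NatConst F m
  | Add t u => Add (tsubst s t) (tsubst s u)
  | Opp t => Opp (tsubst s t)
  | NatMul t m => NatMul (tsubst s t) m
  | Mul t u => Mul (tsubst s t) (tsubst s u)
  | Exp t m => Exp (tsubst s t) m
  end.

Fixpoint fsubst (s : nat -> qe_rcf.term F) (f : qe_rcf.formula F) :
    qe_rcf.formula F :=
  match f with
  | Bool b => Bool b
  | Equal t u => Equal (tsubst s t) (tsubst s u)
  | Lt t u => Lt (tsubst s t) (tsubst s u)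
  | Le t u => Le (tsubst s t) (tsubst s u)
  | And f g => And (fsubst s f) (fsubst s g)
  | Or f g => Or (fsubst s f) (fsubst s g)
  | Implies f g => Implies (fsubst s f) (fsubst s g)
  | Not f => Not (fsubst s f)
  end.

Lemma eval_tsubst (K : realFieldType) (h : {rmorphism F -> K}) s e e' t :
  (forall i, e'`_i = eval e (tmap h (s i))) ->
  eval e (tmap h (tsubst s t)) = eval e' (tmap h t).
Proof.
move=> es; elim: t => //= [t -> u ->|t ->|t -> m|t -> u ->|t -> m] //.
Qed.

Lemma eval_fsubst (K : realFieldType) (h : {rmorphism F -> K}) s e e' f :
  (forall i, e'`_i = eval e (tmap h (s i))) ->
  qf_eval e (fmap h (fsubst s f)) = qf_eval e' (fmap h f).
Proof.
by move=> es; elim: f => //= [t u|t u|t u|f -> g ->|f -> g ->|f -> g ->|f ->];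
  rewrite ?(eval_tsubst _ es).
Qed.

End Substitution.

Section Elimination.

Variable F : realFieldType.
Implicit Types (g : qe_rcf.formula F) (t : qe_rcf.term F).

(** A conjunction of equations (first list) and strict inequalities (second list) with 0: the shape
    that [CcountGt0] decides. *)
Definition clause := (seq (qe_rcf.term F) * seq (qe_rcf.term F))%type.

Definition clause_eval (K : realFieldType) (h : {rmorphism F -> K}) e
    (c : clause) : bool :=
  all (fun t => eval e (tmap h t) == 0) c.1 &&
  all (fun t => 0 < eval e (tmap h t)) c.2.

(** The clauses have coefficients in [F] but must be correct in every extension [K]; this is what
    keeps the elimination uniform. *)
Definition dnf_of g (D : seq clause) := forall (K : realFieldType)
  (h : {rmorphism F -> K}) e, qf_eval e (fmap h g) = has (clause_eval h e) D.

Lemma dnf_and g1 g2 D1 D2 : dnf_of g1 D1 -> dnf_of g2 D2 ->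
  dnf_of (And g1 g2) [seq (c.1 ++ d.1, c.2 ++ d.2) | c <- D1, d <- D2].
Proof.
move=> gD1 gD2 K h e /=; rewrite gD1 gD2; elim: D1 {gD1} => //= c D1 IH.
rewrite has_cat -IH andb_orl has_map; congr (_ || _).
elim: D2 {gD2 IH} => [|d D2 IH] /=; first by rewrite andbF.
rewrite andb_orr IH; congr (_ || _); rewrite /clause_eval /= !all_cat.
by do 4!case: (all _ _).
Qed.

Lemma dnf_or g1 g2 D1 D2 : dnf_of g1 D1 -> dnf_of g2 D2 ->
  dnf_of (Or g1 g2) (D1 ++ D2).
Proof. by move=> gD1 gD2 K h e /=; rewrite gD1 gD2 has_cat. Qed.

Lemma dnf_eq g g' D : (forall (K : realFieldType) (h : {rmorphism F -> K}) e,
  qf_eval e (fmap h g) = qf_eval e (fmap h g')) -> dnf_of g D -> dnf_of g' D.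
Proof. by move=> gg' gD K h e; rewrite -gg'. Qed.

(** A formula and its negation are normalized together, so that the induction passes through [Not]
    and [Implies]; negated atoms are expressed positively because the order is total. *)
Lemma dnf_exists g : (exists D, dnf_of g D) /\ (exists D, dnf_of (Not g) D).
Proof.
elim: g => [b|t u|t u|t u|f [[D fD] [N fN]] g [[E gE] [M gM]]
  |f [[D fD] [N fN]] g [[E gE] [M gM]]|f [[D fD] [N fN]] g [[E gE] [M gM]]
  |f [[D fD] [N fN]]].
- split; [exists (if b then [:: ([::], [::])] else [::])
         |exists (if b then [::] else [:: ([::], [::])])] => K h e;
  by case: b.
- split; [exists [:: ([:: Add t (Opp u)], [::])]
    |exists [:: ([::], [:: Add t (Opp u)]); ([::], [:: Add u (Opp t)])]];
  move=> K h e; rewrite /clause_eval /= ?orbF ?andbT ?subr_eq0 ?subr_gt0 //.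
  by rewrite neq_lt orbC.
- split; [exists [:: ([::], [:: Add u (Opp t)])]
    |exists [:: ([::], [:: Add t (Opp u)]); ([:: Add u (Opp t)], [::])]];
  move=> K h e; rewrite /clause_eval /= ?orbF ?andbT ?subr_eq0 ?subr_gt0 //.
  by rewrite -leNgt le_eqVlt orbC.
- split; [exists [:: ([::], [:: Add u (Opp t)]); ([:: Add u (Opp t)], [::])]
    |exists [:: ([::], [:: Add t (Opp u)])]];
  move=> K h e; rewrite /clause_eval /= ?orbF ?andbT ?subr_eq0 ?subr_gt0 //.
  + by rewrite le_eqVlt orbC eq_sym.
  + by rewrite ltNge.
- split; first by eexists; apply: dnf_and fD gE.
  exists (N ++ M); apply: dnf_eq (dnf_or fN gM) => K h e /=.
  by rewrite negb_and.
- split; first by eexists; apply: dnf_or fD gE.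
  eexists; apply: dnf_eq (dnf_and fN gM) => K h e /=.
  by rewrite negb_or.
- split; first by eexists; apply: dnf_eq (dnf_or fN gE) => K h e /=; rewrite implybE.
  eexists; apply: dnf_eq (dnf_and fD gM) => K h e /=.
  by rewrite negb_imply.
- split; first by exists N.
  by exists D => K h e; rewrite -fD /= negbK.
Qed.

(* Variable 0 no longer matters once it has been eliminated. *)
Definition unshift (i : nat) : qe_rcf.term F :=
  if i is i'.+1 then Var F i' else NatConst F 0.

Definition clause_elim (c : clause) : qe_rcf.formula F :=
  fsubst unshift (CcountGt0 (map (abstrX 0) c.1) (map (abstrX 0) c.2)).

Lemma clause_elimP (K : rcfType) (h : {rmorphism F -> K}) e c :
  reflect (exists x, clause_eval h (x :: e) c)
    (qf_eval e (fmap h (clause_elim c))).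
Proof.
(* By the choice of [unshift], the formula is evaluated with the dummy value 0 in the slot of the
   eliminated variable. *)
rewrite /clause_elim (@eval_fsubst _ _ _ _ _ (0 :: e)); last by case.
rewrite fmap_CcountGt0 eval_CcountGt0.
apply: (equivP (ccount_gt0P _ _)).
suff E x : clause_eval h (x :: e) c = \big[andb/true]_(p <- map (eval_poly (0 :: e))
      (map (map (tmap h)) (map (abstrX 0) c.1))) (p.[x] == 0) &&
    \big[andb/true]_(q <- map (eval_poly (0 :: e))
      (map (map (tmap h)) (map (abstrX 0) c.2))) (0 < q.[x]).
  by split=> -[x cx]; exists x; move: cx; rewrite E.
rewrite /clause_eval !big_map !big_all; congr (_ && _);
  by apply: eq_all => t; rewrite pmap_abstrX abstrXP.
Qed.

Lemma qf_exists g : exists g', forall (K : rcfType) (h : {rmorphism F -> K}) e,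
  (exists x, qf_eval (x :: e) (fmap h g)) <-> qf_eval e (fmap h g').
Proof.
have [[D gD] _] := dnf_exists g.
suff [g' g'P] : exists g', forall (K : rcfType) (h : {rmorphism F -> K}) e,
    (exists x, has (clause_eval h (x :: e)) D) <-> qf_eval e (fmap h g').
  exists g' => K h e; rewrite -g'P.
  by split=> -[x]; exists x; rewrite ?gD // -gD.
elim: D {gD g} => [|c D [g' g'P]].
  by exists (Bool false) => K h e; split=> // -[].
exists (Or (clause_elim c) g') => K h e /=; split.
  case=> x /orP[cx|Dx]; apply/orP; [left; apply/clause_elimP; by exists x|right].
  by apply/g'P; exists x.
case/orP => [/clause_elimP[x cx]|/g'P[x Dx]]; exists x; by rewrite ?cx ?Dx ?orbT.
Qed.

End Elimination.

(** * Predicates defined by one quantifier-free formula in all real closed extensions *)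

Section Definability.

Variable F : realFieldType.

(** Predicates are given by their meaning in every extension at once. The closure lemmas produce the
    formulas behind them, so that none has to be written out. *)
Definition upred := forall K : rcfType, {rmorphism F -> K} -> seq K -> Prop.
Definition uterm := forall K : rcfType, {rmorphism F -> K} -> seq K -> K.

Implicit Types (P Q : upred) (T U : uterm).

Definition definable P := exists g : qe_rcf.formula F,
  forall K h e, P K h e <-> qf_eval e (fmap h g).

Definition tdefinable T := exists t : qe_rcf.term F,
  forall K h e, T K h e = eval e (tmap h t).

Lemma tdef_var i : tdefinable (fun K h e => e`_i).
Proof. by exists (Var F i). Qed.

Lemma tdef_const c : tdefinable (fun K h e => h c).
Proof. by exists (Const c). Qed.

Lemma tdef_nat m : tdefinable (fun K h e => m%:R).
Proof. by exists (NatConst F m). Qed.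

Lemma tdef_add T U : tdefinable T -> tdefinable U ->
  tdefinable (fun K h e => T K h e + U K h e).
Proof. by move=> [t tP] [u uP]; exists (Add t u) => K h e /=; rewrite tP uP. Qed.

Lemma tdef_mul T U : tdefinable T -> tdefinable U ->
  tdefinable (fun K h e => T K h e * U K h e).
Proof. by move=> [t tP] [u uP]; exists (Mul t u) => K h e /=; rewrite tP uP. Qed.

Lemma tdef_exp T m : tdefinable T -> tdefinable (fun K h e => T K h e ^+ m).
Proof. by move=> [t tP]; exists (Exp t m) => K h e /=; rewrite tP. Qed.

Lemma tdef_sum (I : Type) (r : seq I) (B : pred I) (T : I -> uterm) :
  (forall i, tdefinable (T i)) ->
  tdefinable (fun K h e => \sum_(i <- r | B i) T i K h e).
Proof.
move=> defT; elim: r => [|i r [t tP]].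
  by exists (NatConst F 0) => K h e; rewrite big_nil.
have [u uP] := defT i.
exists (if B i then Add u t else t) => K h e; rewrite big_cons tP.
by case: (B i); rewrite //= uP.
Qed.

Lemma tdef_prod (I : Type) (r : seq I) (B : pred I) (T : I -> uterm) :
  (forall i, tdefinable (T i)) ->
  tdefinable (fun K h e => \prod_(i <- r | B i) T i K h e).
Proof.
move=> defT; elim: r => [|i r [t tP]].
  by exists (NatConst F 1) => K h e; rewrite big_nil.
have [u uP] := defT i.
exists (if B i then Mul u t else t) => K h e; rewrite big_cons tP.
by case: (B i); rewrite //= uP.
Qed.

Lemma def_ext P Q : (forall K h e, P K h e <-> Q K h e) ->
  definable P -> definable Q.
Proof. by move=> PQ [g gP]; exists g => K h e; rewrite -PQ. Qed.

Lemma def_ge0 T : tdefinable T -> definable (fun K h e => 0 <= T K h e).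
Proof. by move=> [t tP]; exists (Le (NatConst F 0) t) => K h e /=; rewrite tP. Qed.

Lemma def_eq T U : tdefinable T -> tdefinable U ->
  definable (fun K h e => T K h e = U K h e).
Proof.
move=> [t tP] [u uP]; exists (Equal t u) => K h e /=; rewrite tP uP.
by split=> /eqP.
Qed.

Lemma def_true : definable (fun K h e => Logic.True).
Proof. by exists (Bool true). Qed.

Lemma def_not P : definable P -> definable (fun K h e => ~ P K h e).
Proof.
by move=> [g gP]; exists (Not g) => K h e /=; rewrite gP; split=> /negP.
Qed.

Lemma def_and P Q : definable P -> definable Q ->
  definable (fun K h e => P K h e /\ Q K h e).
Proof.
move=> [g gP] [g' g'P]; exists (And g g') => K h e /=; rewrite gP g'P.
by split=> /andP.
Qed.

Lemma def_or P Q : definable P -> definable Q ->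
  definable (fun K h e => P K h e \/ Q K h e).
Proof.
move=> [g gP] [g' g'P]; exists (Or g g') => K h e /=; rewrite gP g'P.
by split=> /orP.
Qed.

Lemma def_imp P Q : definable P -> definable Q ->
  definable (fun K h e => P K h e -> Q K h e).
Proof.
move=> [g gP] [g' g'P]; exists (Implies g g') => K h e /=; rewrite gP g'P.
by split=> /implyP.
Qed.

Lemma def_ex P : definable P -> definable (fun K h e => exists x, P K h (x :: e)).
Proof.
move=> [g gP]; have [g' g'P] := qf_exists g; exists g' => K h e.
by rewrite -g'P; split=> -[x]; exists x; apply/gP.
Qed.

Lemma def_all P : definable P -> definable (fun K h e => forall x, P K h (x :: e)).
Proof.
move=> defP; apply: (def_ext _ (def_not (def_ex (def_not defP)))) => K h e.
split=> [nex x|allP [x]]; last by apply; apply: allP.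
by apply: contrapT => nP; apply: nex; exists x.
Qed.

Lemma def_all_seq (I : eqType) (r : seq I) (P : I -> upred) :
  (forall i, definable (P i)) ->
  definable (fun K h e => forall i, i \in r -> P i K h e).
Proof.
move=> defP; elim: r => [|i r IHr]; first by apply: def_ext def_true.
apply: (def_ext _ (def_and (defP i) IHr)) => K h e; split=> [[Pi Pr] j|Pr].
  by rewrite inE => /predU1P[->|/Pr].
by split=> [|j rj]; apply: Pr; rewrite inE ?eqxx // rj orbT.
Qed.

(** The quantified block fills the first [m] slots of the environment, so [P] finds entry [j] of [e]
    at position [m + j]. *)
Lemma def_allb m P : definable P ->
  definable (fun K h e => forall x : 'I_m -> K, P K h ([seq x i | i : 'I_m] ++ e)).
Proof.
elim: m P => [|m IHm] P defP.
  apply: (def_ext _ defP) => K h e.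
  have nil0 (x : 'I_0 -> K) : [seq x i | i : 'I_0] = [::].
    by apply/size0nil; rewrite size_map size_enum_ord.
  by split=> [Pe x|/(_ (fun=> 0))]; rewrite nil0.
apply: (def_ext _ (IHm _ (def_all defP))) => K h e; split=> [Pe x|Pe x a].
  have := Pe (fun i => x (lift ord0 i)) (x ord0).
  by rewrite /image_mem enum_ordSl /= -map_comp.
pose y i := oapp x a (unlift ord0 i).
have := Pe y; rewrite /image_mem enum_ordSl /= -map_comp {1}/y unlift_none /=.
by under eq_map => i do rewrite /= /y liftK /=.
Qed.

Lemma def_exb m P : definable P ->
  definable (fun K h e => exists x : 'I_m -> K, P K h ([seq x i | i : 'I_m] ++ e)).
Proof.
move=> defP; apply: (def_ext _ (def_not (def_allb m (def_not defP)))) => K h e.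
split=> [nall|[x Px] /(_ x)] //.
by apply: contrapT => nex; apply: nall => x Px; apply: nex; exists x.
Qed.

(** Quantifier-free formulas are preserved and reflected by order embeddings, so both sides amount
    to the truth value of the formula in [F], which need not be real closed. *)
Lemma definable_transfer P (K K' : rcfType) (h : {rmorphism F -> K})
    (h' : {rmorphism F -> K'}) e :
  {mono h : x y / x <= y} -> {mono h' : x y / x <= y} -> definable P ->
  P K h (map h e) <-> P K' h' (map h' e).
Proof.
suff gE (L : rcfType) (l : {rmorphism F -> L}) g : {mono l : x y / x <= y} ->
    qf_eval (map l e) (fmap l g) = qf_eval e g.
  by move=> hm h'm [g gP]; rewrite !gP !gE.
move=> lm; have tE t : eval (map l e) (tmap l t) = l (eval e t).
  elim: t => //= [i|m|t -> u ->|t ->|t -> m|t -> u ->|t -> m].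
  - have [lti|gei] := ltnP i (size e); first by rewrite (nth_map 0).
    by rewrite !nth_default ?size_map ?rmorph0.
  - by rewrite rmorph_nat.
  - by rewrite rmorphD.
  - by rewrite rmorphN.
  - by rewrite rmorphMn.
  - by rewrite rmorphM.
  - by rewrite rmorphXn.
elim: g => //= [t u|t u|t u|f -> g ->|f -> g ->|f -> g ->|f ->]; rewrite ?tE //.
- by rewrite (inj_eq (fmorph_inj _)).
- by rewrite !ltNge lm.
Qed.

End Definability.

(** Nonnegative elements of a real closed field are squares, and morphisms preserve squares. *)
Lemma rcf_mono (F : rcfType) (K : realFieldType) (h : {rmorphism F -> K}) :
  {mono h : x y / x <= y}.
Proof.
suff h0 x : (0 <= h x) = (0 <= x) by move=> x y; rewrite -subr_ge0 -rmorphB h0 subr_ge0.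
have hp y : 0 <= y -> 0 <= h y.
  by move=> y0; rewrite -(sqr_sqrtr y0) rmorphXn sqr_ge0.
apply/idP/idP => [|/hp//]; apply: contraTT; rewrite -!ltNge => x0.
rewrite lt_neqAle fmorph_eq0 lt_eqF //=.
by rewrite -oppr_ge0 -rmorphN hp // oppr_ge0 ltW.
Qed.

(** * Ultrapowers of real closed fields *)

(** The field [large_ge] makes the ultrafilter nonprincipal. *)
Record ultrafilter := Ultrafilter {
  large :> (nat -> Prop) -> Prop;
  large_and : forall P Q, large P -> large Q -> large (fun n => P n /\ Q n);
  large_sub : forall P Q : nat -> Prop, (forall n, P n -> Q n) -> large P -> large Q;
  largeF : ~ large (fun=> Logic.False);
  large_or : forall P, large P \/ large (fun n => ~ P n);
  large_ge : forall m, large (fun n => (m <= n)%N)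
}.

Lemma ultrafilter_exists : inhabited ultrafilter.
Proof.
have [U [UU sub]] := @ultraFilterLemma nat _ eventually_filter.
pose L (P : nat -> Prop) := U P.
have UF : ProperFilter U := @ultra_proper _ _ UU.
constructor; apply: (@Ultrafilter L).
- by move=> P Q UP UQ; apply: filterI.
- by move=> P Q PQ; apply: filterS.
- exact: (@filter_not_empty _ _ UF).
- by move=> P; apply: in_ultra_setVsetC.
- by move=> m; apply: sub; exists m.
Qed.


Lemma large_not (U : ultrafilter) P : ~ U P -> U (fun n => ~ P n).
Proof. by case: (large_or U P). Qed.

Lemma large_exists (U : ultrafilter) P : U P -> exists n, P n.
Proof.
move=> UP; apply: contrapT => nex; apply: (@largeF U).
by apply: large_sub UP => n Pn; apply: nex; exists n.
Qed.

Lemma large_all (U : ultrafilter) P : (forall n, P n) -> U P.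
Proof. by move=> Pn; apply: large_sub (large_ge U 0) => n _. Qed.

Section Ultrapower.

Local Open Scope quotient_scope.

Variables (U : ultrafilter) (F : rcfType).
Local Notation seqs := (nat -> F).
Implicit Types f g : seqs.

Definition ueq (f g : seqs) : bool := `[< U (fun n => f n = g n) >].

Fact ueq_refl : reflexive ueq.
Proof. by move=> f; apply/asboolP/large_all. Qed.
Fact ueq_sym : ssrbool.symmetric ueq.
Proof. by move=> f g; apply/asboolP/asboolP; apply: large_sub => n. Qed.
Fact ueq_trans : transitive ueq.
Proof.
move=> g f h /asboolP fg /asboolP gh; apply/asboolP.
by apply: large_sub (large_and fg gh) => n [-> ->].
Qed.

Canonical ueq_equiv := EquivRel ueq ueq_refl ueq_sym ueq_trans.

Definition upow := {eq_quot ueq}.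
HB.instance Definition _ := Choice.on upow.
HB.instance Definition _ := EqQuotient.on upow.

Definition cl (f : seqs) : upow := \pi_upow f.

Lemma clP f g : cl f = cl g <-> U (fun n => f n = g n).
Proof. by split=> [/eqmodP/asboolP|fg]; last by apply/eqmodP/asboolP. Qed.

Lemma cl_repr x : cl (repr x) = x. Proof. exact: reprK. Qed.

Lemma repr_cl f : U (fun n => repr (cl f) n = f n).
Proof. by apply/clP; rewrite cl_repr. Qed.

Lemma clW (P : upow -> Prop) : (forall f, P (cl f)) -> forall x, P x.
Proof. by move=> Pcl x; rewrite -(cl_repr x). Qed.

Definition upow_add (x y : upow) := cl (fun n => repr x n + repr y n).
Definition upow_opp (x : upow) := cl (fun n => - repr x n).
Definition upow_mul (x y : upow) := cl (fun n => repr x n * repr y n).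
Definition upow_inv (x : upow) := cl (fun n => (repr x n)^-1).

Lemma upow_addE f g : upow_add (cl f) (cl g) = cl (fun n => f n + g n).
Proof. by apply/clP; apply: large_sub (large_and (repr_cl f) (repr_cl g)) => n [-> ->]. Qed.
Lemma upow_oppE f : upow_opp (cl f) = cl (fun n => - f n).
Proof. by apply/clP; apply: large_sub (repr_cl f) => n ->. Qed.
Lemma upow_mulE f g : upow_mul (cl f) (cl g) = cl (fun n => f n * g n).
Proof. by apply/clP; apply: large_sub (large_and (repr_cl f) (repr_cl g)) => n [-> ->]. Qed.
Lemma upow_invE f : upow_inv (cl f) = cl (fun n => (f n)^-1).
Proof. by apply/clP; apply: large_sub (repr_cl f) => n ->. Qed.

Fact upow_addA : associative upow_add.
Proof.
elim/clW => f; elim/clW => g; elim/clW => h; rewrite !upow_addE.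
by apply/clP/large_all => n; rewrite addrA.
Qed.
Fact upow_addC : commutative upow_add.
Proof.
elim/clW => f; elim/clW => g; rewrite !upow_addE.
by apply/clP/large_all => n; rewrite addrC.
Qed.
Fact upow_add0 : left_id (cl (fun=> 0)) upow_add.
Proof. by elim/clW => f; rewrite upow_addE; apply/clP/large_all => n; rewrite add0r. Qed.
Fact upow_addN : left_inverse (cl (fun=> 0)) upow_opp upow_add.
Proof.
by elim/clW => f; rewrite upow_oppE upow_addE; apply/clP/large_all => n; rewrite addNr.
Qed.

HB.instance Definition _ := GRing.isZmodule.Build upow
  upow_addA upow_addC upow_add0 upow_addN.

Fact upow_mulA : associative upow_mul.
Proof.
elim/clW => f; elim/clW => g; elim/clW => h; rewrite !upow_mulE.
by apply/clP/large_all => n; rewrite mulrA.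
Qed.
Fact upow_mulC : commutative upow_mul.
Proof.
elim/clW => f; elim/clW => g; rewrite !upow_mulE.
by apply/clP/large_all => n; rewrite mulrC.
Qed.
Fact upow_mul1 : left_id (cl (fun=> 1)) upow_mul.
Proof. by elim/clW => f; rewrite upow_mulE; apply/clP/large_all => n; rewrite mul1r. Qed.
Fact upow_mulDl : left_distributive upow_mul +%R.
Proof.
elim/clW => f; elim/clW => g; elim/clW => h; rewrite /+%R /= !(upow_mulE, upow_addE).
by apply/clP/large_all => n; rewrite mulrDl.
Qed.
Fact upow1_neq0 : cl (fun=> 1) != 0.
Proof.
apply/eqP => /clP /large_exists[_ /eqP]; by rewrite oner_eq0.
Qed.

HB.instance Definition _ := GRing.Zmodule_isComNzRing.Build upow
  upow_mulA upow_mulC upow_mul1 upow_mulDl upow1_neq0.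

Lemma clD f g : cl f + cl g = cl (fun n => f n + g n). Proof. exact: upow_addE. Qed.
Lemma clN f : - cl f = cl (fun n => - f n). Proof. exact: upow_oppE. Qed.
Lemma clM f g : cl f * cl g = cl (fun n => f n * g n). Proof. exact: upow_mulE. Qed.
Lemma clB f g : cl f - cl g = cl (fun n => f n - g n).
Proof. by rewrite clN clD. Qed.
Lemma cl0 : cl (fun=> 0) = 0. Proof. by []. Qed.
Lemma cl1 : cl (fun=> 1) = 1. Proof. by []. Qed.
Lemma clX f m : cl f ^+ m = cl (fun n => f n ^+ m).
Proof.
elim: m => [|m IHm]; first by rewrite expr0 -cl1; apply/clP/large_all.
by rewrite exprS IHm clM; apply/clP/large_all => n; rewrite exprS.
Qed.

Lemma cl_sum (I : Type) (r : seq I) (f : I -> seqs) :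
  \sum_(i <- r) cl (f i) = cl (fun n => \sum_(i <- r) f i n).
Proof.
elim: r => [|i r IHr]; first by rewrite big_nil; apply/clP/large_all => n; rewrite big_nil.
by rewrite big_cons IHr clD; apply/clP/large_all => n; rewrite big_cons.
Qed.

Lemma cl_prod (I : Type) (r : seq I) (f : I -> seqs) :
  \prod_(i <- r) cl (f i) = cl (fun n => \prod_(i <- r) f i n).
Proof.
elim: r => [|i r IHr]; first by rewrite big_nil; apply/clP/large_all => n; rewrite big_nil.
by rewrite big_cons IHr clM; apply/clP/large_all => n; rewrite big_cons.
Qed.

Fact upow_mulV (x : upow) : x != 0 -> upow_inv x * x = 1.
Proof.
move: x; elim/clW => f /eqP f0; rewrite upow_invE clM; apply/clP.
have : ~ U (fun n => f n = 0) by move/clP.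
by move/large_not; apply: large_sub => n /eqP fn; rewrite mulVf.
Qed.

Fact upow_inv0 : upow_inv 0 = 0.
Proof. by rewrite -cl0 upow_invE; apply/clP/large_all => n; rewrite invr0. Qed.

HB.instance Definition _ := GRing.ComNzRing_isField.Build upow upow_mulV upow_inv0.

Definition upow_le (x y : upow) : bool := `[< U (fun n => repr x n <= repr y n) >].
Definition upow_lt (x y : upow) : bool := (y != x) && upow_le x y.
Definition upow_norm (x : upow) := cl (fun n => `|repr x n|).

Lemma upow_leP f g : reflect (U (fun n => f n <= g n)) (upow_le (cl f) (cl g)).
Proof.
apply: (equivP (asboolP _)); have fg := large_and (repr_cl f) (repr_cl g).
by split=> le; apply: large_sub (large_and fg le) => n [[-> ->]].
Qed.

Lemma upow_normE f : upow_norm (cl f) = cl (fun n => `|f n|).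
Proof. by apply/clP; apply: large_sub (repr_cl f) => n ->. Qed.

Fact upow_le0_add x y : upow_le 0 x -> upow_le 0 y -> upow_le 0 (x + y).
Proof.
move: x y; elim/clW => f; elim/clW => g; rewrite -cl0 clD.
move=> /upow_leP f0 /upow_leP g0; apply/upow_leP.
by apply: large_sub (large_and f0 g0) => n [? ?]; apply: addr_ge0.
Qed.
Fact upow_le0_mul x y : upow_le 0 x -> upow_le 0 y -> upow_le 0 (x * y).
Proof.
move: x y; elim/clW => f; elim/clW => g; rewrite -cl0 clM.
move=> /upow_leP f0 /upow_leP g0; apply/upow_leP.
by apply: large_sub (large_and f0 g0) => n [? ?]; apply: mulr_ge0.
Qed.
Fact upow_le0_anti x : upow_le 0 x -> upow_le x 0 -> x = 0.
Proof.
move: x; elim/clW => f; rewrite -cl0 => /upow_leP f0 /upow_leP g0; apply/clP.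
by apply: large_sub (large_and f0 g0) => n [? ?]; apply/le_anti/andP.
Qed.
Fact upow_sub_ge0 x y : upow_le 0 (y - x) = upow_le x y.
Proof.
move: x y; elim/clW => f; elim/clW => g; rewrite -cl0 clB.
by apply/upow_leP/upow_leP; apply: large_sub => n; rewrite subr_ge0.
Qed.
Fact upow_le0_total x : upow_le 0 x || upow_le x 0.
Proof.
move: x; elim/clW => f; rewrite -cl0; apply/orP.
have [f0|f0] := large_or U (fun n => 0 <= f n); [left|right]; apply/upow_leP => //.
by apply: large_sub f0 => n /negP; rewrite -ltNge => /ltW.
Qed.
Fact upow_normN x : upow_norm (- x) = upow_norm x.
Proof.
move: x; elim/clW => f; rewrite clN !upow_normE; apply/clP/large_all => n.
by rewrite normrN.
Qed.
Fact upow_ge0_norm x : upow_le 0 x -> upow_norm x = x.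
Proof.
move: x; elim/clW => f; rewrite -cl0 upow_normE => /upow_leP f0; apply/clP.
by apply: large_sub f0 => n /ger0_norm.
Qed.
Fact upow_lt_def x y : upow_lt x y = (y != x) && upow_le x y. Proof. by []. Qed.

HB.instance Definition _ := Num.IntegralDomain_isLeReal.Build upow
  upow_le0_add upow_le0_mul upow_le0_anti upow_sub_ge0 upow_le0_total
  upow_normN upow_ge0_norm upow_lt_def.

Lemma clle f g : cl f <= cl g <-> U (fun n => f n <= g n).
Proof. by split=> [/upow_leP|fg]; last by apply/upow_leP. Qed.

Lemma cllt f g : cl f < cl g <-> U (fun n => f n < g n).
Proof.
rewrite ltNge; split=> [/negP nle|fg].
  have /large_not : ~ U (fun n => g n <= f n) by move/clle.
  by apply: large_sub => n /negP; rewrite -ltNge.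
apply/negP => /clle gf; have [n [fgn]] := large_exists (large_and fg gf).
by rewrite leNgt fgn.
Qed.

(** The size of [p n] may vary with [n]; the common bound [m] turns all evaluations into sums of the
    same length. *)
Lemma cl_horner (p : nat -> {poly F}) m f (P : {poly upow}) :
  (size P <= m)%N -> (forall n, size (p n) <= m)%N ->
  (forall i, P`_i = cl (fun n => (p n)`_i)) ->
  P.[cl f] = cl (fun n => (p n).[f n]).
Proof.
move=> sP sp Pp; rewrite (horner_coef_wide _ sP).
under eq_bigr => i _ do rewrite Pp clX clM.
rewrite -(big_mkord xpredT (fun i => cl (fun n => (p n)`_i * f n ^+ i))) cl_sum.
by apply/clP/large_all => n; rewrite (horner_coef_wide _ (sp n)) big_mkord.
Qed.

Fact upow_closed : Num.real_closed_axiom upow.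
Proof.
move=> P; elim/clW => a; elim/clW => b /clle ab.
pose p n := \poly_(i < size P) repr P`_i n.
have sp n : (size (p n) <= size P)%N by apply: size_poly.
have Pp i : P`_i = cl (fun n => (p n)`_i).
  rewrite -[LHS]cl_repr; apply/clP; have [lt|ge] := ltnP i (size P).
    by apply: large_all => n; rewrite coef_poly lt.
  rewrite nth_default //; apply: large_sub (repr_cl (fun=> 0)) => n ->.
  by rewrite coef_poly ltnNge ge.
have hP f := cl_horner f (leqnn _) sp Pp.
rewrite !hP -cl0 => /andP[/clle Pa /clle Pb].
(* The intermediate value theorem is applied at each index. Where its hypotheses fail the chosen
   point is arbitrary, which happens on a negligible set only. *)
have /choice[x xP] n : exists x, a n <= b n -> (p n).[a n] <= 0 <= (p n).[b n] ->
    a n <= x <= b n /\ (p n).[x] = 0.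
  have [/andP[le /poly_ivt[//|x xab /rootP px]]|/negP nle] :=
      boolP ((a n <= b n) && ((p n).[a n] <= 0 <= (p n).[b n])).
    by exists x.
  by exists 0 => le le'; case: nle; rewrite le le'.
have xU : U (fun n => a n <= x n <= b n /\ (p n).[x n] = 0).
  apply: large_sub (large_and ab (large_and Pa Pb)) => n [le [l1 l2]].
  by apply: xP; rewrite ?l1.
exists (cl x).
  by apply/andP; split; apply/clle; apply: large_sub xU => n [/andP[]].
by apply/rootP; rewrite hP -cl0; apply/clP; apply: large_sub xU => n [].
Qed.

HB.instance Definition _ := Num.RealField_isClosed.Build upow upow_closed.

Definition uconst (c : F) : upow := cl (fun=> c).

Fact uconst_additive : zmod_morphism uconst.
Proof. by move=> c d; rewrite /uconst clB. Qed.
Fact uconst_multiplicative : monoid_morphism uconst.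
Proof. by split=> // c d; rewrite /uconst clM. Qed.
HB.instance Definition _ := GRing.isZmodMorphism.Build F upow uconst uconst_additive.
HB.instance Definition _ := GRing.isMonoidMorphism.Build F upow uconst uconst_multiplicative.

End Ultrapower.

(** * Levi-Civita fields *)

Section FiniteSum.

Variables (I : eqType) (V : zmodType).
Implicit Types (F : I -> V) (s : seq I).

Definition fcover F s := forall i, F i != 0 -> i \in s.

(** The sum of a family with finitely many nonzero terms, and 0 for all other families. Being total,
    it allows convolution to be defined without carrying supports along. *)
Definition fsum F : V :=
  if pselect (exists s, fcover F s) is left ex
  then \sum_(i <- undup (projT1 (cid ex))) F i else 0.

Lemma fsumE F s : uniq s -> fcover F s -> fsum F = \sum_(i <- s) F i.
Proof.
move=> us cs; rewrite /fsum; case: pselect => [ex|]; last by case; exists s.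
case: cid => /= t ct; rewrite big_mkcond [RHS]big_mkcond /=.
rewrite (bigID (fun i => F i != 0)) [RHS](bigID (fun i => F i != 0)) /=.
rewrite [X in _ + X]big1 ?[X in _ = _ + X]big1;
  try by move=> i; rewrite negbK => /eqP.
congr (_ + _); rewrite -big_filter -[RHS]big_filter; apply/perm_big/uniq_perm.
- by rewrite filter_uniq // undup_uniq.
- by rewrite filter_uniq.
move=> i; rewrite !mem_filter mem_undup.
by case: (boolP (F i != 0)) => // Fi; rewrite ct // cs.
Qed.

Lemma eq_fsum F F' : F =1 F' -> fsum F = fsum F'.
Proof. by move=> /funext ->. Qed.

Lemma fsum0 : fsum (fun=> 0) = 0.
Proof. by rewrite (@fsumE _ [::]) ?big_nil // => i; rewrite eqxx. Qed.

Lemma fsum_neq0 F : fsum F != 0 -> exists i, F i != 0.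
Proof.
apply: contraNP => nex; rewrite -fsum0; apply/eqP/eq_fsum => i.
by apply/eqP; apply: contraPT nex => Fi nex; apply: nex; exists i.
Qed.

Lemma fsum_single F j : (forall i, i != j -> F i = 0) -> fsum F = F j.
Proof.
move=> Fj; rewrite (@fsumE _ [:: j]) ?big_seq1 // => i; rewrite inE.
by apply: contraNT => /Fj ->.
Qed.

Lemma fsumD F F' s s' : fcover F s -> fcover F' s' ->
  fsum (fun i => F i + F' i) = fsum F + fsum F'.
Proof.
move=> cs cs'; have us := undup_uniq (s ++ s').
rewrite !(fsumE us) ?big_split // => i; rewrite mem_undup mem_cat.
- by move=> /cs' ->; rewrite orbT.
- by move=> /cs ->.
apply: contraNT; rewrite negb_or => /andP[/(contraNT (cs i))/eqP-> /(contraNT (cs' i))/eqP->].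
by rewrite addr0.
Qed.

(** Finiteness is not assumed: if [F] has no finite cover, neither has the reindexed family, and
    both sums are 0 by convention. *)
Lemma fsum_reindex F (f g : I -> I) : cancel f g -> cancel g f ->
  fsum (fun i => F (f i)) = fsum F.
Proof.
move=> fK gK; case: (pselect (exists s, fcover F s)) => [[s cs]|ncs].
  have us := undup_uniq s.
  rewrite [RHS](fsumE us) => [|i /cs]; last by rewrite mem_undup.
  rewrite (@fsumE _ (map g (undup s))).
  - by rewrite big_map; apply: eq_bigr => i _; rewrite gK.
  - by rewrite map_inj_uniq //; apply: can_inj gK.
  - by move=> i Fi; apply/mapP; exists (f i); rewrite ?mem_undup ?cs ?fK.
rewrite /fsum; case: pselect => [[s cs]|_]; last by case: pselect => [ex|//]; case: ncs.
case: ncs; exists (map f s) => i Fi; apply/mapP; exists (g i); rewrite ?gK //.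
by apply: cs; rewrite gK.
Qed.

End FiniteSum.

Lemma fsumMl (I : eqType) (A : idomainType) (F : I -> A) c :
  fsum (fun i => c * F i) = c * fsum F.
Proof.
have [->|c0] := eqVneq c 0.
  by rewrite mul0r -[RHS](fsum0 I); apply: eq_fsum => i; rewrite mul0r.
have cE i : (c * F i != 0) = (F i != 0) by rewrite mulf_eq0 negb_or c0.
case: (pselect (exists s, fcover F s)) => [[s cs]|ncs].
  have us := undup_uniq s.
  rewrite !(fsumE us) ?mulr_sumr // => i; rewrite ?cE => /cs; by rewrite mem_undup.
rewrite /fsum; case: pselect => [[s cs]|_]; last first.
  case: pselect => [ex|_]; [by case: ncs | by rewrite mulr0].
by case: ncs; exists s => i Fi; apply: cs; rewrite cE.
Qed.

Lemma exchange_fsum (I J : eqType) (V : zmodType) (F : I -> J -> V)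
    (s : seq I) (t : seq J) :
  (forall i j, F i j != 0 -> (i \in s) && (j \in t)) ->
  fsum (fun i => fsum (F i)) = fsum (fun j => fsum (fun i => F i j)).
Proof.
move=> cF; have us := undup_uniq s; have ut := undup_uniq t.
have inner i : fsum (F i) = \sum_(j <- undup t) F i j.
  by apply: fsumE => // j /cF/andP[_]; rewrite mem_undup.
have inner' j : fsum (fun i => F i j) = \sum_(i <- undup s) F i j.
  by apply: fsumE => // i /cF/andP[]; rewrite mem_undup.
rewrite (fsumE us) => [|i /fsum_neq0[j /cF/andP[]]]; last by rewrite mem_undup.
rewrite (fsumE ut) => [|j /fsum_neq0[i /cF/andP[]]]; last by rewrite mem_undup.
by under eq_bigr do rewrite inner; rewrite exchange_big; under [RHS]eq_bigr do rewrite inner'.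
Qed.

(* An injective additive map to the reals makes [G] an archimedean ordered group,
   for which left-finite supports suffice to get a real closed field. *)
Record weight (R : realType) (G : lmodType rat) := Weight {
  wt :> G -> R;
  wtD : {morph wt : a b / a + b};
  wt_inj : injective wt
}.

Section WeightTheory.

Variables (R : realType) (G : lmodType rat) (w : weight R G).

Lemma wt0 : w 0 = 0.
Proof. by apply: (addrI (w 0)); rewrite -wtD !addr0. Qed.

Lemma wtN a : w (- a) = - w a.
Proof. by apply: (addrI (w a)); rewrite -wtD !subrr wt0. Qed.

Lemma wtB a b : w (a - b) = w a - w b.
Proof. by rewrite wtD wtN. Qed.

Lemma wtMn a m : w (a *+ m) = w a *+ m.
Proof. by elim: m => [|m IHm]; rewrite ?wt0 // !mulrS wtD IHm. Qed.

End WeightTheory.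

(** * The ring of series with left-finite support *)

Section LeviCivita.

Variables (R : realType) (G : lmodType rat) (w : weight R G) (k : fieldType).

Definition lfin (f : G -> k) := forall B : R,
  exists s : seq G, forall a, f a != 0 -> w a < B -> a \in s.

Record lcs := LCS { lcf :> G -> k; lcfP : lfin lcf }.

Implicit Types (f g : G -> k) (x y z : lcs).

Lemma lcs_eqP x y : x =1 y -> x = y.
Proof.
case: x y => f fP [g gP] /= /funext fg; subst g.
by rewrite (Prop_irrelevance fP gP).
Qed.

HB.instance Definition _ := gen_eqMixin lcs.
HB.instance Definition _ := gen_choiceMixin lcs.

Lemma lfin0 : lfin (fun=> 0).
Proof. by move=> B; exists [::] => a; rewrite eqxx. Qed.

Lemma lfinD f g : lfin f -> lfin g -> lfin (fun a => f a + g a).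
Proof.
move=> fP gP B; have [s sP] := fP B; have [t tP] := gP B.
exists (s ++ t) => a fga aB; rewrite mem_cat.
have [/sP->//|/negbNE/eqP fa0] := boolP (f a != 0).
by rewrite (tP _ _ aB) ?orbT //; apply: contraNN fga => /eqP->; rewrite fa0 addr0.
Qed.

Lemma lfinN f : lfin f -> lfin (fun a => - f a).
Proof. by move=> fP B; have [s sP] := fP B; exists s => a; rewrite oppr_eq0; apply: sP. Qed.

Definition lcs0 := LCS lfin0.
Definition lcsD x y := LCS (lfinD (lcfP x) (lcfP y)).
Definition lcsN x := LCS (lfinN (lcfP x)).

Fact lcsDA : associative lcsD.
Proof. by move=> x y z; apply: lcs_eqP => a /=; rewrite addrA. Qed.
Fact lcsDC : commutative lcsD.
Proof. by move=> x y; apply: lcs_eqP => a /=; rewrite addrC. Qed.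
Fact lcs0D : left_id lcs0 lcsD.
Proof. by move=> x; apply: lcs_eqP => a /=; rewrite add0r. Qed.
Fact lcsND : left_inverse lcs0 lcsN lcsD.
Proof. by move=> x; apply: lcs_eqP => a /=; rewrite addNr. Qed.

HB.instance Definition _ := GRing.isZmodule.Build lcs lcsDA lcsDC lcs0D lcsND.

Lemma lcsDE x y a : (x + y) a = x a + y a. Proof. by []. Qed.
Lemma lcsNE x a : (- x) a = - x a. Proof. by []. Qed.
Lemma lcs0E a : (0 : lcs) a = 0. Proof. by []. Qed.

Lemma lcs_sumE (I : Type) (r : seq I) (P : pred I) (x : I -> lcs) a :
  (\sum_(i <- r | P i) x i) a = \sum_(i <- r | P i) x i a.
Proof. exact: (big_morph (fun x : lcs => x a) (fun x y => lcsDE x y a) (lcs0E a)). Qed.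

(** The valuation of [f] is at least [B]. As a mere lower bound it also makes sense for the zero
    series. *)
Definition vge (f : G -> k) (B : R) := forall a, w a < B -> f a = 0.

Lemma vge_exists f : lfin f -> exists B, vge f B.
Proof.
move=> fP; have [s sP] := fP 0.
(* Exponents of negative weight in the support all lie in [s], so the least of 0 and the weights in
   [s] is a lower bound. *)
exists (foldr Num.min 0 (map w s)) => a aB; apply/eqP; apply: contraLR aB => fa.
rewrite -leNgt; have [a0|] := ltP (w a) 0; last first.
  move=> a0; apply: le_trans a0; elim: s {sP} => //= b s IH.
  by rewrite ge_min IH orbT.
have := sP _ fa a0; elim: s {sP} => //= b s IH; rewrite inE => /predU1P[->|/IH].
  by rewrite ge_min lexx.
by rewrite ge_min => ->; rewrite orbT.
Qed.

Definition conv f g c := fsum (fun a => f a * g (c - a)).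

Lemma vge_nz f B a : vge f B -> f a != 0 -> B <= w a.
Proof. by move=> fB; apply: contraNT; rewrite -ltNge => /fB ->. Qed.

Lemma conv_cover f g c : lfin f -> lfin g ->
  exists s, fcover (fun a => f a * g (c - a)) s.
Proof.
move=> fP gP; have [B gB] := vge_exists gP; have [s sP] := fP (w c - B + 1).
exists s => a; rewrite mulf_eq0 negb_or => /andP[fa /(vge_nz gB)].
by rewrite wtB => le; apply: sP fa _; rewrite ltr_pwDr // lerBrDr -lerBrDl.
Qed.

Lemma lfin_conv f g : lfin f -> lfin g -> lfin (conv f g).
Proof.
move=> fP gP B; have [Bf fB] := vge_exists fP; have [Bg gB] := vge_exists gP.
(* If [a] and [b] contribute to a coefficient of weight below [B], then [Bg <= w b] gives
   [w a < B - Bg], and symmetrically for [b]. *)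
have [s sP] := fP (B - Bg); have [t tP] := gP (B - Bf).
exists [seq a + b | a <- s, b <- t] => c /fsum_neq0[a].
rewrite mulf_eq0 negb_or => /andP[fa gca] cB.
apply/allpairsP; exists (a, c - a); split; rewrite //= ?[a + _]addrC ?subrK //.
  apply: sP => //; have := vge_nz gB gca; rewrite wtB => le.
  by rewrite ltrBrDr; apply: le_lt_trans cB; rewrite -lerBrDl.
apply: tP => //; have := vge_nz fB fa; rewrite wtB => le.
by apply: ltr_leB.
Qed.

Definition lcsM x y := LCS (lfin_conv (lcfP x) (lcfP y)).

Definition monomial (c : k) (a : G) : G -> k := fun b => if b == a then c else 0.

Lemma lfin_mono c a : lfin (monomial c a).
Proof. by move=> B; exists [:: a] => b; rewrite inE /monomial; case: (b == a); rewrite ?eqxx. Qed.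

Definition lcs_mono c a := LCS (@lfin_mono c a).

Lemma conv_mono c a g b : conv (monomial c a) g b = c * g (b - a).
Proof.
rewrite /conv (fsum_single (j := a)) /monomial ?eqxx // => i /negPf->.
by rewrite mul0r.
Qed.

Fact lcsMC : commutative lcsM.
Proof.
move=> x y; apply: lcs_eqP => c /=; rewrite /conv.
rewrite -(fsum_reindex (fun a => x a * y (c - a)) (f := fun a => c - a) (g := fun a => c - a)).
- by apply: eq_fsum => a; rewrite subKr mulrC.
- exact: subKr.
- exact: subKr.
Qed.

Fact lcsMA : associative lcsM.
Proof.
move=> x y z; apply: lcs_eqP => d /=; rewrite /conv.
have [Bx xB] := vge_exists (lcfP x); have [By yB] := vge_exists (lcfP y).
have [Bz zB] := vge_exists (lcfP z).
(* In a nonzero term the three exponents add up to [d], so each weight is at most [w d] minus the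
   lower bounds of the other two; the summand 1 makes the inequality strict. *)
have [s sP] := lcfP x (w d - Bz - By + 1).
have [t tP] := lcfP y (w d - Bz - Bx + 1).
pose F a b := x a * (y (b - a) * z (d - b)).
transitivity (fsum (fun a => fsum (F a))).
  apply: eq_fsum => a; rewrite -fsumMl.
  rewrite -(fsum_reindex (F a) (f := fun b => b + a) (g := fun b => b - a)).
  - by apply: eq_fsum => b; rewrite /F addrK [b + a]addrC opprD addrA.
  - by move=> b; rewrite addrK.
  - by move=> b; rewrite subrK.
rewrite (@exchange_fsum _ _ _ _ s [seq a + b | a <- s, b <- t]) => [|a b].
  apply: eq_fsum => b; rewrite mulrC -fsumMl; apply: eq_fsum => a.
  by rewrite /F mulrA mulrC.
rewrite /F !mulf_eq0 !negb_or => /and3P[xa yba zdb].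
have := vge_nz xB xa; have := vge_nz yB yba; have := vge_nz zB zdb.
rewrite !wtB => z1 y1 x1; apply/andP.
have sa : a \in s.
  by apply: sP => //; lra.
split=> //; apply/allpairsP; exists (a, b - a); split=> //=; last by rewrite addrC subrK.
by apply: tP => //; rewrite wtB; lra.
Qed.

Fact lcs1M : left_id (lcs_mono 1 0) lcsM.
Proof. by move=> x; apply: lcs_eqP => a /=; rewrite conv_mono mul1r subr0. Qed.

Fact lcsMDl : left_distributive lcsM lcsD.
Proof.
move=> x y z; apply: lcs_eqP => c /=; rewrite /conv.
have [s cs] := conv_cover c (lcfP x) (lcfP z).
have [t ct] := conv_cover c (lcfP y) (lcfP z).
by rewrite -(fsumD cs ct); apply: eq_fsum => a; rewrite mulrDl.
Qed.

Fact lcs1_neq0 : lcs_mono 1 0 != lcs0.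
Proof.
apply/eqP => /(congr1 (fun x : lcs => x 0)) /=.
by rewrite /monomial eqxx => /eqP; rewrite oner_eq0.
Qed.

HB.instance Definition _ := GRing.Zmodule_isComNzRing.Build lcs
  lcsMA lcsMC lcs1M lcsMDl lcs1_neq0.

End LeviCivita.

(** * Valuation, successive approximation and inverses *)

Section Valuation.

Variables (R : realType) (G : lmodType rat) (w : weight R G) (k : fieldType).
Local Notation K := (lcs w k).
Implicit Types (x y z : K) (a b : G) (B : R).
Local Notation vge x B := (@vge R G w k (lcf x) B).

Lemma lcsME x y c : (x * y) c = fsum (fun a => x a * y (c - a)).
Proof. by []. Qed.

Lemma vgeW B B' x : B' <= B -> vge x B -> vge x B'.
Proof. by move=> BB' xB a aB; apply: xB; apply: lt_le_trans BB'. Qed.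

Lemma vgeD B x y : vge x B -> vge y B -> vge (x + y) B.
Proof. by move=> xB yB a aB; rewrite lcsDE xB // yB // addr0. Qed.

Lemma vgeN B x : vge x B -> vge (- x) B.
Proof. by move=> xB a aB; rewrite lcsNE xB // oppr0. Qed.

Lemma vgeB B x y : vge x B -> vge y B -> vge (x - y) B.
Proof. by move=> xB yB; apply: vgeD xB (vgeN yB). Qed.

Lemma vge_sum B (I : Type) (r : seq I) (P : pred I) (x : I -> K) :
  (forall i, P i -> vge (x i) B) -> vge (\sum_(i <- r | P i) x i) B.
Proof. by move=> xB; apply: (big_ind (fun x : K => vge x B)) => // ? ?; apply: vgeD. Qed.

Lemma vgeM B B' x y : vge x B -> vge y B' -> vge (x * y) (B + B').
Proof.
move=> xB yB' c cB; apply/eqP; apply: contraTT cB => /fsum_neq0[a].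
rewrite mulf_eq0 negb_or -leNgt => /andP[/(vge_nz xB) + /(vge_nz yB')].
by rewrite wtB; lra.
Qed.

(** Any other pair of exponents with sum [a + b] would have a weight below [w a] or [w b]; this uses
    that [w] is injective. *)
Lemma mul_lead a b x y : vge x (w a) -> vge y (w b) -> (x * y) (a + b) = x a * y b.
Proof.
move=> xa yb; rewrite lcsME (fsum_single (j := a)) => [|c]; first by rewrite [a + b]addrC addrK.
apply: contraNeq; rewrite mulf_eq0 negb_or => /andP[/(vge_nz xa) + /(vge_nz yb)].
by rewrite wtB wtD => ac ca; apply/eqP/(@wt_inj _ _ w)/le_anti; rewrite ac andbT; lra.
Qed.

Lemma lead_exists x : x != 0 -> exists2 a, x a != 0 & vge x (w a).
Proof.
move=> x0; have [b xb] : exists b, x b != 0.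
  apply: contraPP x0 => nex; apply/negP; rewrite negbK; apply/eqP/lcs_eqP => b.
  by apply/eqP; apply: contraPT nex => xb; apply; exists b.
have [s sP] := lcfP x (w b).
suff [a xa aP] : exists2 a, x a != 0 & forall c, x c != 0 -> c \in b :: s -> w a <= w c.
  exists a => // c ca; apply/eqP; apply: contraTT ca => xc; rewrite -leNgt.
  have [cb|bc] := ltP (w c) (w b); first by rewrite aP // inE sP ?orbT.
  by apply: le_trans bc; apply: aP => //; rewrite inE eqxx.
elim: (s) => [|c t [a xa aP]].
  by exists b => // c _; rewrite inE => /eqP->.
have [xc0|xc] := eqVneq (x c) 0.
  exists a => // d xd; rewrite !inE orbCA => /predU1P[dc|db].
    by rewrite dc xc0 eqxx in xd.
  by apply: aP; rewrite ?inE.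
have [ac|ca] := leP (w a) (w c).
  exists a => // d xd; rewrite !inE orbCA => /predU1P[->//|db].
  by apply: aP; rewrite ?inE.
exists c => // d xd; rewrite !inE orbCA => /predU1P[->//|db].
by apply: le_trans (ltW ca) (aP _ _ _); rewrite ?inE.
Qed.

(** Left-finiteness keeps the valuation away from 0 once the constant term vanishes. The gap [d] is
    the contraction rate in later uses of [fixed_point]. *)
Lemma vge_gap x : vge x 0 -> x 0 = 0 -> exists2 d : R, 0 < d & vge x d.
Proof.
move=> xge x00; have [->|/lead_exists[a xa xla]] := eqVneq x 0.
  by exists 1.
exists (w a) => //; rewrite lt_neqAle (vge_nz xge xa) andbT -(wt0 w).
by apply: contraNneq xa => /wt_inj <-; rewrite x00.
Qed.

Lemma vge_all x : (forall B, vge x B) -> x = 0.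
Proof. by move=> xB; apply: lcs_eqP => a; apply: (xB (w a + 1)); rewrite ltrDl. Qed.

(* Successive approximation: the coefficient of exponent [a] of the iterates is
   eventually constant, which replaces completeness. *)
Lemma fixed_point (I : Type) (d : R) (T : (I -> K) -> (I -> K)) : 0 < d ->
  (forall x : I -> K, (forall i, vge (x i) d) -> forall i, vge (T x i) d) ->
  (forall (x y : I -> K) B, (forall i, vge (x i) d) -> (forall i, vge (y i) d) ->
    (forall i, vge (x i - y i) B) -> forall i, vge (T x i - T y i) (B + d)) ->
  exists x : I -> K, (forall i, vge (x i) d) /\ T x = x.
Proof.
move=> d0 Td Tc; pose u n := iter n T (fun=> 0).
have ud n i : vge (u n i) d.
  by elim: n i => [|n IHn] // i; apply: Td.
have uS n i : vge (u n.+1 i - u n i) (d *+ n.+1).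
  elim: n i => [|n IHn] i; first by rewrite subr0; apply: ud.
  by rewrite mulrSr; apply: (Tc (u n.+1) (u n) _ (ud _) (ud _) IHn i).
have uB n m i : (n <= m)%N -> vge (u m i - u n i) (d *+ n.+1).
  move=> /subnK<-; elim: (m - n)%N => [|p IHp]; first by rewrite subrr.
  rewrite addSn -[u _ i](subrK (u (p + n)%N i)) -addrA; apply: (vgeD _ IHp).
  by apply: vgeW (uS _ i); rewrite ler_pMn2l // ltnS leq_addl.
(* From iterate [N B] on, the coefficients of weight below [B] no longer change. *)
pose N B := Num.bound (B / d).
have NP B : B < d *+ (N B).+1.
  have := archi_boundP (ltW d0 : 0 <= d); have := ler_norm (B / d).
  have [B0|B0] := ltP B 0.
    by move=> _ _; apply: lt_le_trans B0 _; rewrite mulrn_wge0 // ltW.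
  move=> _ _; rewrite -mulr_natr mulrC -ltr_pdivrMr //.
  by apply: lt_le_trans (archi_boundP (divr_ge0 B0 (ltW d0))) _; rewrite ler_nat leqnSn.
have uN i a n : w a < d *+ n.+1 -> u n i a = u (N (w a)) i a.
  move=> an; apply/eqP; rewrite -subr_eq0; apply/eqP.
  have [le|/ltnW le] := leqP n (N (w a)).
    by rewrite -[LHS]opprK opprB; apply/eqP; rewrite oppr_eq0; apply/eqP;
       apply: (uB _ _ i le).
  by apply: (uB _ _ i le); apply: NP.
have lP i : lfin w (fun a => u (N (w a)) i a).
  move=> B; have [s sP] := lcfP (u (N B) i) B; exists s => a.
  move=> ua aB; apply: sP => //; rewrite uN //.
  exact: lt_trans aB (NP B).
pose l i := LCS (lP i).
have lB n i : vge (l i - u n i) (d *+ n.+1).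
  by move=> a an; rewrite lcsDE lcsNE /= -(uN i a n) // subrr.
have ld i : vge (l i) d.
  by rewrite -[l i](subrK (u 0%N i)); apply: vgeD (lB 0%N i) (ud _ _).
(* For every [B], both [T l] and [l] agree with the iterate of index [(N B).+1] below weight [B]. *)
exists l; split=> //; apply/funext => i; apply/subr0_eq/vge_all => B.
apply: (@vgeW (d *+ (N B).+1)); first exact: ltW (NP B).
rewrite -[T l i](subrK (u (N B).+1 i)) -addrA; apply: vgeD.
  by apply: vgeW (Tc _ _ _ ld (ud (N B)) (lB (N B)) i); rewrite lerDl ltW.
by rewrite -opprB; apply/vgeN/(vgeW _ (lB _ _)); rewrite ler_pMn2l.
Qed.

Definition lcC (c : k) : K := lcs_mono w c 0.
Definition lcT (a : G) : K := lcs_mono w 1 a.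

Lemma lcC_mulE c x a : (lcC c * x) a = c * x a.
Proof. by rewrite /= conv_mono subr0. Qed.

Lemma lcT_mulE b x a : (lcT b * x) a = x (a - b).
Proof. by rewrite /= conv_mono mul1r. Qed.

Lemma lcCE c a : lcC c a = if a == 0 then c else 0. Proof. by []. Qed.
Lemma lcTE b a : lcT b a = (a == b)%:R. Proof. by rewrite /= /monomial; case: (a == b). Qed.

Fact lcC_additive : zmod_morphism lcC.
Proof.
by move=> c d; apply: lcs_eqP => a; rewrite lcsDE lcsNE !lcCE; case: eqP; rewrite ?subr0.
Qed.
Fact lcC_multiplicative : monoid_morphism lcC.
Proof.
split=> // c d; apply: lcs_eqP => a; rewrite lcC_mulE !lcCE.
by case: eqP; rewrite ?mulr0.
Qed.
HB.instance Definition _ := GRing.isZmodMorphism.Build k K lcC lcC_additive.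
HB.instance Definition _ := GRing.isMonoidMorphism.Build k K lcC lcC_multiplicative.

Lemma lcT0 : lcT 0 = 1. Proof. by []. Qed.

Lemma lcTD a b : lcT (a + b) = lcT a * lcT b.
Proof.
by apply: lcs_eqP => c; rewrite lcT_mulE !lcTE subr_eq addrC.
Qed.

Lemma lcTX a m : lcT (a *+ m) = lcT a ^+ m.
Proof. by elim: m => // m IHm; rewrite mulrS lcTD IHm exprS. Qed.

Lemma lcTVK a : lcT (- a) * lcT a = 1.
Proof. by rewrite -lcTD addNr. Qed.

Lemma vge_lcC c : vge (lcC c) 0.
Proof. by move=> a; rewrite -(wt0 w) lcCE => a0; case: eqP a0 => // ->; rewrite ltxx. Qed.

Lemma vge_lcT a : vge (lcT a) (w a).
Proof. by move=> b ba; rewrite lcTE; case: eqP ba => // ->; rewrite ltxx. Qed.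

Lemma vge_lcC_mul c x B : vge x B -> vge (lcC c * x) B.
Proof. by move=> xB a aB; rewrite lcC_mulE xB // mulr0. Qed.

(** Dividing [x] by its leading term leaves [1 - u] with [u] of positive valuation. The fixed point
    of [y = u * (1 + y)] gives the geometric series [1 + y], the inverse of [1 - u]. *)
Lemma inv_exists x : x != 0 -> exists y, y * x = 1.
Proof.
case/lead_exists=> a xa xla; pose u := 1 - lcC (x a)^-1 * lcT (- a) * x.
have uge : vge u 0.
  apply: vgeB; first exact: vge_lcC.
  rewrite -mulrA; apply: vge_lcC_mul.
  by apply: vgeW (vgeM (@vge_lcT (- a)) xla); rewrite wtN addNr.
have u0 : u 0 = 0.
  rewrite lcsDE lcsNE -mulrA lcC_mulE lcT_mulE opprK add0r mulVf //.
  by rewrite /= /monomial eqxx subrr.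
have [d d0 ud] := vge_gap uge u0.
have [||y [yd yE]] := @fixed_point unit d (fun (y : unit -> K) i => u * (1 + y i)) d0.
- move=> y yd i; rewrite -[d]addr0; apply: vgeM ud (vgeD (vge_lcC 1) _).
  exact: vgeW (ltW d0) (yd i).
- move=> y z B yd zd yz i; rewrite -mulrBr opprD addrACA subrr add0r [B + d]addrC.
  exact: vgeM ud (yz i).
have {}yE : y tt = u * (1 + y tt) by rewrite -{1}yE.
exists ((1 + y tt) * (lcC (x a)^-1 * lcT (- a))); rewrite -mulrA.
rewrite (_ : _ * _ * x = 1 - u); last by rewrite opprB addrC subrK.
by rewrite mulrBr mulr1 [_ * u]mulrC -yE addrK.
Qed.

Definition lcinv x : K := if pselect (exists y, y * x = 1) is left ex
  then projT1 (cid ex) else 0.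

Fact lcmulVf x : x != 0 -> lcinv x * x = 1.
Proof.
move=> /inv_exists ex; rewrite /lcinv; case: pselect => // ex'.
by case: cid.
Qed.

Fact lcinv0 : lcinv 0 = 0.
Proof.
rewrite /lcinv; case: pselect => // ex; exfalso.
by case: ex => y /eqP; rewrite mulr0 eq_sym oner_eq0.
Qed.

HB.instance Definition _ := GRing.ComNzRing_isField.Build K lcmulVf lcinv0.

End Valuation.

(** * The order given by the sign of the leading coefficient *)

Section Ordering.

Variables (R : realType) (G : lmodType rat) (w : weight R G) (k : realFieldType).
Local Notation K := (lcs w k).
Local Notation vge x B := (@vge R G w k (lcf x) B).
Implicit Types x y : K.

Definition lcpos x := exists2 a, 0 < x a & vge x (w a).
Definition lcge0 x : bool := (x == 0) || `[< lcpos x >].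
Definition lcle x y := lcge0 (y - x).
Definition lclt x y := (y != x) && lcle x y.
Definition lcnorm x := if lcge0 x then x else - x.

Lemma lcposD x y : lcpos x -> lcpos y -> lcpos (x + y).
Proof.
move=> [a xa xla] [b yb ylb]; have [ab|ba|/wt_inj ab] := ltgtP (w a) (w b).
- exists a; last by apply: vgeD xla (vgeW (ltW ab) ylb).
  by rewrite lcsDE ylb // addr0.
- exists b; last by apply: vgeD (vgeW (ltW ba) xla) ylb.
  by rewrite lcsDE xla // add0r.
- subst b; exists a; last exact: vgeD.
  by rewrite lcsDE addr_gt0.
Qed.

Lemma lcposM x y : lcpos x -> lcpos y -> lcpos (x * y).
Proof.
move=> [a xa xla] [b yb ylb]; exists (a + b); first by rewrite mul_lead // mulr_gt0.
by rewrite wtD; apply: vgeM.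
Qed.

Lemma lcpos_total x : [\/ x = 0, lcpos x | lcpos (- x)].
Proof.
have [->|/lead_exists[a xa xla]] := eqVneq x 0; first by constructor.
have [xa0|xa0|xa0] := ltgtP 0 (x a); last by rewrite -xa0 eqxx in xa.
  by constructor 2; exists a.
by constructor 3; exists a; [rewrite lcsNE oppr_gt0 | apply: vgeN].
Qed.

Lemma lcposN x : lcpos x -> ~ lcpos (- x).
Proof.
move=> xp /(lcposD xp)[a]; by rewrite subrr lcs0E ltxx.
Qed.

Lemma lcpos_neq0 x : lcpos x -> x != 0.
Proof. by move=> [a + _]; apply: contraTneq => ->; rewrite lcs0E ltxx. Qed.

Lemma lcge0P x : reflect (x = 0 \/ lcpos x) (lcge0 x).
Proof. by apply: (iffP orP) => -[/eqP|/asboolP]; auto; right; apply/asboolP. Qed.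

Fact lcle0_add x y : lcle 0 x -> lcle 0 y -> lcle 0 (x + y).
Proof.
rewrite /lcle !subr0 => /lcge0P[->|xp] /lcge0P[->|yp]; rewrite ?addr0 ?add0r;
  apply/lcge0P; auto.
by right; apply: lcposD.
Qed.

Fact lcle0_mul x y : lcle 0 x -> lcle 0 y -> lcle 0 (x * y).
Proof.
rewrite /lcle !subr0 => /lcge0P[->|xp] /lcge0P[->|yp]; rewrite ?mulr0 ?mul0r;
  apply/lcge0P; auto.
by right; apply: lcposM.
Qed.

Fact lcle0_anti x : lcle 0 x -> lcle x 0 -> x = 0.
Proof.
by rewrite /lcle subr0 sub0r => /lcge0P[//|xp] /lcge0P[/eqP|/(lcposN xp)//];
  rewrite oppr_eq0 => /eqP.
Qed.

Fact lcsub_ge0 x y : lcle 0 (y - x) = lcle x y.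
Proof. by rewrite /lcle subr0. Qed.

Fact lcle0_total x : lcle 0 x || lcle x 0.
Proof.
rewrite /lcle subr0 sub0r; apply/orP.
case: (lcpos_total x) => [->|xp|xn].
- by left; apply/lcge0P; left.
- by left; apply/lcge0P; right.
- by right; apply/lcge0P; right.
Qed.

Fact lcnormN x : lcnorm (- x) = lcnorm x.
Proof.
have pE y : lcpos y -> lcge0 y /\ lcge0 (- y) = false.
  move=> yp; split; first by apply/lcge0P; right.
  apply/lcge0P => -[y0|/(lcposN yp)//].
  by have := lcpos_neq0 yp; rewrite -oppr_eq0 y0 eqxx.
rewrite /lcnorm opprK; case: (lcpos_total x) => [->|/pE[-> ->]//|/pE].
  by rewrite oppr0 if_same.
by rewrite opprK => -[-> ->].
Qed.

Fact lcge0_norm x : lcle 0 x -> lcnorm x = x.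
Proof. by rewrite /lcle subr0 /lcnorm => ->. Qed.

Fact lclt_def x y : lclt x y = (y != x) && lcle x y. Proof. by []. Qed.

HB.instance Definition _ := Num.IntegralDomain_isLeReal.Build K
  lcle0_add lcle0_mul lcle0_anti lcsub_ge0 lcle0_total lcnormN lcge0_norm lclt_def.

Lemma lcs_gt0P x : reflect (lcpos x) (0 < x).
Proof.
rewrite /Order.lt /= /lclt /lcle subr0.
apply: (iffP andP) => [[x0 /lcge0P[xE|//]]|xp]; first by rewrite xE eqxx in x0.
by split; [apply: lcpos_neq0|apply/lcge0P; right].
Qed.

End Ordering.

(** * Hensel's lemma for monic polynomials *)

Section Hensel.

Variables (R : realType) (G : lmodType rat) (w : weight R G) (k : fieldType).
Local Notation K := (lcs w k).
Local Notation vge x B := (@vge R G w k (lcf x) B).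
Local Notation C := (@lcC R G w k).
Implicit Types (x y : K) (P Q N : {poly K}) (p q : {poly k}) (a : G) (B : R).

(** A polynomial over the series is read as a series of polynomials over [k], of which this is the
    coefficient at exponent [a]. On polynomials with [pvge P 0], [slice 0] is the reduction to the
    residue field. *)
Definition slice a P : {poly k} := map_poly (fun x : K => x a) P.

Lemma coef_slice a P i : (slice a P)`_i = P`_i a.
Proof. exact: coef_map_id0. Qed.

Lemma size_slice a P : (size (slice a P) <= size P)%N.
Proof. by apply/leq_sizeP => i iP; rewrite coef_slice nth_default. Qed.

Lemma slice_inj P Q : (forall a, slice a P = slice a Q) -> P = Q.
Proof.
by move=> PQ; apply/polyP => i; apply: lcs_eqP => a; rewrite -!coef_slice PQ.
Qed.

Lemma sliceD a P Q : slice a (P + Q) = slice a P + slice a Q.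
Proof. by apply/polyP => i; rewrite coefD !coef_slice coefD. Qed.

Lemma sliceN a P : slice a (- P) = - slice a P.
Proof. by apply/polyP => i; rewrite coefN !coef_slice coefN. Qed.

Lemma slice_mulC a P q : slice a (P * map_poly C q) = slice a P * q.
Proof.
apply/polyP => i; rewrite coef_slice !coefM lcs_sumE; apply: eq_bigr => j _.
by rewrite coef_slice coef_map mulrC lcC_mulE mulrC.
Qed.

Lemma slice0_mulCC p q : slice 0 (map_poly C p * map_poly C q) = p * q.
Proof.
rewrite slice_mulC; congr (_ * q); apply/polyP => i.
by rewrite coef_slice coef_map lcCE eqxx.
Qed.

Lemma lfin_slice P B : exists s : seq G, forall a, slice a P != 0 -> w a < B -> a \in s.
Proof.
elim/poly_ind: P => [|P x [s sP]].
  exists [::] => a; rewrite (_ : slice a 0 = 0) ?eqxx //.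
  by apply/polyP => i; rewrite coef_slice !coef0.
have [t tP] := lcfP x B; exists (s ++ t) => a sa aB; rewrite mem_cat.
have [xa|xa] := eqVneq (x a) 0; last by rewrite tP ?orbT.
rewrite sP //; apply: contraNneq sa => Pa; apply/eqP/polyP => -[|i];
  rewrite coef_slice coefD coefC coefMX coef0 /= ?add0r ?addr0 //.
by rewrite -coef_slice Pa coef0.
Qed.

Definition pvge P B := forall i, vge P`_i B.

Lemma pvge_slice P B a : pvge P B -> w a < B -> slice a P = 0.
Proof. by move=> PB aB; apply/polyP => i; rewrite coef_slice coef0 PB. Qed.

Lemma pvgeD P Q B : pvge P B -> pvge Q B -> pvge (P + Q) B.
Proof. by move=> PB QB i; rewrite coefD; apply: vgeD. Qed.

Lemma pvgeN P B : pvge P B -> pvge (- P) B.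
Proof. by move=> PB i; rewrite coefN; apply: vgeN. Qed.

Lemma pvgeM P Q B B' : pvge P B -> pvge Q B' -> pvge (P * Q) (B + B').
Proof. by move=> PB QB i; rewrite coefM; apply: vge_sum => j _; apply: vgeM. Qed.

Lemma pvge_gap P : pvge P 0 -> slice 0 P = 0 -> exists2 d : R, 0 < d & pvge P d.
Proof.
move=> P0 sP0; suff [d d0 dP] : exists2 d : R, 0 < d &
    forall i, (i < size P)%N -> vge P`_i d.
  exists d => // i; have [/dP//|ge] := ltnP i (size P).
  by rewrite nth_default.
elim: (size P) => [|m [d d0 dP]]; first by exists 1.
have [|d' d'0 d'P] := vge_gap (P0 m); first by rewrite -coef_slice sP0 coef0.
exists (Num.min d d') => [|i]; first by rewrite lt_min d0.
rewrite ltnS leq_eqVlt => /predU1P[->|/dP].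
  by apply: vgeW d'P; rewrite ge_min lexx orbT.
by apply: vgeW; rewrite ge_min lexx.
Qed.

Section Lift.

Variables (L : {poly k} -> {poly k}) (L0 : L 0 = 0).

Lemma lfin_slift N i : lfin w (fun a => (L (slice a N))`_i).
Proof.
move=> B; have [s sP] := lfin_slice N B; exists s => a La; apply: sP.
by apply: contraNneq La => ->; rewrite L0 coef0.
Qed.

(** Coefficient [i] of the result of applying [L] to every slice of [N]; the condition [L 0 = 0]
    keeps the support left-finite. *)
Definition slift N i : K := LCS (lfin_slift N i).

Lemma vge_slift N i B : pvge N B -> vge (slift N i) B.
Proof. by move=> NB a aB /=; rewrite (pvge_slice NB) // L0 coef0. Qed.

(** Below weight [B] the slices of [N] and [N'] coincide, hence so do their images: additivity of
    [L] is not at stake. *)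
Lemma vge_sliftB N N' i B : pvge (N - N') B -> vge (slift N i - slift N' i) B.
Proof.
move=> NB a aB; rewrite lcsDE lcsNE /=.
have /subr0_eq-> : slice a N - slice a N' = 0.
  by rewrite -sliceN -sliceD (pvge_slice NB).
by rewrite subrr.
Qed.

End Lift.

(** For factors [f + phi] and [g + gam], the equation reads [phi * g + gam * f = E - phi * gam],
    where [E] is the error of the residue factorization. Bezout solves the linear left-hand side
    slice by slice, and the quadratic term is contracting because [phi] and [gam] have positive
    valuation. *)
Lemma hensel P (f g : {poly k}) : P \is monic -> f \is monic -> g \is monic ->
  pvge P 0 -> slice 0 P = f * g -> coprimep f g -> size P = (size f + size g).-1 ->
  exists F H : {poly K}, [/\ P = F * H, size F = size f & size H = size g].
Proof.
move=> Pm fm gm Pge Pfg /Bezout_eq1_coprimepP[[u v] /= uv1].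
have f0 := monic_neq0 fm; have g0 := monic_neq0 gm.
move fE: (size f) => [|r]; first by move/eqP: fE; rewrite size_poly_eq0 (negPf f0).
move gE: (size g) => [|s]; first by move/eqP: gE; rewrite size_poly_eq0 (negPf g0).
rewrite addnS addSn /= => sP.
pose Cf := map_poly C f; pose Cg := map_poly C g.
have Cfm : Cf \is monic by rewrite monic_map.
have Cgm : Cg \is monic by rewrite monic_map.
have sCf : size Cf = r.+1 by rewrite size_map_poly.
have sCg : size Cg = s.+1 by rewrite size_map_poly.
pose E := P - Cf * Cg.
have sCfg : size (Cf * Cg) = (r + s).+1.
  by rewrite size_monicM ?monic_neq0 // sCf sCg addnS.
(* Two monic polynomials of the same degree are subtracted, so the degree drops; this is needed to
   bound the degree of the corrections. *)
have sE : (size E <= r + s)%N.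
  apply/leq_sizeP => i; rewrite leq_eqVlt => /predU1P[<-|le]; rewrite coefB.
    have /monicP : Cf * Cg \is monic by rewrite monicMl.
    rewrite /lead_coef sCfg /= => ->.
    by have := monicP Pm; rewrite /lead_coef sP /= => ->; rewrite subrr.
  by rewrite !nth_default ?subrr // ?sP ?sCfg.
have sE0 : slice 0 E = 0 by rewrite sliceD sliceN Pfg slice0_mulCC subrr.
have Ege : pvge E 0.
  apply: pvgeD Pge (pvgeN _); rewrite -[0]addr0.
  by apply: pvgeM => i; rewrite coef_map; apply: vge_lcC.
have [d d0 Ed] := pvge_gap Ege sE0.
(* The Bezout solution of [A M * g + D M * f = M] with [A M] reduced modulo [f]; the degree bound on
   [D M] then follows from this equation. *)
pose A (M : {poly k}) := (v * M) %% f; pose D (M : {poly k}) := u * M + (v * M %/ f) * g.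
have A0 : A 0 = 0 by rewrite /A mulr0 mod0p.
have D0 : D 0 = 0 by rewrite /D !mulr0 div0p mul0r addr0.
have AD M : A M * g + D M * f = M.
  rewrite -[RHS]mul1r -uv1 mulrDl /D /A mulrDl.
  rewrite (_ : v * g * M = v * M * g); last by rewrite mulrAC.
  by rewrite {3}(divp_eq (v * M) f); ring.
have sA M : (size (A M) <= r)%N by rewrite -ltnS -fE ltn_modp.
have sD (M : {poly k}) : (size M <= r + s)%N -> (size (D M) <= s)%N.
  move=> sN; have [->|DN0] := eqVneq (D M) 0; first by rewrite size_poly0.
  suff : (size (D M * f)%R <= r + s)%N.
    by rewrite size_mul // fE addnS /= addnC leq_add2l.
  rewrite -[D M * f](addKr (A M * g)) AD addrC; apply: leq_trans (size_polyD _ _) _.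
  rewrite geq_max sN size_polyN; apply: leq_trans (size_polyMleq _ _) _.
  by rewrite gE addnS /= leq_add2r.
(* The unknowns of the fixed-point equation are the coefficients of both corrections, indexed by
   [(true, i)] for [phi] and [(false, i)] for [gam]. *)
pose phi (x : bool * nat -> K) := \poly_(i < r) x (true, i).
pose gam (x : bool * nat -> K) := \poly_(i < s) x (false, i).
pose N (x : bool * nat -> K) := E - phi x * gam x.
pose T (x : bool * nat -> K) i := if i.1 then slift A0 (N x) i.2 else slift D0 (N x) i.2.
have phiV (x y : bool * nat -> K) B : (forall i, vge (x i - y i) B) ->
    pvge (phi x - phi y) B.
  by move=> xy i; rewrite coefB !coef_poly; case: ifP => _; rewrite ?subrr.
have gamV (x y : bool * nat -> K) B : (forall i, vge (x i - y i) B) ->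
    pvge (gam x - gam y) B.
  by move=> xy i; rewrite coefB !coef_poly; case: ifP => _; rewrite ?subrr.
have phid (x : bool * nat -> K) : (forall i, vge (x i) d) -> pvge (phi x) d.
  by move=> xd i; rewrite coef_poly; case: ifP.
have gamd (x : bool * nat -> K) : (forall i, vge (x i) d) -> pvge (gam x) d.
  by move=> xd i; rewrite coef_poly; case: ifP.
have [||x [xd xT]] := @fixed_point _ _ w k _ d T d0.
- move=> x xd i; have Nd : pvge (N x) d.
    apply: pvgeD Ed (pvgeN _) => i0; apply: (@vgeW _ _ _ _ (d + d)).
      by rewrite lerDl ltW.
    by apply: pvgeM; [apply: phid|apply: gamd].
  by rewrite /T; case: ifP => _; apply: vge_slift.
- move=> x y B xd yd xy i; have NB : pvge (N x - N y) (B + d).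
    rewrite (_ : _ - _ = - ((phi x - phi y) * gam x + (gam x - gam y) * phi y)).
      apply/pvgeN/pvgeD; apply: pvgeM; by [apply: phiV|apply: gamV|apply: phid|apply: gamd].
    by rewrite /N; ring.
  by rewrite /T; case: ifP => _; apply: vge_sliftB.
have sN : (size (N x) <= r + s)%N.
  apply: leq_trans (size_polyD _ _) _; rewrite geq_max sE size_polyN.
  apply: leq_trans (size_polyMleq _ _) _; rewrite -subn1 leq_subLR.
  by apply: leq_trans (leq_add (size_poly _ _) (size_poly _ _)) _; rewrite leq_addl.
have sphi a : slice a (phi x) = A (slice a (N x)).
  apply/polyP => i; rewrite coef_slice coef_poly; case: ltnP => ir.
    exact: (esym (congr1 (fun y : bool * nat -> K => y (true, i) a) xT)).
  by rewrite nth_default // (leq_trans (sA _)).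
have sgam a : slice a (gam x) = D (slice a (N x)).
  apply/polyP => i; rewrite coef_slice coef_poly; case: ltnP => ir.
    exact: (esym (congr1 (fun y : bool * nat -> K => y (false, i) a) xT)).
  by rewrite nth_default // (leq_trans (sD _ _)) // (leq_trans (size_slice _ _)).
have NE : phi x * Cg + gam x * Cf = N x.
  by apply: slice_inj => a; rewrite sliceD !slice_mulC sphi sgam AD.
exists (Cf + phi x), (Cg + gam x); split.
- rewrite (_ : P = Cf * Cg + N x + phi x * gam x); first by rewrite -NE; ring.
  by rewrite /N /E; ring.
- by rewrite size_polyDl // sCf ltnS size_poly.
- by rewrite size_polyDl // sCg ltnS size_poly.
Qed.

End Hensel.

(** * The intermediate value property and its stability *)

Section IntermediateValue.

Variable F : realFieldType.
Implicit Types (P Q : {poly F}).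

(** With a condition on the product of the end values, the property does not depend on the sign of
    [P] and passes to products, which suits an induction by factorization. *)
Definition ivt P := forall a b, a <= b -> P.[a] * P.[b] <= 0 ->
  exists2 x, a <= x <= b & root P x.

Lemma ivtM P Q : ivt P -> ivt Q -> ivt (P * Q).
Proof.
move=> iP iQ a b ab; rewrite !hornerM mulrACA => le.
have [lP|lP] := leP (P.[a] * P.[b]) 0.
  by have [x xab rx] := iP a b ab lP; exists x; rewrite // rootM rx.
move: le; rewrite pmulr_rle0 // => /(iQ a b ab)[x xab rx].
by exists x; rewrite // rootM rx orbT.
Qed.

Lemma ivt_subst P Q c d l : 0 < c -> l != 0 ->
  (forall x, P.[c * x + d] = l * Q.[x]) -> ivt Q -> ivt P.
Proof.
move=> c0 l0 PQ iQ a b ab; pose t x := (x - d) / c.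
have tK x : c * t x + d = x by rewrite mulrC divfK ?gt_eqF // subrK.
rewrite -[in P.[a]](tK a) -[in P.[b]](tK b) !PQ mulrACA pmulr_rle0; last first.
  by rewrite -expr2 exprn_even_gt0.
have tab : t a <= t b by rewrite /t ler_pM2r ?invr_gt0 // lerB.
move=> /(iQ _ _ tab)[x xab /rootP Qx].
exists (c * x + d); last by apply/rootP; rewrite PQ Qx mulr0.
move: xab; rewrite ler_pdivrMr // ler_pdivlMr // lerBlDr lerBrDr.
by rewrite ![x * c]mulrC.
Qed.

Lemma ivtXn m : (0 < m)%N -> ivt 'X^m.
Proof.
move=> m0 a b ab; rewrite !hornerXn -exprMn => le.
exists 0; last by rewrite rootE hornerXn expr0n eqn0Ngt m0.
have le0 : a * b <= 0 by rewrite leNgt; apply: contraL le => gt; rewrite -ltNge exprn_gt0.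
by apply/andP; split; rewrite leNgt; apply: contraL le0 => ?; rewrite -ltNge; nra.
Qed.

Lemma ivt_gt0 P : (forall x, 0 < P.[x]) -> ivt P.
Proof. by move=> P0 a b _; rewrite leNgt mulr_gt0. Qed.

End IntermediateValue.

Lemma coef_XaddC_exp (A : comNzRingType) (c : A) m :
  (('X + c%:P) ^+ m.+1)`_m = c *+ m.+1.
Proof.
elim: m => [|m IHm]; first by rewrite expr1 coefD coefX coefC add0r.
rewrite exprS mulrDl coefD coefXM coefCM /= IHm.
have /monicP : ('X + c%:P) ^+ m.+1 \is monic.
  by rewrite monic_exp // -[c]opprK polyCN monicXsubC.
rewrite /lead_coef -[c]opprK polyCN size_exp_XsubC /= => ->.
by rewrite mulr1 opprK [RHS]mulrSr.
Qed.

(** Effect of a translation on the subleading coefficient, which the Tschirnhaus shift is meant to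
    cancel. *)
Lemma comp_XaddC_coef (A : comNzRingType) (p : {poly A}) c m :
  size p = m.+2 -> (p \Po ('X + c%:P))`_m = p`_m + p`_m.+1 * c *+ m.+1.
Proof.
move=> sp; rewrite comp_polyE sp !big_ord_recr /= !coefD coef_sum big1 => [|i _].
  rewrite add0r !coefZ coef_XaddC_exp -mulrnAr; congr (_ + _).
  have /monicP : ('X + c%:P) ^+ m \is monic.
    by rewrite monic_exp // -[c]opprK polyCN monicXsubC.
  by rewrite /lead_coef -[c]opprK polyCN size_exp_XsubC /= => ->; rewrite mulr1.
rewrite coefZ (nth_default _ (_ : (size _ <= m)%N)) ?mulr0 //.
by rewrite -[c]opprK polyCN size_exp_XsubC ltn_ord.
Qed.

(** Without roots the sign is constant, hence equal to the signs at both infinities. At plus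
    infinity it is 1 since [p] is monic; at minus infinity this forces an even degree. *)
Lemma noroot_gt0 (k : rcfType) (p : {poly k}) : p \is monic ->
  (forall x, ~~ root p x) -> (forall x, 0 < p.[x]) /\ odd (size p).
Proof.
move=> pm nr.
have E x : Num.sg p.[x] = 1.
  have := @sgp_pinftyP _ x p (fun y _ => nr y) x; rewrite in_itv /= lexx => -> //.
  by rewrite /sgp_pinfty (monicP pm) sgr1.
split=> [x|]; first by rewrite -sgr_gt0 E ltr01.
have := @sgp_minftyP _ 0 p (fun y _ => nr y) 0; rewrite in_itv /= lexx E.
move=> /(_ isT); rewrite /sgp_minfty (monicP pm) mulr1 sgrX sgrN1 -signr_odd.
case: (size p) (size_poly_eq0 p) => [|m _]; first by rewrite eqxx (negPf (monic_neq0 pm)).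
by case: (boolP (odd m)) => //= om /eqP; rewrite om expr1 -subr_eq0 opprK -mulr2n pnatr_eq0.
Qed.

Section LeviCivitaClosed.

Variables (R : realType) (G : lmodType rat) (w : weight R G) (k : rcfType).
Local Notation K := (lcs w k).
Local Notation vge x B := (@vge R G w k (lcf x) B).
Local Notation T := (@lcT R G w k).
Implicit Types (x y : K) (P Q : {poly K}) (a : G).

Lemma lcT_gt0 a : 0 < T a.
Proof.
by apply/lcs_gt0P; exists a; [rewrite lcTE eqxx | apply: vge_lcT].
Qed.

Lemma lead_exp x a m : vge x (w a) ->
  vge (x ^+ m) (w (a *+ m)) /\ (x ^+ m) (a *+ m) = x a ^+ m.
Proof.
move=> xa; elim: m => [|m [IH1 IH2]].
  by rewrite !expr0 wt0; split; [apply: (vge_lcC 1)|rewrite /= /monomial eqxx].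
rewrite !exprS mulrS; split; first by rewrite wtD; apply: vgeM.
by rewrite mul_lead // IH2.
Qed.

Lemma horner_res P x : pvge P 0 -> vge x 0 ->
  vge P.[x] 0 /\ P.[x] 0 = (slice 0 P).[x 0].
Proof.
move=> P0 x0; have xi i : vge (x ^+ i) 0 /\ (x ^+ i) 0 = x 0 ^+ i.
  have := @lead_exp x 0 i; rewrite mul0rn wt0 => -[] //.
rewrite horner_coef; split.
  apply: vge_sum => i _; apply: (vgeW _ (vgeM (P0 i) (xi i).1)).
  by rewrite addr0.
rewrite lcs_sumE (horner_coef_wide _ (size_slice 0 P)); apply: eq_bigr => i _.
have := @mul_lead _ _ _ k 0 0 P`_i (x ^+ i); rewrite wt0 addr0 => ->.
- by rewrite (xi i).2 coef_slice.
- exact: P0.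
- exact: (xi i).1.
Qed.

(** If [x] has nonnegative valuation, [P.[x]] reduces to a value of the residue polynomial.
    Otherwise the leading power of [x], of even degree, dominates the other terms. *)
Lemma vge0_slice_gt0 P x : pvge P 0 -> P \is monic -> odd (size P) ->
  (forall t, 0 < (slice 0 P).[t]) -> 0 < P.[x].
Proof.
move=> P0 Pm oP sP; apply/lcs_gt0P.
have [x00|nx0] := pselect (vge x 0).
  have [Px0 PxE] := horner_res P0 x00.
  by exists 0; [rewrite PxE | rewrite wt0].
have [a xa xla] : exists2 a, x a != 0 & vge x (w a).
  by apply: lead_exists; apply: contra_notN nx0 => /eqP->.
have a0 : w a < 0.
  by rewrite ltNge; apply/negP => a0; apply: nx0; apply: vgeW xla.
have [m sm] : exists m, size P = m.+1.
  by exists (size P).-1; rewrite prednK // size_poly_gt0 monic_neq0.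
have [xm1 xm2] := lead_exp m xla.
have small : vge (\sum_(i < m) P`_i * x ^+ i) (w (a *+ m) - w a).
  apply: vge_sum => i _; apply: (@vgeW _ _ _ _ (0 + w (a *+ i))).
    rewrite add0r -wtB !wtMn wtB wtMn.
    move: (nat_of_ord i) (ltn_ord i) => j jm; rewrite -(subnKC jm).
    rewrite addSnnS mulrnDr mulrSr addrA addrK.
    by rewrite gerDl mulrn_wle0 // ltW.
  by apply: vgeM (P0 i) (lead_exp i xla).1.
have -> : P.[x] = \sum_(i < m) P`_i * x ^+ i + x ^+ m.
  rewrite horner_coef sm big_ord_recr /=.
  have -> : P`_m = 1 by have := monicP Pm; rewrite /lead_coef sm.
  by rewrite mul1r.
exists (a *+ m).
  rewrite lcsDE xm2 small; last by rewrite ltrDl oppr_gt0.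
  by rewrite add0r exprn_even_gt0 // ?xa ?orbT //; move: oP; rewrite sm.
by apply: vgeD xm1; apply: vgeW small; rewrite lerDl oppr_ge0 ltW.
Qed.

End LeviCivitaClosed.

Section LeviCivitaRcf.

Variables (R : realType) (G : lmodType rat) (w : weight R G) (k : rcfType).
Local Notation K := (lcs w k).
Local Notation vge x B := (@vge R G w k (lcf x) B).
Local Notation T := (@lcT R G w k).
Implicit Types (x y : K) (P Q : {poly K}) (a : G).

(* The normal form reached by a Tschirnhaus shift and a rescaling. The residue
   polynomial is neither ['X^(d.+1)] nor, for lack of a term of degree [d], any
   other power of a linear polynomial: so either it has a root and Hensel's lemma
   applies, or it is positive and then so is [P]. *)
Definition reduced P d := [/\ P \is monic, size P = d.+2, P`_d = 0, pvge P 0 &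
  exists2 j, (j <= d)%N & P`_j 0 != 0].

Lemma ivt_reduced P d : reduced P d ->
  (forall Q, (size Q < size P)%N -> ivt Q) -> ivt P.
Proof.
move=> [Pm sP Pd P0 [j jd Pj]] IH; pose p := slice 0 P.
have pi i : p`_i = P`_i 0 by apply: coef_slice.
have pd : p`_d.+1 = 1.
  by rewrite pi; have := monicP Pm; rewrite /lead_coef sP /= => ->; rewrite /= /monomial eqxx.
have sp : size p = d.+2.
  apply/eqP; rewrite eqn_leq -{1}sP size_slice ltnNge; apply/negP => le.
  by have := pd; rewrite nth_default // => /eqP; rewrite eq_sym oner_eq0.
have pm : p \is monic by rewrite monicE /lead_coef sp pd.
have [nr|] := pselect (forall t, ~~ root p t).
  have [pp op] := noroot_gt0 pm nr; apply: ivt_gt0 => x.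
  by apply: vge0_slice_gt0 => //; rewrite sP -sp.
move=> /existsNP[r /negP]; rewrite negbK => rr.
(* Taking out the root with its full multiplicity makes the two residue factors coprime, as Hensel's
   lemma requires. *)
have [m [q]] := multiplicity_XsubC p r; rewrite monic_neq0 //= => nrq pE.
have Xm : ('X - r%:P) ^+ m \is monic by rewrite monic_exp // monicXsubC.
have qm : q \is monic by have := pm; rewrite pE mulrC monicMl.
have cop : coprimep q (('X - r%:P) ^+ m).
  by apply: coprimep_expr; rewrite coprimep_XsubC.
have m0 : (0 < m)%N.
  rewrite lt0n; apply: contraL rr => /eqP m0.
  by rewrite pE m0 expr0 mulr1.
have q0 := monic_neq0 qm.
have sE : size p = (size q + m)%N.
  by rewrite pE size_mul ?monic_neq0 // size_exp_XsubC addnS.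
have sq : (1 < size q)%N.
  rewrite ltnNge; apply/negP => sq.
  have q1 : q = 1.
    rewrite (size1_polyC sq); move/monicP: qm; rewrite (size1_polyC sq) lead_coefC => ->.
    by rewrite coefC eqxx.
  have mE : m = d.+1 by move: sE; rewrite sp q1 size_polyC oner_eq0 add1n => -[].
  have pE' : p = ('X + (- r)%:P) ^+ d.+1 by rewrite pE q1 mul1r mE polyCN.
  have r0 : r = 0.
    move: (pi d); rewrite Pd lcs0E pE' coef_XaddC_exp => /eqP.
    by rewrite mulrn_eq0 /= oppr_eq0 => /eqP.
  move: Pj; rewrite -pi pE' r0 oppr0 addr0 coefXn.
  by rewrite ltn_eqF ?ltnS // eqxx.
have [F [H [PE sF sH]]] : exists F H : {poly K},
    [/\ P = F * H, size F = size q & size H = size (('X - r%:P) ^+ m)].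
  apply: hensel => //.
  by rewrite size_exp_XsubC addnS /= -sE sp sP.
rewrite PE; apply: ivtM; apply: IH.
  by rewrite sF sP -sp sE -addn1 leq_add2l.
by rewrite sH sP -sp sE size_exp_XsubC -[m.+1]add1n ltn_add2r.
Qed.

(** Here [w c] is the least slope of the Newton polygon. Rescaling by [T c] brings every coefficient
    to nonnegative valuation and gives the coefficient at the minimizing index a nonzero residue.
    Defining [c] requires dividing an exponent by [d.+1 - j]. *)
Lemma reduce P d : P \is monic -> size P = d.+2 -> P`_d = 0 -> P != 'X^(d.+1) ->
  exists c Q, reduced Q d /\ forall x, P.[T c * x] = T (c *+ d.+1) * Q.[x].
Proof.
move=> Pm sP Pd PX.
have Pd1 : P`_d.+1 = 1 by have := monicP Pm; rewrite /lead_coef sP.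
have [j0 Pj0] : exists j : 'I_d.+1, P`_j != 0.
  apply: contrapT => nex; case/negP: PX; apply/eqP/polyP => i; rewrite coefXn.
  have [id|di|->] := ltngtP i d.+1; last by rewrite Pd1.
    by apply/eqP; apply: contrapT => Pi; apply: nex; exists (Ordinal id); apply/negP.
  by rewrite nth_default // sP.
have /choice[v vP] (j : 'I_d.+1) : exists a, P`_j != 0 -> P`_j a != 0 /\ vge P`_j (w a).
  have [_|/lead_exists[a Pa Pla]] := eqVneq P`_j 0; first by exists 0.
  by exists a.
pose slope (j : 'I_d.+1) := w (v j) / (d.+1 - j)%:R.
have [j Pj jmin] := @arg_minP _ _ _ j0 (fun j => P`_j != 0) slope Pj0.
have dj0 i : (0 < d.+1 - nat_of_ord (i : 'I_d.+1))%N by rewrite subn_gt0.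
pose c : G := (d.+1 - j)%:R^-1 *: v j.
have cE : c *+ (d.+1 - j) = v j.
  by rewrite -scaler_nat scalerA mulfV ?scale1r // pnatr_eq0 -lt0n.
have wc : w c = slope j.
  by rewrite /slope -cE wtMn -[w c *+ _]mulr_natr mulfK // pnatr_eq0 -lt0n.
pose Q := \poly_(i < d.+2) (P`_i * T (c *+ i - c *+ d.+1)).
have Qi i : (i < d.+2)%N -> Q`_i = P`_i * T (c *+ i - c *+ d.+1).
  by move=> id; rewrite coef_poly id.
have Qd1 : Q`_d.+1 = 1 by rewrite Qi // subrr Pd1 mul1r.
have sQ : size Q = d.+2.
  apply/eqP; rewrite eqn_leq size_poly ltnNge; apply/negP => le.
  by have := Qd1; rewrite nth_default // => /eqP; rewrite eq_sym oner_eq0.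
exists c, Q; split; last first.
  move=> x; rewrite (horner_coef_wide _ (eq_leq sP)) (horner_coef_wide _ (eq_leq sQ)).
  rewrite mulr_sumr; apply: eq_bigr => i _; rewrite Qi // exprMn -lcTX.
  have -> : T (c *+ i) = T (c *+ d.+1) * T (c *+ i - c *+ d.+1).
    by rewrite -lcTD addrC subrK.
  by ring.
split=> //.
- by rewrite monicE /lead_coef sQ Qd1.
- by rewrite Qi // Pd mul0r.
- move=> i; have [|ge] := ltnP i d.+2; last by rewrite nth_default ?sQ.
  rewrite ltnS leq_eqVlt => /predU1P[->|id]; first by rewrite Qd1; apply: (vge_lcC 1).
  rewrite Qi ?(leqW id) //; pose i' := Ordinal id.
  have [->|Pi] := eqVneq P`_i 0; first by rewrite mul0r.
  have := vgeM (vP i' Pi).2 (@vge_lcT _ _ w k (c *+ i - c *+ d.+1)); apply: vgeW.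
  rewrite wtB !wtMn -opprB -mulrnBr 1?ltnW // wc subr_ge0 -mulr_natr.
  by rewrite -ler_pdivlMr ?ltr0n ?(dj0 i') //; apply: (jmin i' Pi).
- exists j; first by rewrite -ltnS.
  rewrite Qi; last by rewrite ltnS ltnW.
  rewrite mulrC lcT_mulE sub0r opprB -mulrnBr 1?ltnW // cE.
  exact: (vP j Pj).1.
Qed.

Theorem lcs_ivt P : ivt P.
Proof.
have [n] := ubnP (size P); elim: n => // n IHn in P *; rewrite ltnS => sPn.
case sP: (size P) => [|[|d]].
- move/eqP: sP; rewrite size_poly_eq0 => /eqP-> a b ab _.
  by exists a; rewrite ?lexx ?ab ?root0.
- move/eqP: sP => /size_poly1P[c c0 ->] a b ab; rewrite !hornerC -expr2.
  by rewrite leNgt exprn_even_gt0 //= c0.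
pose l := lead_coef P; have l0 : l != 0 by rewrite lead_coef_eq0 -size_poly_eq0 sP.
(* The Tschirnhaus shift: translating by [e] cancels the coefficient of degree [d]. *)
pose e := - (P`_d / (l *+ d.+1)).
pose q : {poly K} := 'X + e%:P.
have sq : size q = 2 by rewrite /q -[e]opprK polyCN size_XsubC.
pose P1 := l^-1 *: (P \Po q).
have lE : lead_coef (P \Po q) = l.
  by rewrite lead_coef_comp ?sq // /q -[e]opprK polyCN lead_coefXsubC expr1n mulr1.
have sP1 : size P1 = d.+2 by rewrite size_scale ?invr_eq0 // size_comp_poly2.
have P1m : P1 \is monic by rewrite monicE lead_coefZ lE mulVf.
have P1d : P1`_d = 0.
  rewrite coefZ comp_XaddC_coef //.
  have -> : P`_d.+1 = l by rewrite /l /lead_coef sP.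
  have ld : l *+ d.+1 != 0 by rewrite mulrn_eq0 negb_or.
  by rewrite -mulrnAl /e mulrN [_ * (_ / _)]mulrC divfK // subrr mulr0.
have PP1 x : P.[1 * x + e] = l * P1.[x].
  by rewrite hornerZ horner_comp mulVKf // /q !hornerE.
apply: (ivt_subst ltr01 l0 PP1).
have [->|P1X] := eqVneq P1 'X^(d.+1); first exact: ivtXn.
have [c [Q [Qr QE]]] := reduce P1m sP1 P1d P1X.
apply: (@ivt_subst _ _ Q (T c) 0 (T (c *+ d.+1))).
- exact: lcT_gt0.
- by rewrite gt_eqF // lcT_gt0.
- by move=> x; rewrite addr0.
apply: (ivt_reduced Qr) => Q' lt; apply: IHn.
have sQ : size Q = d.+2 by case: Qr.
by rewrite (leq_trans lt) // sQ -sP.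
Qed.

Fact lcs_closed : Num.real_closed_axiom K.
Proof.
move=> P a b ab /andP[Pa Pb]; have [|x xab rx] := lcs_ivt ab (_ : P.[a] * P.[b] <= 0).
  exact: mulr_le0_ge0.
by exists x; rewrite ?in_itv.
Qed.

HB.instance Definition _ := Num.RealField_isClosed.Build K lcs_closed.

End LeviCivitaRcf.

(** * Positive semidefinite forms and Hadamard multipliers *)

Definition qform (F : pzSemiRingType) d (M : 'I_d -> 'I_d -> F) (v : 'I_d -> F) : F :=
  \sum_i \sum_j v i * v j * M i j.

Definition psdform (F : realDomainType) d (M : 'I_d -> 'I_d -> F) :=
  forall v, 0 <= qform M v.

Lemma qform_gram (F : comPzRingType) d (s : seq ('I_d -> F)) v :
  qform (fun i j => \sum_(b <- s) b i * b j) v = \sum_(b <- s) (\sum_i v i * b i) ^+ 2.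
Proof.
rewrite /qform; under eq_bigr => i _ do under eq_bigr => j _ do rewrite mulr_sumr.
under eq_bigr => i _ do rewrite exchange_big.
rewrite exchange_big; apply: eq_bigr => b _ /=; rewrite expr2 mulr_suml.
apply: eq_bigr => i _; rewrite mulr_sumr; apply: eq_bigr => j _.
by rewrite mulrACA.
Qed.

Definition scons (A : Type) d (x : A) (v : 'I_d -> A) : 'I_d.+1 -> A :=
  fun i => oapp v x (unlift ord0 i).

Lemma scons0 (A : Type) d (x : A) (v : 'I_d -> A) : scons x v ord0 = x.
Proof. by rewrite /scons unlift_none. Qed.

Lemma sconsS (A : Type) d (x : A) (v : 'I_d -> A) i : scons x v (lift ord0 i) = v i.
Proof. by rewrite /scons liftK. Qed.

Lemma qform_scons (F : comPzRingType) d (M : 'I_d.+1 -> 'I_d.+1 -> F) x v :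
  (forall i j, M i j = M j i) ->
  qform M (scons x v) = x ^+ 2 * M ord0 ord0 +
    (x * \sum_i v i * M ord0 (lift ord0 i)) *+ 2 +
    qform (fun i j => M (lift ord0 i) (lift ord0 j)) v.
Proof.
move=> Ms; rewrite /qform big_ord_recl big_ord_recl /= !scons0 expr2 mulr2n -!addrA.
congr (_ + _); congr (_ + _).
  by rewrite mulr_sumr; apply: eq_bigr => i _; rewrite sconsS mulrA.
rewrite mulr_sumr -big_split /=; apply: eq_bigr => i _.
rewrite big_ord_recl /= scons0 sconsS; congr (_ + _).
  by rewrite Ms; ring.
by apply: eq_bigr => j _; rewrite !sconsS.
Qed.

Lemma linear_ge0 (F : realFieldType) (a c : F) : (forall t, 0 <= t * a + c) -> a = 0.
Proof.
move=> ta; apply: contrapT => /eqP a0.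
(* At this [t] the affine function takes the value [-1]. *)
by have := ta ((- c - 1) / a); rewrite divfK //; lra.
Qed.

(** Cholesky decomposition by induction on the size: a positive pivot is split off as a square and
    leaves its Schur complement, while a zero pivot forces its whole row to vanish. *)
Lemma gram (F : rcfType) d (M : 'I_d -> 'I_d -> F) :
  (forall i j, M i j = M j i) -> psdform M ->
  exists s : seq ('I_d -> F), forall i j, M i j = \sum_(b <- s) b i * b j.
Proof.
elim: d M => [|d IHd] M Ms Mp; first by exists [::] => -[].
set a := M ord0 ord0.
pose M0 i := M ord0 (lift ord0 i); pose M' i j := M (lift ord0 i) (lift ord0 j).
have Mq x v : 0 <= x ^+ 2 * a + (x * \sum_i v i * M0 i) *+ 2 + qform M' v.
  by rewrite -qform_scons.
have a0 : 0 <= a.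
  have := Mq 1 (fun=> 0); rewrite /qform !big1 => [|i _|i _]; last 2 first.
  - by rewrite big1 // => j _; rewrite !mul0r.
  - by rewrite mul0r.
  by rewrite expr1n mul1r mulr0 mul0rn !addr0.
have [az|an] := eqVneq a 0.
  have M00 j : M0 j = 0.
    apply: (@linear_ge0 _ _ (qform M' (fun i => (i == j)%:R) / 2)) => t.
    have := Mq t (fun i => (i == j)%:R); rewrite az mulr0 add0r.
    rewrite (bigD1 j) //= eqxx mul1r big1 => [|i /negPf->]; last by rewrite mul0r.
    rewrite addr0; lra.
  have [||s sP] := IHd M'; first by move=> i j; apply: Ms.
    by move=> v; have := Mq 0 v; rewrite expr0n /= !mul0r mul0rn !add0r.
  exists [seq scons 0 b | b <- s] => i j; rewrite big_map.
  have [i'|] := unliftP ord0 i => ->; last first.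
    rewrite big1 => [|b _]; last by rewrite scons0 mul0r.
    by have [j'|] := unliftP ord0 j => ->; [apply: M00|].
  have [j'|] := unliftP ord0 j => ->; last first.
    by rewrite big1 => [|b _]; rewrite ?scons0 ?mulr0 // Ms; apply: M00.
  by rewrite -[LHS]/(M' i' j') sP; apply: eq_bigr => b _; rewrite !sconsS.
have ap : 0 < a by rewrite lt_neqAle eq_sym an.
pose r := Num.sqrt a; have r2 : r * r = a by rewrite -expr2 sqr_sqrtr.
have r0 : r != 0 by rewrite sqrtr_eq0 -ltNge.
pose b0 i := M0 i / r.
pose M'' i j := M' i j - b0 i * b0 j.
have [||s sP] := IHd M''.
- by move=> i j; rewrite /M'' [b0 i * _]mulrC /M' Ms.
(* This first coordinate minimizes the form for fixed [v], and the minimum is the value of the Schur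
   complement at [v]. *)
- move=> v; have := Mq (- (\sum_i v i * M0 i) / a) v; set S := \sum_i _.
  have -> : qform M'' v = qform M' v - S ^+ 2 / a.
    have -> : S ^+ 2 / a = qform (fun i j => \sum_(b <- [:: b0]) b i * b j) v.
      rewrite qform_gram big_seq1 (_ : \sum_i v i * b0 i = S / r); last first.
        by rewrite mulr_suml; apply: eq_bigr => i _; rewrite mulrA.
      by rewrite exprMn exprVn [r ^+ 2]expr2 r2.
    rewrite /qform -sumrB; apply: eq_bigr => i _.
    by rewrite -sumrB; apply: eq_bigr => j _; rewrite big_seq1 -mulrBr.
  congr (0 <= _); field; exact: an.
exists (scons r b0 :: [seq scons 0 b | b <- s]) => i j; rewrite big_cons big_map.
have [i'|] := unliftP ord0 i => ->; have [j'|] := unliftP ord0 j => ->.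
- rewrite !sconsS; have := sP i' j'; rewrite /M'' /M' => /eqP.
  rewrite subr_eq addrC => /eqP ->; congr (_ + _).
  by apply: eq_bigr => b _; rewrite !sconsS.
- rewrite sconsS scons0 big1 => [|b _]; last by rewrite scons0 mulr0.
  by rewrite addr0 divfK // Ms.
- rewrite sconsS scons0 big1 => [|b _]; last by rewrite scons0 mul0r.
  by rewrite addr0 mulrC divfK.
- rewrite scons0 big1 => [|b _]; last by rewrite scons0 mul0r.
  by rewrite addr0 r2.
Qed.

Lemma psdform_gram (F : rcfType) d (M : 'I_d -> 'I_d -> F)
    (s : seq ('I_d -> F)) :
  (forall i j, M i j = \sum_(b <- s) b i * b j) -> psdform M.
Proof.
move=> Ms v; have -> : M = fun i j => \sum_(b <- s) b i * b j.
  by apply/funext => i; apply/funext => j.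
by rewrite qform_gram sumr_ge0 // => b _; rewrite sqr_ge0.
Qed.

(** * Coefficientwise multipliers of series *)

Section Hadamard.

Variables (R : realType) (G : lmodType rat) (w : weight R G) (k : rcfType).
Local Notation K := (lcs w k).
Local Notation vge x B := (@vge R G w k (lcf x) B).
Local Notation T := (@lcT R G w k).
Local Notation C := (@lcC R G w k).
Implicit Types (x y : K) (a : G).

(** The sum is the value of the functional on the square of the element with coefficients [c i] at
    exponents [a i]. *)
Definition psd_kernel (la : G -> k) := forall d (c : 'I_d -> k) (a : 'I_d -> G),
  0 <= \sum_i \sum_j c i * c j * la (a i + a j).

Section Multiplier.

Variable la : G -> k.

Lemma lfin_hadamard x : lfin w (fun a => la a * x a).
Proof.
move=> B; have [s sP] := lcfP x B; exists s => a lx; apply: sP.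
by apply: contraNneq lx => ->; rewrite mulr0.
Qed.

Definition hadamard x : K := LCS (lfin_hadamard x).

Lemma hadamardE x a : hadamard x a = la a * x a. Proof. by []. Qed.

Fact hadamard_additive : zmod_morphism hadamard.
Proof. by move=> x y; apply: lcs_eqP => a; rewrite !(lcsDE, lcsNE, hadamardE) mulrBr. Qed.
HB.instance Definition _ := GRing.isZmodMorphism.Build K K hadamard hadamard_additive.

Lemma hadamardCM c x : hadamard (C c * x) = C c * hadamard x.
Proof. by apply: lcs_eqP => a; rewrite hadamardE !lcC_mulE hadamardE mulrCA. Qed.

Lemma hadamardT a : hadamard (T a) = C (la a) * T a.
Proof.
apply: lcs_eqP => b; rewrite hadamardE lcC_mulE !lcTE.
by case: eqP => [->|]; rewrite ?mulr0.
Qed.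

Lemma hadamardC c : la 0 = 1 -> hadamard (C c) = C c.
Proof.
move=> l1; rewrite -[C c]mulr1 hadamardCM -(@lcT0 _ _ w k) hadamardT l1.
by rewrite rmorph1 mul1r.
Qed.

Lemma vge_hadamard x B : vge x B -> vge (hadamard x) B.
Proof. by move=> xB a aB; rewrite hadamardE xB // mulr0. Qed.

End Multiplier.

Lemma hadamardK la : (forall a, la a != 0) ->
  cancel (hadamard la) (hadamard (fun a => (la a)^-1)).
Proof. by move=> l0 x; apply: lcs_eqP => a; rewrite !hadamardE mulKf. Qed.

Lemma hadamardVK la : (forall a, la a != 0) ->
  cancel (hadamard (fun a => (la a)^-1)) (hadamard la).
Proof. by move=> l0 x; apply: lcs_eqP => a; rewrite !hadamardE mulVKf. Qed.

Definition lcs_fin (s : seq (k * G)) : K := \sum_(p <- s) C p.1 * T p.2.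

Lemma lcs_truncate x B : exists s, vge (x - lcs_fin s) B.
Proof.
have [s sP] := lcfP x B; exists [seq (x a, a) | a <- undup s] => a aB.
rewrite lcsDE lcsNE /lcs_fin big_map lcs_sumE.
have [as_|ans] := boolP (a \in s).
  rewrite (bigD1_seq a) ?mem_undup ?undup_uniq // lcC_mulE lcTE eqxx mulr1.
  rewrite big1 => [|b /negPf ba]; first by rewrite /= addr0 subrr.
  by rewrite lcC_mulE lcTE eq_sym ba mulr0.
have -> : x a = 0 by apply/eqP; apply: contraNT ans => xa; apply: sP.
rewrite sub0r big_seq big1 ?oppr0 // => b; rewrite mem_undup => bs.
by rewrite lcC_mulE lcTE; case: eqP ans => [->|_ _]; rewrite ?bs ?mulr0.
Qed.

Lemma vge_mul_congr m B x x' y y' : vge x m -> vge y' m ->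
  vge (x - x') B -> vge (y - y') B -> vge (x * y - x' * y') (B + m).
Proof.
move=> xm ym xx yy; rewrite (_ : _ - _ = x * (y - y') + (x - x') * y'); last by ring.
by apply: vgeD; [rewrite [B + m]addrC|]; apply: vgeM.
Qed.

Section Positivity.

Variables (la : G -> k) (la_psd : psd_kernel la).
Local Notation Phi := (hadamard la).

(* Schur's product theorem: a psd matrix over [k] is a sum of squares, and it
   remains one over [K]. *)
Lemma psd_kernel_lcs (s : seq (K * G)) :
  0 <= \sum_(p <- s) \sum_(q <- s) p.1 * q.1 * C (la (p.2 + q.2)).
Proof.
pose d := size s; pose p (i : 'I_d) := nth (0, 0) s i.
have [||t tP] := @gram k d (fun i j => la ((p i).2 + (p j).2)).
- by move=> i j; rewrite addrC.
- by move=> v; apply: la_psd.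
suff /psdform_gram/(_ (fun i => (p i).1)) : forall i j,
    C (la ((p i).2 + (p j).2)) = \sum_(b <- [seq C \o b | b <- t]) b i * b j.
  rewrite /qform (big_nth (0, 0)) big_mkord; congr (0 <= _).
  apply: eq_bigr => i _; rewrite (big_nth (0, 0)) big_mkord.
  by apply: eq_bigr => j _.
by move=> i j; rewrite tP rmorph_sum big_map; apply: eq_bigr => b _; rewrite rmorphM.
Qed.

(** On monomials, [Phi (T a * T b) = C (la (a + b)) * T a * T b]. Absorbing [T a] and [T b] into the
    vector leaves the kernel of [psd_kernel_lcs]. *)
Lemma hadamard_fin_ge0 d (v b : 'I_d -> seq (k * G)) :
  0 <= \sum_i \sum_j lcs_fin (v i) * lcs_fin (v j) * Phi (lcs_fin (b i) * lcs_fin (b j)).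
Proof.
pose s := [seq (lcs_fin (v i) * C r.1 * T r.2, r.2) | i <- enum 'I_d, r <- b i].
have := psd_kernel_lcs s; congr (0 <= _).
rewrite /s big_allpairs_dep /= big_enum /=; apply: eq_bigr => i _.
transitivity (\sum_j \sum_(r <- b i) \sum_(u <- b j)
    (lcs_fin (v i) * C r.1 * T r.2) * (lcs_fin (v j) * C u.1 * T u.2) * C (la (r.2 + u.2))).
  rewrite [RHS]exchange_big; apply: eq_bigr => r _.
  by rewrite big_allpairs_dep /= big_enum.
apply: eq_bigr => j _; rewrite [lcs_fin (b i)]/lcs_fin [lcs_fin (b j)]/lcs_fin.
rewrite mulr_suml raddf_sum mulr_sumr; apply: eq_bigr => r _.
rewrite mulr_sumr raddf_sum mulr_sumr; apply: eq_bigr => u _ /=.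
rewrite (_ : C r.1 * T r.2 * (C u.1 * T u.2) = C r.1 * (C u.1 * T (r.2 + u.2))).
  by rewrite !hadamardCM hadamardT lcTD; ring.
by rewrite lcTD; ring.
Qed.

(* Truncating the series does not change the sign of the form, which is given by
   one coefficient. *)
Lemma hadamard_square_ge0 d (v b : 'I_d -> K) :
  0 <= \sum_i \sum_j v i * v j * Phi (b i * b j).
Proof.
rewrite leNgt; apply/negP => /[dup] q0; rewrite -oppr_gt0 => /lcs_gt0P[c].
set q := \sum_i _ => qc qlc.
have [m mP] : exists m, (m <= 0) /\ forall i, vge (v i) m /\ vge (b i) m.
  have /choice[f fP] i : exists m, vge (v i) m by apply: vge_exists (lcfP _).
  have /choice[g gP] i : exists m, vge (b i) m by apply: vge_exists (lcfP _).
  pose h (i : 'I_d) := Num.min (f i) (g i).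
  exists (\big[Num.min/0]_i h i); split; first exact: bigmin_le_id.
  move=> i; have hi : \big[Num.min/0]_i h i <= h i by apply: bigmin_le_cond.
  split; [apply: vgeW (fP i)|apply: vgeW (gP i)]; apply: le_trans hi _;
    by rewrite ge_min lexx ?orbT.
(* Replacing a factor by its truncation costs an error of valuation [B], and the three other factors
   have valuation at least [m]; this [B] pushes the total error beyond the leading exponent [c]. The
   maximum with 0 ensures [m <= B], so that truncations keep valuation at least [m]. *)
case: mP => m0 mP; pose B := Num.max (w c + 1 - (m + m + m)) 0.
have /choice[v' v'P] i : exists s, vge (v i - lcs_fin s) B by apply: lcs_truncate.
have /choice[b' b'P] i : exists s, vge (b i - lcs_fin s) B by apply: lcs_truncate.
have Bm : m <= B by rewrite le_max m0 orbT.
have tm x y : vge x m -> vge (x - y) B -> vge y m.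
  move=> xm xy; rewrite -[y](subKr x); apply: vgeB xm (vgeW Bm xy).
have q'0 := hadamard_fin_ge0 v' b'; set q' := (X in 0 <= X) in q'0.
have qq' : vge (q - q') (w c + 1).
  rewrite /q /q' -sumrB; apply: vge_sum => i _; rewrite -sumrB; apply: vge_sum => j _.
  have [vi bi] := mP i; have [vj bj] := mP j.
  have vv := vge_mul_congr vi (tm _ _ vj (v'P j)) (v'P i) (v'P j).
  have bb := vge_mul_congr bi (tm _ _ bj (b'P j)) (b'P i) (b'P j).
  have vl := vgeM vi vj.
  have bl := vgeM (tm _ _ bi (b'P i)) (tm _ _ bj (b'P j)).
  have Pbb : vge (Phi (b i * b j) - Phi (lcs_fin (b' i) * lcs_fin (b' j))) (B + m).
    by rewrite -raddfB; apply: vge_hadamard.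
  have Pbl := vge_hadamard la bl.
  apply: vgeW (vge_mul_congr vl Pbl vv Pbb).
  have : w c + 1 - (m + m + m) <= B by rewrite le_max lexx.
  by lra.
suff : 0 < - q' by rewrite oppr_gt0 ltNge q'0.
have -> : - q' = - q + (q - q') by rewrite addKr.
apply/lcs_gt0P; exists c.
  by rewrite lcsDE qq' ?addr0 // ltrDl.
by apply: vgeD qlc (vgeW _ qq'); rewrite lerDl.
Qed.

(** A Gram decomposition over [K] reduces the claim to matrices of rank one. *)
Lemma hadamard_psd d (M : 'I_d -> 'I_d -> K) :
  (forall i j, M i j = M j i) -> psdform M -> psdform (fun i j => Phi (M i j)).
Proof.
move=> Ms Mp; have [s sP] := gram Ms Mp; move=> v; rewrite /qform.
have -> : \sum_i \sum_j v i * v j * Phi (M i j) =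
    \sum_(b <- s) \sum_i \sum_j v i * v j * Phi (b i * b j).
  rewrite [RHS]exchange_big; apply: eq_bigr => i _; rewrite [RHS]exchange_big.
  by apply: eq_bigr => j _; rewrite sP raddf_sum mulr_sumr.
by apply: sumr_ge0 => b _; apply: hadamard_square_ge0.
Qed.

End Positivity.

End Hadamard.

(** * Separation from the cone of Gram matrices *)

Section UltraLimit.

Variables (R : realType) (U : ultrafilter).
Implicit Types (x y : nat -> R) (l : R).

Definition ulim x l := forall e : R, 0 < e -> U (fun n => `|x n - l| < e).

(** The limit is the supremum of the numbers below almost all [x n]. Limits along [U] replace the
    extraction of convergent subsequences. *)
Lemma ulim_exists x B : U (fun n => `|x n| <= B) -> exists l, ulim x l.
Proof.
move=> xB; pose A : set R := fun r => U (fun n => r <= x n).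
have supA : has_sup A.
  split; first by exists (- B); apply: large_sub xB => n; rewrite ler_norml => /andP[].
  exists B => r Ar; have [n [rx]] := large_exists (large_and Ar xB).
  by rewrite ler_norml => /andP[_]; apply: le_trans.
exists (sup A) => e e0; have [r Ar rl] := sup_adherent e0 supA.
have : U (fun n => ~ (sup A + e <= x n)).
  apply: large_not => Ae; have := sup_upper_bound supA Ae.
  by rewrite gerDl leNgt e0.
move=> /(large_and Ar); apply: large_sub => n [rx /negP]; rewrite -ltNge => xe.
by rewrite ltr_norml; apply/andP; split; lra.
Qed.

Lemma ulim_cst l : ulim (fun=> l) l.
Proof. by move=> e e0; apply: large_all => n; rewrite subrr normr0. Qed.

Lemma ulimD x y a b : ulim x a -> ulim y b -> ulim (fun n => x n + y n) (a + b).
Proof.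
move=> xa yb e e0; have e2 : 0 < e / 2 by rewrite divr_gt0.
apply: large_sub (large_and (xa _ e2) (yb _ e2)) => n [].
by rewrite !ltr_norml => /andP[? ?] /andP[? ?]; apply/andP; split; lra.
Qed.

Lemma ulimM x y a b : ulim x a -> ulim y b -> ulim (fun n => x n * y n) (a * b).
Proof.
move=> xa yb e e0.
have a1 : 0 < `|a| + 1 by rewrite ltr_wpDl.
have b1 : 0 < `|b| + 1 by rewrite ltr_wpDl.
have d1 : 0 < e / 2 / (`|b| + 1) by rewrite !divr_gt0.
have d2 : 0 < e / 2 / (`|a| + 1) by rewrite !divr_gt0.
have U3 := large_and (xa _ d1) (large_and (yb _ d2) (yb _ ltr01)).
apply: large_sub U3 => n [h1 [h2 h3]].
rewrite (_ : _ - _ = (x n - a) * y n + a * (y n - b)); last by ring.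
apply: le_lt_trans (ler_normD _ _) _; rewrite !normrM.
have yn : `|y n| <= `|b| + 1.
  by rewrite -[y n](subrK b) addrC; apply: le_trans (ler_normD _ _) _; rewrite lerD2l ltW.
have t1 : `|x n - a| * `|y n| < e / 2.
  apply: le_lt_trans (ler_wpM2l (normr_ge0 _) yn) _.
  by rewrite -ltr_pdivlMr.
have t2 : `|a| * `|y n - b| <= e / 2.
  apply: le_trans (ler_wpM2l (normr_ge0 _) (ltW h2)) _.
  rewrite mulrCA ler_piMr ?divr_ge0 ?(ltW e0) // ler_pdivrMr //.
  by rewrite mul1r lerDl.
lra.
Qed.

Lemma ulim_sum (I : Type) (r : seq I) (x : I -> nat -> R) (l : I -> R) :
  (forall i, ulim (x i) (l i)) ->
  ulim (fun n => \sum_(i <- r) x i n) (\sum_(i <- r) l i).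
Proof.
move=> xl; elim: r => [|i r IHr].
  by rewrite big_nil => e e0; apply: large_all => n; rewrite big_nil subrr normr0.
rewrite big_cons => e e0; apply: large_sub (ulimD (xl i) IHr e0) => n.
by rewrite big_cons.
Qed.

Lemma ulim_le x y a b : ulim x a -> ulim y b -> U (fun n => x n <= y n) -> a <= b.
Proof.
move=> xa yb xy; rewrite leNgt; apply/negP => ba.
have e0 : 0 < (a - b) / 2 by rewrite divr_gt0 ?subr_gt0.
have [n [h1 [h2 h3]]] := large_exists (large_and xy (large_and (xa _ e0) (yb _ e0))).
by move: h2 h3; rewrite !ltr_norml => /andP[? ?] /andP[? ?]; lra.
Qed.

End UltraLimit.

Lemma qform2 (F : comPzRingType) d (M : 'I_d -> 'I_d -> F) (t : F) (a b : 'I_d) :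
  qform M (fun i => t * (i == a)%:R + (i == b)%:R) =
  t ^+ 2 * M a a + t * (M a b + M b a) + M b b.
Proof.
have one c (X : 'I_d -> F) : \sum_i (i == c)%:R * X i = X c.
  rewrite (bigD1 c) //= eqxx mul1r big1 ?addr0 // => i /negPf->.
  by rewrite mul0r.
have two (X : 'I_d -> F) : \sum_i (t * (i == a)%:R + (i == b)%:R) * X i = t * X a + X b.
  under eq_bigr => i _ do rewrite mulrDl -mulrA.
  by rewrite big_split /= -mulr_sumr !one.
transitivity (\sum_i (t * (i == a)%:R + (i == b)%:R) * (t * M i a + M i b)).
  apply: eq_bigr => i _; rewrite -two mulr_sumr.
  by apply: eq_bigr => j _; rewrite mulrA.
by rewrite two; ring.
Qed.

Section PsdEntries.

Variables (F : realFieldType) (d : nat) (M : 'I_d -> 'I_d -> F).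
Hypotheses (Ms : forall i j, M i j = M j i) (Mp : psdform M).

Lemma psd_pair (t : F) i j : 0 <= t ^+ 2 * M i i + (t * M i j) *+ 2 + M j j.
Proof.
have := Mp (fun l => t * (l == i)%:R + (l == j)%:R); rewrite qform2 (Ms j i).
by rewrite -mulr2n mulrnAr.
Qed.

Lemma psd_diag i : 0 <= M i i.
Proof. by have := psd_pair 0 i i; rewrite expr0n /= !mul0r mul0rn !add0r. Qed.

Lemma psd_zero i j : M i i = 0 -> M i j = 0.
Proof.
move=> Mi; apply: (@linear_ge0 _ _ (M j j / 2)) => t.
by have := psd_pair t i j; rewrite Mi; lra.
Qed.

(** Evaluating the form at the sum and the difference of two basis vectors bounds twice the entry by
    two diagonal entries. Hence the trace controls the whole matrix. *)
Lemma psd_entry i j : `|M i j| <= \sum_l M l l.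
Proof.
have := psd_pair 1 i j; have := psd_pair (-1) i j; have := psd_diag i.
have := psd_diag j; rewrite sqrrN expr1n !mul1r mulN1r.
have tr l : M l l <= \sum_l M l l.
  by rewrite (bigD1 l) //= lerDl sumr_ge0 // => l' _; apply: psd_diag.
have := tr i; have := tr j; rewrite ler_norml => ? ? ? ? ? ?; apply/andP; split; lra.
Qed.

End PsdEntries.

(** * Best approximation by elements with a psd Gram matrix *)

Section Separation.

Variables (R : realType) (G : lmodType rat) (w : weight R G).
Variables (m : nat) (E : 'I_m -> G) (J : seq G).
Hypotheses (E_inj : injective E) (J_uniq : uniq J).
Hypothesis EJ : forall i j, E i + E j \in J.
Implicit Types (Q : 'I_m -> 'I_m -> R).

(** The coefficient at [c] of the group ring element with Gram matrix [Q] in the monomials of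
    exponents [E i]. *)
Definition gmap (F : pzRingType) (Q : 'I_m -> 'I_m -> F) c : F :=
  \sum_i \sum_j Q i j * (E i + E j == c)%:R.

Definition spsd (F : realDomainType) (Q : 'I_m -> 'I_m -> F) :=
  (forall i j, Q i j = Q j i) /\ psdform Q.

(* The extremal exponent among those with nonzero diagonal entry is attained by
   only one pair of indices. *)
Lemma gmap_eq0 Q i : spsd Q -> (forall c, c \in J -> gmap Q c = 0) -> Q i i = 0.
Proof.
move=> [Qs Qp] Q0; apply/eqP; apply: contraPT isT => Qi _.
have [j Qj jmax] := @arg_maxP _ _ _ i (fun l => Q l l != 0) (fun l => w (E l)) Qi.
case/negP: Qj; rewrite -(Q0 _ (EJ j j)) /gmap (bigD1 j) //= (bigD1 j) //= eqxx mulr1.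
rewrite [X in _ + X + _]big1 => [|l lj]; last first.
  rewrite (inj_eq (addrI _)) (inj_eq E_inj) (negPf lj); exact: mulr0.
rewrite addr0 big1 ?addr0 // => a aj; apply: big1 => b _.
case: eqP => [Eab|_]; last by rewrite mulr0.
have [Qa|Qa] := eqVneq (Q a a) 0; first by rewrite psd_zero ?mul0r.
have [Qb|Qb] := eqVneq (Q b b) 0; first by rewrite Qs psd_zero ?mul0r.
have := congr1 w Eab; rewrite !wtD.
have := jmax _ Qa; have := jmax _ Qb => /= lb la e.
have /wt_inj/E_inj ea : w (E a) = w (E j) by apply/le_anti/andP; split; lra.
by rewrite ea eqxx in aj.
Qed.

Lemma gmapZ Q t c : gmap (fun i j => t * Q i j) c = t * gmap Q c.
Proof.
rewrite /gmap mulr_sumr; apply: eq_bigr => i _; rewrite mulr_sumr.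
by apply: eq_bigr => j _; rewrite mulrA.
Qed.

Lemma gmapD Q Q' c : gmap (fun i j => Q i j + Q' i j) c = gmap Q c + gmap Q' c.
Proof.
rewrite /gmap -big_split; apply: eq_bigr => i _; rewrite -big_split.
by apply: eq_bigr => j _; rewrite mulrDl.
Qed.

Lemma qformZ (F : comPzRingType) d t (M : 'I_d -> 'I_d -> F) v :
  qform (fun i j => t * M i j) v = t * qform M v.
Proof.
rewrite /qform mulr_sumr; apply: eq_bigr => i _; rewrite mulr_sumr.
by apply: eq_bigr => j _; rewrite mulrCA.
Qed.

Lemma qformD (F : comPzRingType) d (M M' : 'I_d -> 'I_d -> F) v :
  qform (fun i j => M i j + M' i j) v = qform M v + qform M' v.
Proof.
rewrite /qform -big_split; apply: eq_bigr => i _; rewrite -big_split.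
by apply: eq_bigr => j _; rewrite mulrDr.
Qed.

Lemma spsdZ Q t : 0 <= t -> spsd Q -> spsd (fun i j => t * Q i j).
Proof.
move=> t0 [Qs Qp]; split=> [i j|v]; first by rewrite Qs.
by rewrite qformZ mulr_ge0.
Qed.

Lemma spsdD Q Q' : spsd Q -> spsd Q' -> spsd (fun i j => Q i j + Q' i j).
Proof.
move=> [Qs Qp] [Q's Q'p]; split=> [i j|v]; first by rewrite Qs Q's.
by rewrite qformD addr_ge0.
Qed.

Definition gdist (p : G -> R) Q := \sum_(c <- J) (gmap Q c - p c) ^+ 2.

Lemma gdist_ge0 p Q : 0 <= gdist p Q.
Proof. by apply: sumr_ge0 => c _; apply: sqr_ge0. Qed.

Section UltraLimits.

Variables (U : ultrafilter) (Qn : nat -> 'I_m -> 'I_m -> R).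

Definition mlim (Ql : 'I_m -> 'I_m -> R) :=
  forall i j, ulim U (fun n => Qn n i j) (Ql i j).

Lemma mlim_exists B : (forall i j, U (fun n => `|Qn n i j| <= B)) ->
  exists Ql, mlim Ql.
Proof.
move=> QB; have /choice[f fP] (ij : 'I_m * 'I_m) :
    exists l, ulim U (fun n => Qn n ij.1 ij.2) l.
  exact: ulim_exists (QB _ _).
by exists (fun i j => f (i, j)) => i j; apply: (fP (i, j)).
Qed.

Lemma mlim_gmap Ql c : mlim Ql -> ulim U (fun n => gmap (Qn n) c) (gmap Ql c).
Proof.
by move=> lQ; do 2![apply: ulim_sum => ?]; apply: ulimM (lQ _ _) (ulim_cst _ _).
Qed.

Lemma mlim_spsd Ql : mlim Ql -> U (fun n => spsd (Qn n)) -> spsd Ql.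
Proof.
move=> lQ Up; split=> [i j|v].
  apply/le_anti/andP; split; [apply: ulim_le (lQ i j) (lQ j i) _|
    apply: ulim_le (lQ j i) (lQ i j) _];
  by apply: large_sub Up => n [Qs _]; rewrite Qs.
apply: (ulim_le (ulim_cst U 0) (_ : ulim U (fun n => qform (Qn n) v) _)).
  by do 2![apply: ulim_sum => ?]; apply: ulimM (ulim_cst _ _) (lQ _ _).
by apply: large_sub Up => n [_]; apply.
Qed.

Lemma mlim_gdist p Ql : mlim Ql -> ulim U (fun n => gdist p (Qn n)) (gdist p Ql).
Proof.
move=> lQ; apply: ulim_sum => c.
by apply: ulimM; apply: ulimD (mlim_gmap _ lQ) (ulim_cst _ _).
Qed.

End UltraLimits.

(* A minimizing sequence with unbounded traces would, after normalization, converge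
   to a nonzero psd matrix in the kernel of [gmap]. *)
Lemma gdist_min p : exists2 Q, spsd Q & forall Q', spsd Q' -> gdist p Q <= gdist p Q'.
Proof.
have [U] := ultrafilter_exists.
pose A : set R := fun y => exists2 Q, spsd Q & gdist p Q = y.
have infA : has_inf A.
  split; last by exists 0 => _ [Q _ <-]; apply: gdist_ge0.
  exists (gdist p (fun _ _ => 0)), (fun _ _ => 0) => //; split=> // v.
  by rewrite /qform big1 // => i _; rewrite big1 // => j _; rewrite mulr0.
have /choice[Qn QnP] n : exists Q, spsd Q /\ gdist p Q < inf A + n.+1%:R^-1.
  have n0 : 0 < n.+1%:R^-1 :> R by rewrite invr_gt0 ltr0n.
  by have [_ [Q Qp <-] lt] := inf_adherent n0 infA; exists Q.
have inv_small e : 0 < e -> U (fun n => n.+1%:R^-1 < e :> R).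
  move=> e0; apply: large_sub (large_ge U (Num.bound e^-1)) => n le.
  rewrite invf_plt ?posrE ?ltr0n //.
  apply: lt_le_trans (archi_boundP _) _; first by rewrite invr_ge0 ltW.
  by rewrite ler_nat (leq_trans le).
pose tr n := \sum_l Qn n l l.
have tr0 n : 0 <= tr n by apply: sumr_ge0 => l _; case: (QnP n) => -[? ?] _; apply: psd_diag.
have QnB n i j : `|Qn n i j| <= tr n.
  by case: (QnP n) => -[? ?] _; apply: psd_entry.
have [[B trB]|nB] := pselect (exists B, U (fun n => tr n <= B)).
  have [Q lQ] : exists Q, mlim U Qn Q.
    apply: (@mlim_exists _ _ B) => i j; apply: large_sub trB => n.
    exact: le_trans (QnB n i j).
  have Qp : spsd Q by apply: mlim_spsd lQ _; apply: large_all => n; case: (QnP n).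
  exists Q => // Q' Q'p; apply: (@le_trans _ _ (inf A)); last first.
    by apply: ge_inf; [case: infA|exists Q'].
  rewrite leNgt; apply/negP => lt; rewrite -subr_gt0 in lt.
  have := ulim_le (mlim_gdist p lQ) (ulim_cst U (inf A + (gdist p Q - inf A) / 2)).
  move=> /(_ (large_sub _ (inv_small _ (divr_gt0 lt (ltr0n R 2))))) H.
  suff : gdist p Q <= inf A + (gdist p Q - inf A) / 2 by lra.
  by apply: H => n lt1; apply/ltW/(lt_trans (QnP n).2); rewrite ltrD2l.
exfalso; have trL B : U (fun n => B < tr n).
  have : U (fun n => ~ tr n <= B) by apply: large_not => UB; apply: nB; exists B.
  by apply: large_sub => n /negP; rewrite -ltNge.
pose Pn n i j := (tr n)^-1 * Qn n i j.
have [P lP] : exists P, mlim U Pn P.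
  apply: (@mlim_exists _ _ 1) => i j; apply: large_sub (trL 0) => n t0.
  by rewrite normrM gtr0_norm ?invr_gt0 // mulrC ler_pdivrMr // mul1r.
have Pp : spsd P.
  apply: mlim_spsd lP _; apply: large_all => n; apply: spsdZ; first by rewrite invr_ge0.
  by case: (QnP n).
have Ptr : \sum_l P l l = 1.
  have tP : ulim U (fun n => \sum_l Pn n l l) (\sum_l P l l).
    by apply: ulim_sum => l; apply: lP.
  have E1 : U (fun n => \sum_l Pn n l l = 1).
    apply: large_sub (trL 0) => n t0; rewrite -mulr_sumr mulVf ?gt_eqF //.
  apply/le_anti/andP; split; [apply: ulim_le tP (ulim_cst U 1) _|
    apply: ulim_le (ulim_cst U 1) tP _];
  by apply: large_sub E1 => n ->.
suff P0 i : P i i = 0.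
  by move/eqP: Ptr; rewrite big1 // eq_sym oner_eq0.
apply: (gmap_eq0 i Pp) => c cJ; have lc := mlim_gmap c lP.
(* The distances stay below [inf A + 1], and [y <= y ^+ 2 + 1], so the coefficients of the
   minimizing sequence are bounded by [M]; divided by unbounded traces, they tend to 0. *)
pose M := `|p c| + (inf A + 1) + 1.
have gB n : `|gmap (Qn n) c| <= M.
  have [_] := QnP n; have n1 : n.+1%:R^-1 <= 1 :> R by rewrite invf_le1 ?ler1n ?ltr0n.
  have : (gmap (Qn n) c - p c) ^+ 2 <= gdist p (Qn n).
    rewrite /gdist (bigD1_seq c) //= lerDl sumr_ge0 // => c' _; exact: sqr_ge0.
  set g := gmap _ c => h1 h2; rewrite -[g](subrK (p c)) addrC.
  apply: le_trans (ler_normD _ _) _; rewrite /M -addrA lerD2l.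
  have : `|g - p c| ^+ 2 <= inf A + 1.
    rewrite real_normK ?num_real //; apply: le_trans h1 (ltW (lt_le_trans h2 _)).
    by rewrite lerD2l.
  by have := normr_ge0 (g - p c); nra.
apply/eqP/negPn/negP => g0; pose e := `|gmap P c|.
have e0 : 0 < e by rewrite normr_gt0.
have M0 : 0 <= M by apply: le_trans (gB 0%N).
have e2 : 0 < e / 2 by rewrite divr_gt0.
have [n [h1 h2]] := large_exists (large_and (lc _ e2) (trL (M / (e / 2)))).
have t0 : 0 < tr n by apply: le_lt_trans h2; rewrite divr_ge0 // ltW.
have h3 : `|gmap (Pn n) c| < e / 2.
  rewrite gmapZ normrM gtr0_norm ?invr_gt0 // mulrC ltr_pdivrMr //.
  by apply: le_lt_trans (gB n) _; rewrite mulrC -ltr_pdivrMr.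
have : e <= `|gmap (Pn n) c| + `|gmap (Pn n) c - gmap P c|.
  by rewrite /e -{1}[gmap P c](subKr (gmap (Pn n) c)) ler_normB.
lra.
Qed.

(* The functional is the residue of the best approximation of [p] by elements of
   the cone. *)
Theorem gram_separation p : (forall Q, spsd Q -> exists2 c, c \in J & gmap Q c != p c) ->
  exists la : G -> R, (forall z : 'I_m -> R, 0 <= \sum_i \sum_j z i * z j * la (E i + E j)) /\
    \sum_(c <- J) p c * la c < 0.
Proof.
move=> nQ; have [Q Qp Qmin] := gdist_min p; pose r c := gmap Q c - p c.
pose dot (f : G -> R) := \sum_(c <- J) r c * f c.
have dE Q' : gdist p (fun i j => Q i j + Q' i j) =
    gdist p Q + dot (gmap Q') *+ 2 + \sum_(c <- J) gmap Q' c ^+ 2.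
  rewrite /gdist /dot -sumrMnl -!big_split; apply: eq_bigr => c _ /=.
  by rewrite gmapD /r; ring.
have dotZ t Q' : dot (gmap (fun i j => t * Q' i j)) = t * dot (gmap Q').
  by rewrite /dot mulr_sumr; apply: eq_bigr => c _; rewrite gmapZ mulrCA.
have sqZ t Q' : \sum_(c <- J) gmap (fun i j => t * Q' i j) c ^+ 2 =
    t ^+ 2 * \sum_(c <- J) gmap Q' c ^+ 2.
  by rewrite mulr_sumr; apply: eq_bigr => c _; rewrite gmapZ exprMn.
(* First-order condition at the minimum, in any direction along which one can stay in the cone for a
   while. *)
have var Q' (u : R) : 0 < u -> (forall t, 0 < t -> t <= u ->
    spsd (fun i j => Q i j + t * Q' i j)) -> 0 <= dot (gmap Q').
  move=> u0 Q'p; set a := dot _; set b := \sum_(c <- J) gmap Q' c ^+ 2.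
  have b0 : 0 <= b by apply: sumr_ge0 => c _; apply: sqr_ge0.
  rewrite leNgt; apply/negP => a0.
  (* For this step length [2 * t * a + t ^+ 2 * b] is negative, so the distance would decrease. *)
  pose t := Num.min u (- a / (b + 1)).
  have b1 : 0 < b + 1 by rewrite ltr_wpDl.
  have t0 : 0 < t by rewrite lt_min u0 divr_gt0 // oppr_gt0.
  have tb : t * (b + 1) <= - a by rewrite -ler_pdivlMr // ge_min lexx orbT.
  have := Qmin _ (Q'p t t0 _); rewrite dE dotZ sqZ -/a -/b => /(_ _)H.
  have /H : t <= u by rewrite ge_min lexx.
  by nra.
have dot_ge0 Q' : spsd Q' -> 0 <= dot (gmap Q').
  by move=> Q'p; apply: (var Q' 1) => // t t0 _; apply/spsdD/spsdZ/Q'p/ltW.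
(* The direction [- Q] is also admissible: it moves [Q] to [(1 - t) * Q], still in the cone. *)
have dot_le0 : dot (gmap Q) <= 0.
  rewrite -oppr_ge0 -mulN1r -dotZ; apply: (var _ 1) => // t t0 t1.
  rewrite (_ : (fun i j => _) = (fun i j => (1 - t) * Q i j)).
    by apply: spsdZ Qp; rewrite subr_ge0.
  by apply/funext => i; apply/funext => j; ring.
exists r; split=> [z|].
  have := dot_ge0 (fun i j => z i * z j); rewrite /dot => H.
  suff <- : \sum_(c <- J) r c * gmap (fun i j => z i * z j) c =
      \sum_i \sum_j z i * z j * r (E i + E j).
    apply: H; split=> [i j|v]; first by rewrite mulrC.
    rewrite (_ : (fun i j => _) = (fun i j => \sum_(b <- [:: z]) b i * b j)); last first.
      by apply/funext => i; apply/funext => j; rewrite big_seq1.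
    by rewrite qform_gram big_seq1 sqr_ge0.
  rewrite /gmap; under eq_bigr => c _ do rewrite mulr_sumr.
  rewrite exchange_big; apply: eq_bigr => i _ /=.
  under eq_bigr => c _ do rewrite mulr_sumr.
  rewrite exchange_big; apply: eq_bigr => j _ /=.
  rewrite (bigD1_seq (E i + E j)) ?EJ //= eqxx mulr1 big1 ?addr0 1?mulrC // => c ne.
  by rewrite eq_sym (negPf ne) !mulr0.
have [c0 c0J rc0] := nQ Q Qp.
have : 0 < \sum_(c <- J) r c ^+ 2.
  rewrite (bigD1_seq c0) //= ltr_pwDl ?sumr_ge0 // => [|c _]; last exact: sqr_ge0.
  by rewrite exprn_even_gt0 //= subr_eq0.
have -> : \sum_(c <- J) p c * r c = dot (gmap Q) - \sum_(c <- J) r c ^+ 2.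
  by rewrite -sumrB; apply: eq_bigr => c _; rewrite /r; ring.
lra.
Qed.

End Separation.

(** * Exponents and transfer *)

Section Weights.

Variables (R : realType) (n : nat).

Lemma Xn_sub2_irreducible : (0 < n)%N ->
  irreducible_poly ('X^n - 2%:P : {poly rat}).
Proof.
move=> n0; pose q : {poly int} := 'X^n - 2%:P.
have sq : size q = n.+1 by rewrite size_XnsubC.
have -> : 'X^n - 2%:P = map_poly intr q :> {poly rat}.
  by rewrite rmorphB /= map_polyXn map_polyC.
apply/irreducible_rat_int; apply: (@eisenstein_crit 2) => //.
- by rewrite sq; case: (n) n0.
- by have /monicP -> : q \is monic by apply: monicXnsubC.
- by rewrite coefB coefXn coefC eqxx ltn_eqF.
move=> i; rewrite sq coefB coefXn coefC => ilt; rewrite ltn_eqF // sub0r.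
by case: (i == 0%N).
Qed.

(* The powers of the [n]-th root of 2 of exponent below [n] are linearly
   independent over the rationals. *)
Lemma weight_exists : inhabited (weight R 'rV[rat]_n).
Proof.
have [t tE] : exists t : R, (0 < n)%N -> t ^+ n = 2.
  case: n => [|m]; first by exists 0.
  have [||t _ /rootP] := @poly_ivt R ('X^(m.+1) - 2%:P) 0 2.
  - by rewrite ler0n.
  - rewrite !(hornerXn, hornerE) expr0n /= sub0r oppr_le0 ler0n /= subr_ge0.
    by rewrite exprS ler_peMr ?ler0n // exprn_ege1 // ler1n.
  by rewrite !(hornerXn, hornerE) => /subr0_eq; exists t.
pose w (a : 'rV[rat]_n) : R := \sum_i ratr (a 0 i) * t ^+ i.
have wD : {morph w : a b / a + b}.
  move=> a b; rewrite /w -big_split; apply: eq_bigr => i _ /=.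
  by rewrite mxE rmorphD mulrDl.
have wE a : w a = (map_poly ratr (rVpoly a)).[t].
  rewrite (@horner_coef_wide _ n); last by rewrite size_map_poly size_poly.
  by apply: eq_bigr => i _; rewrite coef_map coef_rVpoly_ord.
constructor; apply: (@Weight _ _ w wD) => a b ab.
have wab : (map_poly ratr (rVpoly (a - b))).[t] = 0.
  by rewrite linearB rmorphB hornerD hornerN -!wE ab subrr.
apply/subr0_eq; rewrite -[a - b]rVpolyK; set P := rVpoly _ in wab *.
suff -> : P = 0 by rewrite linear0.
apply/eqP; apply: contraPT isT => P0 _.
have sP : (size P <= n)%N by apply: size_poly.
have n0 : (0 < n)%N by apply: leq_trans sP; rewrite size_poly_gt0.
have [_ irr] := Xn_sub2_irreducible n0; set q := 'X^n - 2%:P in irr.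
have sq : size q = n.+1 by rewrite size_XnsubC.
have cop : coprimep P q.
  apply: contraPT isT => /(irr _)/(_ (dvdp_gcdr _ _)) /eqp_dvdr e _.
  have : q %| P by rewrite (dvdp_trans _ (dvdp_gcdl P q)) // e.
  by move=> /(dvdp_leq P0); rewrite sq ltnNge sP.
have [[u v] /= uv] := Bezout_eq1_coprimepP _ _ cop.
(* Both [P] and [q] vanish at [t], so the Bezout relation evaluates to [0 = 1]. *)
have := congr1 (fun r => (map_poly ratr r).[t]) uv.
rewrite /= rmorphD !rmorphM /= rmorph1 !hornerE wab mulr0 add0r.
have -> : (map_poly ratr q).[t] = 0 :> R.
  by rewrite rmorphB /= map_polyXn map_polyC /= rmorph_nat !(hornerE, hornerXn) tE ?subrr.
by rewrite mulr0 => /eqP; rewrite eq_sym oner_eq0.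
Qed.

End Weights.

(** * Positive formulas over other domains *)

Section Interpretation.

Variables (M : rel_structure) (D : Type).
Variable I : forall r : relsym M, ('I_(arity r) -> D) -> Prop.

(** The symbols of [M] are fixed, but a formula must also be read in larger fields, hence the
    arbitrary domain and interpretation. *)
Fixpoint satin (V : Type) (phi : pos_formula M V) (e : V -> D) {struct phi} : Prop :=
  match phi with
  | PEq x y => e x = e y
  | PRel r xs => I (fun i => e (xs i))
  | PAnd f g => satin f e /\ satin g e
  | POr f g => satin f e \/ satin g e
  | PExists f => exists a, satin f (oapp e a)
  | PForall f => forall a, satin f (oapp e a)
  end.

End Interpretation.

Lemma satin_interp M (V : Type) (phi : pos_formula M V) e :
  satin (@interp M) phi e <-> sat phi e.
Proof.
elim: phi e => //= [V' f IHf g IHg|V' f IHf g IHg|V' f IHf|V' f IHf] e.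
- by rewrite IHf IHg.
- by rewrite IHf IHg.
- by split=> -[a /IHf]; exists a.
- by split=> H a; apply/IHf.
Qed.

Lemma satin_iff M D (I J : forall r : relsym M, ('I_(arity r) -> D) -> Prop)
    (V : Type) (phi : pos_formula M V) e :
  (forall r xs, I r xs <-> J r xs) -> satin I phi e <-> satin J phi e.
Proof.
move=> IJ; elim: phi e => //= [V' f IHf g IHg|V' f IHf g IHg|V' f IHf|V' f IHf] e.
- by rewrite IHf IHg.
- by rewrite IHf IHg.
- by split=> -[a /IHf]; exists a.
- by split=> H a; apply/IHf.
Qed.

(** Positive formulas are preserved by surjective homomorphisms. The section [g] serves at
    [PForall], where a value in [D'] has to be lifted to [D]. *)
Lemma satin_surj M D D' (I : forall r : relsym M, ('I_(arity r) -> D) -> Prop)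
    (J : forall r : relsym M, ('I_(arity r) -> D') -> Prop) (f : D -> D') (g : D' -> D)
    (V : Type) (phi : pos_formula M V) e :
  cancel g f -> (forall r xs, I r xs -> J r (fun i => f (xs i))) ->
  satin I phi e -> satin J phi (fun v => f (e v)).
Proof.
move=> gK IJ.
have fE (V' : Type) (e' : V' -> D) a :
    (fun o => f (oapp e' a o)) = oapp (fun v => f (e' v)) (f a).
  by apply/funext => -[].
elim: phi e => //= [V' x y|V' r xs|V' p IHp q IHq|V' p IHp q IHq|V' p IHp|V' p IHp] e.
- by move=> ->.
- exact: IJ.
- by move=> [/IHp ? /IHq].
- by move=> [/IHp|/IHq]; [left|right].
- by move=> [a /IHp]; rewrite fE; exists (f a).
- by move=> pe a; have /IHp := pe (g a); rewrite fE gK.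
Qed.

Lemma psdmx_form (R : realType) d (A : 'M[R]_d) : psdmx A <-> psdform (fun i j => A i j).
Proof.
have qE (v : 'cV[R]_d) : (v^T *m A *m v) 0 0 = qform (fun i j => A i j) (fun i => v i 0).
  rewrite mxE /qform exchange_big; apply: eq_bigr => i _; rewrite mxE mulr_suml.
  by apply: eq_bigr => j _; rewrite mxE mulrAC.
split=> [Ap v|Ap v]; last by rewrite qE.
have := Ap (\col_i v i); rewrite qE; congr (0 <= _).
by apply: eq_bigr => i _; apply: eq_bigr => j _; rewrite !mxE.
Qed.

Section Spectrahedra.

Variable R : realType.

(** A spectrahedron is a subset of a real space; only a linear matrix inequality chosen for it can
    be read over an extension of the reals. *)
Record pencil (m : nat) (K : ('I_m -> R) -> Prop) := Pencil {
  pdim : nat;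
  pconst : 'M[R]_pdim;
  plin : 'I_m -> 'M[R]_pdim;
  pconst_sym : pconst^T = pconst;
  plin_sym : forall i, (plin i)^T = plin i;
  pencilP : forall x, K x <-> psdmx (pconst + \sum_i x i *: plin i)
}.

Lemma pencil_exists m (K : ('I_m -> R) -> Prop) :
  spectrahedron K -> exists P : pencil K, Logic.True.
Proof. by move=> [d [A0 [A [A0s As AK]]]]; exists (Pencil A0s As AK). Qed.

Definition sym_pencil (K : {m : nat & {K : ('I_m -> R) -> Prop | spectrahedron K}}) :
  pencil (proj1_sig (projT2 K)) :=
  projT1 (cid (pencil_exists (proj2_sig (projT2 K)))).

Definition pencil_entry (F : pzRingType) (h : R -> F) m (K : ('I_m -> R) -> Prop)
    (P : pencil K) (xs : 'I_m -> F) (i j : 'I_(pdim P)) : F :=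
  h (pconst P i j) + \sum_l xs l * h (plin P l i j).

Definition rcf_interp (F : rcfType) (h : {rmorphism R -> F}) (r : spec_sym R) :
    ('I_(spec_arity r) -> F) -> Prop :=
  match r return ('I_(spec_arity r) -> F) -> Prop with
  | Some K => fun xs => psdform (pencil_entry h (P := sym_pencil K) xs)
  | None => fun xs => xs ord0 <> xs ord_max
  end.

Lemma rcf_interp_id (r : spec_sym R) (xs : 'I_(spec_arity r) -> R) :
  @interp (spectrahedra_neq R) r xs <-> rcf_interp (F := R) idfun xs.
Proof.
case: r xs => [K|] xs //=; rewrite (pencilP (sym_pencil K)) psdmx_form.
suff -> : (fun i j => (pconst (sym_pencil K) +
    \sum_l xs l *: plin (sym_pencil K) l) i j) =
  pencil_entry idfun (P := sym_pencil K) xs by [].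
apply/funext => i; apply/funext => j; rewrite !mxE summxE; congr (_ + _).
by apply: eq_bigr => l _; rewrite mxE.
Qed.

Lemma nth_block (F : nmodType) m (x : 'I_m -> F) e (i : 'I_m) :
  ([seq x i | i : 'I_m] ++ e)`_i = x i.
Proof.
rewrite nth_cat size_map size_enum_ord ltn_ord (nth_map i) ?size_enum_ord //.
by rewrite nth_ord_enum.
Qed.

Lemma nth_block_shift (F : nmodType) m (x : 'I_m -> F) e j :
  ([seq x i | i : 'I_m] ++ e)`_(m + j) = e`_j.
Proof. by rewrite nth_cat size_map size_enum_ord ltnNge leq_addr /= addKn. Qed.

(** The map [nu] places the free variables in the environment; under a quantifier [None] takes slot
    0 and the others move up by one. Positive semidefiniteness costs one block of universal
    quantifiers. *)
Lemma def_satin (V : Type) (phi : pos_formula (spectrahedra_neq R) V) (nu : V -> nat) :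
  definable (fun (F : rcfType) (h : {rmorphism R -> F}) e =>
    satin (M := spectrahedra_neq R) (rcf_interp h) phi (fun v => e`_(nu v))).
Proof.
elim: phi nu => /= [V' x y|V' r xs|V' p IHp q IHq|V' p IHp q IHq|V' p IHp|V' p IHp] nu.
- by apply: def_eq; apply: tdef_var.
- case: r xs => [K|] xs /=; last first.
    by apply: def_not; apply: def_eq; apply: tdef_var.
  set P := sym_pencil K; set d := pdim P.
  apply: (def_ext _ (def_allb d (def_ge0 (_ : tdefinable (fun (F : rcfType) h e =>
    \sum_(i : 'I_d) \sum_(j : 'I_d) e`_i * e`_j *
      (h (pconst P i j) + \sum_l e`_(d + nu (xs l)) * h (plin P l i j))))))) => [F h e|].
    suff E v : \sum_(i : 'I_d) \sum_(j : 'I_d)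
        ([seq v i | i : 'I_d] ++ e)`_i * ([seq v i | i : 'I_d] ++ e)`_j *
        (h (pconst P i j) + \sum_l ([seq v i | i : 'I_d] ++ e)`_(d + nu (xs l)) *
          h (plin P l i j)) = qform (pencil_entry h (P := P) (fun l => e`_(nu (xs l)))) v.
      by split=> H v; have := H v; rewrite E.
    apply: eq_bigr => i _; apply: eq_bigr => j _; rewrite !nth_block; congr (_ * (_ + _)).
    by apply: eq_bigr => l _; rewrite nth_block_shift.
  apply: tdef_sum => i; apply: tdef_sum => j; apply: tdef_mul.
    by apply: tdef_mul; apply: tdef_var.
  apply: tdef_add; first exact: tdef_const.
  by apply: tdef_sum => l; apply: tdef_mul; [apply: tdef_var|apply: tdef_const].
- exact: def_and.
- exact: def_or.
- pose nu' o := if o is Some v then (nu v).+1 else 0%N.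
  apply: (def_ext _ (def_ex (IHp nu'))) => F h e.
  have E a : (fun o => (a :: e)`_(nu' o)) = oapp (fun v => e`_(nu v)) a.
    by apply/funext => -[].
  by split=> -[a]; rewrite ?E => pa; exists a; rewrite ?E.
- pose nu' o := if o is Some v then (nu v).+1 else 0%N.
  apply: (def_ext _ (def_all (IHp nu'))) => F h e.
  have E a : (fun o => (a :: e)`_(nu' o)) = oapp (fun v => e`_(nu v)) a.
    by apply/funext => -[].
  by split=> H a; have := H a; rewrite E.
Qed.

End Spectrahedra.

(** * Coefficient families, sums of squares and Gram matrices *)

Section Coefficients.

Variables (n : nat) (S : {fset 'X_{1..n}}).

Definition qexp (m : 'X_{1..n}) : 'rV[rat]_n := \row_i (m i)%:R.

Lemma msupp_sum (F : nzRingType) (V : zmodType) (p : {mpoly F[n]}) (X : F -> 'X_{1..n} -> V) :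
  (forall m, X 0 m = 0) -> {subset msupp p <= S} ->
  \sum_(m <- msupp p) X p@_m m = \sum_(s : S) X p@_(val s) (val s).
Proof.
move=> X0 pS; rewrite -(big_seq_fsetE _ S predT (fun m => X p@_m m)) /=.
have cov : fcover (fun m => X p@_m m) (msupp p).
  by move=> m; apply: contraNT => /memN_msupp_eq0 ->; rewrite X0.
rewrite -(fsumE (msupp_uniq p) cov) -fsumE ?fset_uniq //.
by move=> m /cov /pS.
Qed.

Definition sparse_eval (F : pzRingType) (c : S -> F) (x : 'I_n -> F) : F :=
  \sum_(s : S) c s * \prod_i x i ^+ (val s) i.

(** This removes the polynomials from the membership condition, which becomes a first-order
    statement about the coefficients. *)
Lemma Pplus_coefP (F : rcfType) (c : S -> F) :
  Pplus_coef c <-> forall x, 0 <= sparse_eval c x.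
Proof.
have pE (p : {mpoly F[n]}) x : supported_in S p ->
    p.@[x] = sparse_eval (fun s => p@_(val s)) x.
  move=> pS; rewrite mevalE.
  by rewrite (msupp_sum (X := fun a m => a * \prod_i x i ^+ m i)) // => m; rewrite mul0r.
split=> [[p [pS p0] pc] x|c0].
  have -> : c = fun s => p@_(val s) by apply/funext => s; rewrite pc.
  by rewrite -pE.
pose p : {mpoly F[n]} := \sum_(s : S) c s *: 'X_[val s].
have pm m : p@_m = \sum_(s : S) c s * (val s == m)%:R.
  by rewrite /p raddf_sum; apply: eq_bigr => s _; rewrite /= mcoeffZ mcoeffX.
have pc s : p@_(val s) = c s.
  rewrite pm (bigD1 s) //= eqxx mulr1 big1 ?addr0 // => t /negPf ts.
  by rewrite (inj_eq val_inj) ts mulr0.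
have pS : supported_in S p.
  move=> m; rewrite mcoeff_msupp; apply: contraNT => mS; rewrite pm big1 // => s _.
  by case: eqP mS => [<-|]; rewrite ?mulr0 // (valP s).
exists p => [|s]; last by rewrite pc.
split=> // x; rewrite pE //; have -> : (fun s => p@_(val s)) = c by apply/funext.
exact: c0.
Qed.

End Coefficients.

Section GroupRing.

Variables (n : nat) (F : rcfType).
Local Notation G := 'rV[rat]_n.
Local Notation mc := (monalg.mcoeff (K := G) (G := F)).

Lemma mc_qterm c a b : mc b (qterm c a) = c * (a == b)%:R.
Proof. by rewrite /qterm monalg.mcoeffU mulr_natr. Qed.

Lemma mc_sum (I : Type) (r : seq I) (f : I -> qmonalg F n) a :
  mc a (\sum_(i <- r) f i) = \sum_(i <- r) mc a (f i).
Proof. exact: raddf_sum. Qed.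

Lemma mc_qmul (f g : qmonalg F n) (D : seq G) a : uniq D ->
  (forall b, mc b f != 0 -> b \in D) -> (forall b, mc b g != 0 -> b \in D) ->
  mc a (qmul f g) = \sum_(b <- D) \sum_(c <- D) mc b f * mc c g * (b + c == a)%:R.
Proof.
move=> uD fD gD; rewrite /qmul mc_sum.
have supp_sum (h : qmonalg F n) (X : G -> F) : (forall b, mc b h != 0 -> b \in D) ->
    (forall b, mc b h = 0 -> X b = 0) -> \sum_(b <- monalg.msupp h) X b = \sum_(b <- D) X b.
  move=> hD X0; have cov : fcover X (monalg.msupp h).
    by move=> b; apply: contraNT => /monalg.mcoeff_outdom /X0 ->.
  rewrite -(fsumE (fset_uniq _) cov) -fsumE // => b.
  by move=> Xb; apply: hD; apply: contraNneq Xb => /X0 ->.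
rewrite -(supp_sum f) // => [|b fb]; last first.
  by rewrite big1 // => c _; rewrite fb !mul0r.
apply: eq_bigr => b _; rewrite mc_sum -(supp_sum g) // => [|c gc]; last first.
  by rewrite gc mulr0 mul0r.
by apply: eq_bigr => c _; rewrite mc_qterm.
Qed.

(** The Gram matrix is a sum of rank-one matrices, and the one given by [b] is the Gram matrix of
    the square of [g b]. *)
Lemma qsos_gram (S : {fset 'X_{1..n}}) (p : {mpoly F[n]}) m (E : 'I_m -> G) (J : seq G)
    (Q : 'I_m -> 'I_m -> F) :
  injective E -> (forall i j, E i + E j \in J) -> (forall s : S, qexp (val s) \in J) ->
  supported_in S p -> spsd Q ->
  (forall a, a \in J -> gmap E Q a = \sum_(s : S) p@_(val s) * (qexp (val s) == a)%:R) ->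
  qsos (qmonalg_of_mpoly p).
Proof.
move=> E_inj EJ SJ pS [Qs Qp] QJ; have [t tP] := gram Qs Qp.
pose g (b : 'I_m -> F) : qmonalg F n := \sum_i qterm (b i) (E i).
have gE b a : mc a (g b) = \sum_i b i * (E i == a)%:R.
  by rewrite mc_sum; apply: eq_bigr => i _; rewrite mc_qterm.
have gEi b i : mc (E i) (g b) = b i.
  rewrite gE (bigD1 i) //= eqxx mulr1 big1 ?addr0 // => j /negPf ji.
  by rewrite (inj_eq E_inj) ji mulr0.
pose D := [seq E i | i : 'I_m].
have uD : uniq D by rewrite map_inj_uniq ?enum_uniq.
have gD b a : mc a (g b) != 0 -> a \in D.
  apply: contraNT => aD; rewrite gE big1 // => i _.
  by case: eqP aD => [<-|]; rewrite ?mulr0 // map_f ?mem_enum.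
exists (size t), (fun l => g (nth (fun=> 0) t l)).
apply/monalg.malgP => a; rewrite [RHS]mc_sum.
transitivity (\sum_(s : S) p@_(val s) * (qexp (val s) == a)%:R).
  rewrite /qmonalg_of_mpoly mc_sum -(msupp_sum (X := fun c e => c * (qexp e == a)%:R)) // => [|e].
    by apply: eq_bigr => e _; rewrite mc_qterm.
  by rewrite mul0r.
transitivity (gmap E Q a).
  (* Outside [J] both coefficients vanish, since [J] contains all sums of exponents and the support
     of [p]. *)
  have [/QJ //|aJ] := boolP (a \in J).
  rewrite /gmap !big1 // => [i _|s _]; last first.
    by case: eqP aJ => [<-|]; rewrite ?mulr0 // SJ.
  by apply: big1 => j _; case: eqP aJ => [<-|]; rewrite ?mulr0 // EJ.
transitivity (\sum_(b <- t) gmap E (fun i j => b i * b j) a).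
  rewrite /gmap [RHS]exchange_big; apply: eq_bigr => i _ /=.
  rewrite [RHS]exchange_big; apply: eq_bigr => j _ /=.
  by rewrite tP mulr_suml.
rewrite (big_nth (fun=> 0)) big_mkord; apply: eq_bigr => l _.
rewrite (mc_qmul a uD (@gD _) (@gD _)) /D big_map big_enum; apply: eq_bigr => i _ /=.
by rewrite big_map big_enum; apply: eq_bigr => j _ /=; rewrite !gEi.
Qed.

End GroupRing.

Section GramTransfer.

Variables (n : nat) (S : {fset 'X_{1..n}}) (m : nat) (E : 'I_m -> 'rV[rat]_n).
Variable J : seq 'rV[rat]_n.
Local Notation G := 'rV[rat]_n.

Lemma def_sparse_ge0 (F0 : realFieldType) :
  definable (F := F0) (fun F h e => forall x : 'I_n -> F,
    0 <= sparse_eval (fun s : S => e`_(enum_rank s)) x).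
Proof.
apply: (def_ext _ (def_allb n (def_ge0 (_ : tdefinable (fun F h e =>
  sparse_eval (fun s : S => e`_(n + enum_rank s)) (fun i => e`_i)))))) => [F h e|].
  suff Ex (x : 'I_n -> F) :
      sparse_eval (fun s : S => ([seq x i | i : 'I_n] ++ e)`_(n + enum_rank s))
      (fun i => ([seq x i | i : 'I_n] ++ e)`_i) =
    sparse_eval (fun s : S => e`_(enum_rank s)) x.
    by split=> H x; have := H x; rewrite Ex.
  apply: eq_bigr => s _; rewrite nth_block_shift; congr (_ * _).
  by apply: eq_bigr => i _; rewrite nth_block.
apply: tdef_sum => s; apply: tdef_mul; first exact: tdef_var.
by apply: tdef_prod => i; apply: tdef_exp; apply: tdef_var.
Qed.

Definition sparse_coef (F : pzRingType) (c : S -> F) (a : G) : F :=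
  \sum_(s : S) c s * (qexp (val s) == a)%:R.

Definition gramless (F : rcfType) (c : S -> F) :=
  (forall x, 0 <= sparse_eval c x) /\
  forall Q, spsd Q -> exists2 a, a \in J & gmap E Q a != sparse_coef c a.

Lemma def_gramless (F0 : realFieldType) :
  definable (F := F0) (fun F h e => gramless (fun s : S => e`_(enum_rank s))).
Proof.
apply: def_and; first exact: def_sparse_ge0.
(* Layout of the environment: the [m * m] entries of the matrix come first, then the coefficients of
   the polynomial. *)
pose Q (F : rcfType) (e : seq F) (i j : 'I_m) := e`_(mxvec_index i j).
pose c (F : rcfType) (e : seq F) (s : S) := e`_(m * m + enum_rank s).
have defP : definable (F := F0) (fun F h e => spsd (Q F e) ->
    ~ forall a, a \in J -> gmap E (Q F e) a = sparse_coef (c F e) a).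
  apply: def_imp.
    apply: def_and.
      have symP : definable (F := F0) (fun F h e => forall ij : 'I_m * 'I_m,
          ij \in enum [set: 'I_m * 'I_m] -> Q F e ij.1 ij.2 = Q F e ij.2 ij.1).
        by apply: def_all_seq => ij; apply: def_eq; apply: tdef_var.
      apply: (def_ext _ symP) => F h e; split=> [H i j|H ij _]; last exact: H.
      by apply: (H (i, j)); rewrite mem_enum inE.
    apply: (def_ext _ (def_allb m (def_ge0 (_ : tdefinable (fun F h e =>
      \sum_(i : 'I_m) \sum_(j : 'I_m) e`_i * e`_j * e`_(m + mxvec_index i j)))))) => [F h e|].
      suff Ez (z : 'I_m -> F) : \sum_(i : 'I_m) \sum_(j : 'I_m)
          ([seq z i | i : 'I_m] ++ e)`_i * ([seq z i | i : 'I_m] ++ e)`_j *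
          ([seq z i | i : 'I_m] ++ e)`_(m + mxvec_index i j) = qform (Q F e) z.
        by split=> H z; have := H z; rewrite Ez.
      by apply: eq_bigr => i _; apply: eq_bigr => j _; rewrite !nth_block nth_block_shift.
    apply: tdef_sum => i; apply: tdef_sum => j; apply: tdef_mul; last exact: tdef_var.
    by apply: tdef_mul; apply: tdef_var.
  apply/def_not/def_all_seq => a; apply: def_eq.
    apply: tdef_sum => i; apply: tdef_sum => j.
    by apply: tdef_mul; [apply: tdef_var|apply: tdef_nat].
  by apply: tdef_sum => s; apply: tdef_mul; [apply: tdef_var|apply: tdef_nat].
apply: (def_ext _ (def_allb (m * m) defP)) => F h e.
have QE (y : 'I_(m * m) -> F) : Q F ([seq y k | k : 'I_(m * m)] ++ e) =
    fun i j => y (mxvec_index i j).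
  by apply/funext => i; apply/funext => j; apply: nth_block.
have cE (y : 'I_(m * m) -> F) : c F ([seq y k | k : 'I_(m * m)] ++ e) =
    fun s => e`_(enum_rank s).
  by apply/funext => s; apply: nth_block_shift.
split=> [H M Mp|H y].
  have := H (fun k => mxvec (\matrix_(i, j) M i j) 0 k); rewrite QE cE.
  have -> : (fun i j => mxvec (\matrix_(i, j) M i j) 0 (mxvec_index i j)) = M.
    by apply/funext => i; apply/funext => j; rewrite mxvecE mxE.
  move=> /(_ Mp) neq; apply: contrapT => nex; apply: neq => a aJ.
  by apply/eqP; apply: contrapT => /negP ne; apply: nex; exists a.
rewrite QE cE => /H[a aJ ne] eqJ.
by rewrite eqJ ?eqxx in ne.
Qed.

(** Existence of such a family is a sentence without parameters, so it passes from [F] to [F']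
    through the rationals. *)
Lemma gramless_transfer (F F' : rcfType) :
  (exists c : S -> F, gramless c) -> exists c : S -> F', gramless c.
Proof.
have toV (L : rcfType) (c : S -> L) :
    (fun s => [seq c (enum_val j) | j : 'I_#|{: S}|]`_(enum_rank s)) = c.
  apply/funext => s; have := nth_block (fun j => c (enum_val j)) [::] (enum_rank s).
  by rewrite cats0 enum_rankK.
have defE := def_exb #|{: S}| (def_gramless rat).
have := definable_transfer (P := _) [::] (@ler_rat F) (@ler_rat F') defE.
move=> /= [H _] [c cF].
have [|x xF'] := H; last by eexists; apply: xF'.
by exists (fun j => c (enum_val j)); rewrite cats0 toV.
Qed.

End GramTransfer.

Section Functional.

Variables (R : realType) (n : nat) (S : {fset 'X_{1..n}}) (w : weight R 'rV[rat]_n).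
Variables (m : nat) (E : 'I_m -> 'rV[rat]_n) (J : seq 'rV[rat]_n).
Hypotheses (E_inj : injective E) (J_uniq : uniq J).
Hypothesis EJ : forall i j, E i + E j \in J.
Hypothesis SJ : forall s : S, qexp (val s) \in J.
Local Notation G := 'rV[rat]_n.

(** The separating functional is only nonnegative at the exponents [E i + E i]. Adding a small
    constant [d] to all its values, that is [d] times the evaluation at (1, ..., 1), makes it
    positive there and keeps it negative on [c]. *)
Lemma gramless_functional (c : S -> R) : gramless E J c ->
  exists la : G -> R, [/\
    forall d (z : 'I_d -> R) (a : 'I_d -> G), (forall i, exists l, a i = E l) ->
      0 <= \sum_i \sum_j z i * z j * la (a i + a j),
    \sum_(s : S) c s * la (qexp (val s)) < 0 &
    forall i, 0 < la (E i + E i)].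
Proof.
move=> [_ cQ]; have [la [la_psd la_neg]] := gram_separation w E_inj J_uniq EJ cQ.
have psdE d (z : 'I_d -> R) (a : 'I_d -> G) : (forall i, exists l, a i = E l) ->
    0 <= \sum_i \sum_j z i * z j * la (a i + a j).
  (* The family [a] may repeat exponents; the coordinates of [z] with the same exponent are added
     up. *)
  move=> aE; have := la_psd (fun l => \sum_i z i * (a i == E l)%:R); congr (0 <= _).
  have one (X : G -> R) : \sum_l (\sum_i z i * (a i == E l)%:R) * X (E l) =
      \sum_i z i * X (a i).
    under eq_bigr => l _ do rewrite mulr_suml.
    rewrite exchange_big; apply: eq_bigr => i _ /=; have [l0 al0] := aE i.
    rewrite (bigD1 l0) //= al0 eqxx mulr1 big1 ?addr0 // => l ll.
    by rewrite (inj_eq E_inj) eq_sym (negPf ll) mulr0 mul0r.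
  transitivity (\sum_i z i * \sum_j z j * la (a i + a j)).
    rewrite -(one (fun x => \sum_j z j * la (x + a j))); apply: eq_bigr => l _.
    rewrite -(one (fun y => la (E l + y))) mulr_sumr; apply: eq_bigr => l' _.
    by rewrite mulrA.
  by apply: eq_bigr => i _; rewrite mulr_sumr; apply: eq_bigr => j _; rewrite mulrA.
have negE : \sum_(s : S) c s * la (qexp (val s)) < 0.
  move: la_neg; congr (_ < 0); rewrite /sparse_coef.
  under eq_bigr => a _ do rewrite mulr_suml.
  rewrite exchange_big; apply: eq_bigr => s _ /=.
  rewrite (bigD1_seq (qexp (val s))) ?SJ //= eqxx mulr1 big1 ?addr0 // => a ne.
  by rewrite eq_sym (negPf ne) mulr0 mul0r.
set N := \sum_(s : S) _ in negE; pose B := `|\sum_(s : S) c s| + 1.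
have B0 : 0 < B by rewrite ltr_wpDl.
(* The evaluation of the polynomial at (1, ..., 1) is at most [B], so the added constant uses up at
   most half of the gap [- N]. *)
pose d := - N / 2 / B.
have d0 : 0 < d by rewrite !divr_gt0 // oppr_gt0.
exists (fun a => la a + d); split.
- move=> k z a aE; have := psdE k z a aE.
  have -> : \sum_i \sum_j z i * z j * (la (a i + a j) + d) =
      \sum_i \sum_j z i * z j * la (a i + a j) + d * (\sum_i z i) ^+ 2.
    rewrite expr2 mulr_suml mulr_sumr -big_split; apply: eq_bigr => i _ /=.
    rewrite !mulr_sumr -big_split; apply: eq_bigr => j _ /=; ring.
  by move=> h; rewrite addr_ge0 // mulr_ge0 ?sqr_ge0 // ltW.
- have -> : \sum_(s : S) c s * (la (qexp (val s)) + d) = N + (\sum_(s : S) c s) * d.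
    rewrite /N mulr_suml -big_split; apply: eq_bigr => s _; exact: mulrDr.
  have : (\sum_(s : S) c s) * d <= - N / 2.
    apply: le_trans (ler_norm _) _; rewrite normrM (gtr0_norm d0).
    apply: (@le_trans _ _ (B * d)); first by rewrite ler_pM2r // lerDl.
    by rewrite /d mulrC divfK // gt_eqF.
  by lra.
- move=> i; rewrite ltr_wpDl //.
  have := psdE 1 (fun=> 1) (fun=> E i) (fun _ => ex_intro _ i erefl).
  by rewrite !big_ord1 !mul1r.
Qed.

End Functional.

(** * Positive definitions and Hadamard multipliers *)

Section Exhaustion.

Variables (n : nat) (S : {fset 'X_{1..n}}).
Local Notation G := 'rV[rat]_n.

(* An increasing exhaustion of the countable group of exponents by finite sets. *)
Definition exps (N : nat) : seq G := undup (pmap choice.unpickle (iota 0 N)).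
Definition exp_fam N (i : 'I_(size (exps N))) : G := nth 0 (exps N) i.
Definition exp_sums N : seq G :=
  undup ([seq a + b | a <- exps N, b <- exps N] ++ [seq qexp (val s) | s : S]).

Lemma exp_fam_inj N : injective (@exp_fam N).
Proof. by move=> i j /eqP; rewrite nth_uniq ?undup_uniq // => /eqP/val_inj. Qed.

Lemma exp_fam_mem N i : @exp_fam N i \in exps N.
Proof. exact: mem_nth. Qed.

Lemma exp_sums_sum N i j : @exp_fam N i + @exp_fam N j \in exp_sums N.
Proof. by rewrite mem_undup mem_cat allpairs_f ?exp_fam_mem. Qed.

Lemma exp_sums_supp N (s : S) : qexp (val s) \in exp_sums N.
Proof.
rewrite mem_undup mem_cat; apply/orP; right; apply/mapP.
by exists s; rewrite ?mem_enum.
Qed.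

Lemma exp_fam_eventually (U : ultrafilter) (a : G) :
  U (fun N => exists i, a = @exp_fam N i).
Proof.
apply: large_sub (large_ge U (choice.pickle a).+1) => N lt.
have aN : a \in exps N.
  rewrite mem_undup mem_pmap; apply/mapP; exists (choice.pickle a); rewrite ?choice.pickleK //.
  by rewrite mem_iota.
have iN : (index a (exps N) < size (exps N))%N by rewrite index_mem.
by exists (Ordinal iN); rewrite /exp_fam /= nth_index.
Qed.

End Exhaustion.

Lemma large_forall (U : ultrafilter) d (P : 'I_d -> nat -> Prop) :
  (forall i, U (P i)) -> U (fun N => forall i, P i N).
Proof.
move=> UP; suff H : forall r : seq 'I_d, U (fun N => forall i, i \in r -> P i N).
  by apply: large_sub (H (enum 'I_d)) => N PN i; apply: PN; rewrite mem_enum.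
elim=> [|i r IHr]; first by apply: large_all.
by apply: large_sub (large_and (UP i) IHr) => N [Pi Pr] j; rewrite inE => /predU1P[->|/Pr].
Qed.

Lemma lim_functional (R : realType) n (S : {fset 'X_{1..n}}) (U : ultrafilter) :
  (exists (F : rcfType) (p : {mpoly F[n]}),
      in_Pplus S p /\ ~ qsos (qmonalg_of_mpoly p)) ->
  exists (c : S -> upow U R) (la : 'rV[rat]_n -> upow U R),
    [/\ forall x, 0 <= sparse_eval c x, psd_kernel la, forall a, 0 < la a,
        la 0 = 1 & \sum_(s : S) c s * la (qexp (val s)) < 0].
Proof.
move=> [F [p [[pS p0] np]]]; have [w] := weight_exists R n.
have /choice[cl_ /choice[ll llP]] N : exists c : S -> R, exists la : 'rV[rat]_n -> R,
  (forall x, 0 <= sparse_eval c x) /\ [/\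
    forall d (z : 'I_d -> R) (a : 'I_d -> 'rV[rat]_n),
      (forall i, exists l, a i = exp_fam (N := N) l) ->
      0 <= \sum_i \sum_j z i * z j * la (a i + a j),
    \sum_(s : S) c s * la (qexp (val s)) < 0 &
    forall i, 0 < la (@exp_fam n N i + exp_fam i)].
  have [] := @gramless_transfer n S _ (@exp_fam n N) (exp_sums S N) F R.
    exists (fun s => p@_(val s)); split.
      by apply/Pplus_coefP; exists p.
    move=> Q Qp; apply: contrapT => nex; apply: np.
    apply: (qsos_gram (@exp_fam_inj n N) (@exp_sums_sum n S N) (@exp_sums_supp n S N) pS Qp).
    move=> a aJ; apply/eqP; apply: contrapT => /negP ne.
    by apply: nex; exists a.
  move=> c cG; exists c; have [la laP] := gramless_functional w (@exp_fam_inj n N) (undup_uniq _)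
    (@exp_sums_sum n S N) (@exp_sums_supp n S N) cG.
  by exists la; split=> //; case: cG.
pose c s : upow U R := cl U (fun N => cl_ N s).
pose L a : upow U R := cl U (fun N => ll N a).
have L_psd d (z : 'I_d -> upow U R) a : 0 <= \sum_i \sum_j z i * z j * L (a i + a j).
  pose zN i := repr (z i); have zE i : z i = cl U (zN i) by rewrite cl_repr.
  have -> : \sum_i \sum_j z i * z j * L (a i + a j) =
      cl U (fun N => \sum_i \sum_j zN i N * zN j N * ll N (a i + a j)).
    rewrite -cl_sum; apply: eq_bigr => i _; rewrite -cl_sum; apply: eq_bigr => j _.
    by rewrite !zE !clM.
  apply/clle; have := large_forall (fun i => exp_fam_eventually U (a i)).
  by apply: large_sub => N aN; have [_ [psd _ _]] := llP N; apply: psd.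
have L_gt0 a : 0 < L a.
  (* Halving exponents: [a] is twice [2^-1 *: a], which belongs to almost all of the finite
     families. *)
  apply/cllt; apply: large_sub (exp_fam_eventually U (2^-1 *: a)) => N [i iE].
  have [_ [_ _ /(_ i)]] := llP N; rewrite -iE -scalerDl.
  by rewrite (_ : 2^-1 + 2^-1 = 1 :> rat) // scale1r.
have L_neg : \sum_(s : S) c s * L (qexp (val s)) < 0.
  have -> : \sum_(s : S) c s * L (qexp (val s)) =
      cl U (fun N => \sum_(s : S) cl_ N s * ll N (qexp (val s))).
    by rewrite -cl_sum; apply: eq_bigr => s _; rewrite clM.
  by apply/cllt/large_all => N; case: (llP N) => _ [].
(* Dividing by the positive value [L 0] normalizes the functional, so that its multiplier fixes
   constants. *)
exists c, (fun a => L a / L 0); split.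
- move=> x; pose xN i := repr (x i).
  have -> : sparse_eval c x = cl U (fun N => sparse_eval (cl_ N) (fun i => xN i N)).
    rewrite -cl_sum; apply: eq_bigr => s _; rewrite -clM; congr (_ * _).
    by rewrite -cl_prod; apply: eq_bigr => i _; rewrite -clX cl_repr.
  by apply/clle/large_all => N; case: (llP N).
- move=> d z a; have := divr_ge0 (L_psd d z a) (ltW (L_gt0 0)); congr (0 <= _).
  rewrite mulr_suml; apply: eq_bigr => i _; rewrite mulr_suml; apply: eq_bigr => j _.
  by rewrite mulrA.
- by move=> a; rewrite divr_gt0.
- by rewrite divff // gt_eqF.
- rewrite -(pmulr_llt0 _ (L_gt0 0)) mulr_suml; move: L_neg; congr (_ < 0).
  by apply: eq_bigr => s _; rewrite -mulrA divfK // gt_eqF.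
Qed.

Section Preservation.

Variables (R : realType) (G : lmodType rat) (w : weight R G) (k : rcfType).
Variable (iota : {rmorphism R -> k}).
Local Notation K := (lcs w k).
Local Notation C := (@lcC R G w k).
Local Notation h := (C \o iota : {rmorphism R -> K}).
Variables (la : G -> k) (la_psd : psd_kernel la) (la0 : la 0 = 1).
Hypothesis la_neq0 : forall a, la a != 0.

(** The entries of a pencil are affine in [xs] with constant coefficients, so applying the
    multiplier to [xs] amounts to applying it to each entry of the matrix. The relation <> is
    preserved by injectivity. *)
Lemma hadamard_interp (r : spec_sym R) (xs : 'I_(spec_arity r) -> K) :
  rcf_interp h xs -> rcf_interp h (fun i => hadamard la (xs i)).
Proof.
case: r xs => [P|] xs /=; last by move=> ne /(can_inj (hadamardK la_neq0)).
set A := sym_pencil P => Ap.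
have hE x : hadamard la (h x) = h x by apply: hadamardC.
have -> : pencil_entry h (P := A) (fun i => hadamard la (xs i)) =
    fun i j => hadamard la (pencil_entry h (P := A) xs i j).
  apply/funext => i; apply/funext => j; rewrite /pencil_entry raddfD raddf_sum /=.
  congr (_ + _); first by rewrite hadamardC.
  by apply: eq_bigr => l _; rewrite [RHS]/= ![_ * C _]mulrC hadamardCM.
apply: (hadamard_psd la_psd) Ap => i j; rewrite /pencil_entry.
have sE M (Ms : M^T = M) : M i j = M j i :> R by rewrite -[in LHS]Ms mxE.
rewrite (sE _ (pconst_sym A)); congr (_ + _); apply: eq_bigr => l _.
by rewrite (sE _ (plin_sym A l)).
Qed.

End Preservation.

Theorem proposition3p12 (R : realType) (n : nat) (S : {fset 'X_{1..n}}) :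
  (exists (F : rcfType) (p : {mpoly F[n]}),
      in_Pplus S p /\ ~ qsos (qmonalg_of_mpoly p)) ->
  ~ positive_definition (M := spectrahedra_neq R) (@Pplus_coef R n S).
Proof.
have [U] := ultrafilter_exists; have [w] := weight_exists R n.
move=> /(@lim_functional R n S U)[c [la [c0 la_psd la_gt0 la1 neg]]] [phi phiP].
pose k : rcfType := upow U R; pose K : rcfType := lcs w k.
pose C : {rmorphism k -> K} := @lcC R _ w k; pose T := @lcT R _ w k.
pose h : {rmorphism R -> K} := (C \o @uconst U R).
(* The equivalence between [phi] and nonnegativity, quantified over all coefficient families, is one
   definable statement with real constants; it is transferred along [h]. *)
have phiK (e : S -> K) : (forall x, 0 <= sparse_eval e x) <->
    satin (M := spectrahedra_neq R) (rcf_interp h) phi e.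
  pose nu (s : S) : nat := enum_rank s.
  have d0 := def_sparse_ge0 S R; have d1 := def_satin phi nu.
  have dE := def_allb #|{: S}| (def_and (def_imp d0 d1) (def_imp d1 d0)).
  have toV (L : rcfType) (e' : S -> L) :
      (fun s => ([seq e' (enum_val j) | j : 'I_#|{: S}|] ++ [::])`_(enum_rank s)) = e'.
    by apply/funext => s; rewrite nth_block enum_rankK.
  have [H _] := definable_transfer [::] (@rcf_mono R R idfun) (@rcf_mono R K h) dE.
  have := H _ (fun j => e (enum_val j)); rewrite /nu toV => -[|? ?]; last by split.
  move=> x; set y := fun s => _.
  have sR : satin (M := spectrahedra_neq R) (rcf_interp idfun) phi y <->
      satin (@interp (spectrahedra_neq R)) phi y.
    by apply: satin_iff => r xs; rewrite rcf_interp_id.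
  split.
    by move=> y0; apply/sR/satin_interp/phiP/Pplus_coefP.
  by move=> /sR/satin_interp/phiP/Pplus_coefP.
pose e (s : S) : K := C (c s) * T (qexp (val s)).
have Tprod (s : S) (v : 'I_n -> K) (b : 'I_n -> 'rV[rat]_n) :
    \prod_i (T (b i) * v i) ^+ (val s) i =
    T (\sum_i b i *+ (val s) i) * \prod_i v i ^+ (val s) i.
  rewrite (big_morph T (@lcTD _ _ w k) (lcT0 w k)) -big_split; apply: eq_bigr => i _.
  by rewrite /= exprMn /T lcTX.
have qexpE (s : S) : qexp (val s) = \sum_(i < n) delta_mx 0 i *+ (val s) i.
  rewrite [LHS]row_sum_delta; apply: eq_bigr => i _.
  by rewrite mxE scaler_nat.
(* Nonnegativity of the polynomial with coefficients [c] passes from [k] to [K]; scaling the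
   variables by the monomials [epsilon_i] then gives the coefficients [e]. *)
have e0 x : 0 <= sparse_eval e x.
  have cK y : 0 <= sparse_eval (fun s => C (c s)) y.
    have [H _] := definable_transfer [seq c (enum_val j) | j : 'I_#|{: S}|]
      (@rcf_mono k k idfun) (@rcf_mono k K C) (def_sparse_ge0 S k).
    have toV (L : rcfType) (f : k -> L) :
        (fun s => (map f [seq c (enum_val j) | j : 'I_#|{: S}|])`_(enum_rank s)) =
        (fun s => f (c s)).
      apply/funext => s; rewrite -map_comp.
      have := nth_block (fun j => f (c (enum_val j))) [::] (enum_rank s).
      by rewrite cats0 enum_rankK.
    by move: H; rewrite !toV; apply; apply: c0.
  have := cK (fun i => T (delta_mx 0 i) * x i); congr (0 <= _).
  by apply: eq_bigr => s _; rewrite Tprod -qexpE mulrA.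
have la_neq0 a : la a != 0 by rewrite gt_eqF.
have phie : satin (M := spectrahedra_neq R) (rcf_interp h) phi (fun s => hadamard la (e s)).
  have pres (r : spec_sym R) (xs : 'I_(spec_arity r) -> K) :
      rcf_interp h xs -> rcf_interp h (fun i => hadamard la (xs i)).
    exact: hadamard_interp.
  (* Only the multiplier by [la] has to preserve the relations; the one by the inverses of [la] is
     just a section. *)
  apply: (@satin_surj (spectrahedra_neq R) _ _ _ _ _ _ _ _ _ (hadamardVK la_neq0) pres).
  by apply/phiK.
have /phiK/(_ (fun i => T (- delta_mx 0 i))) := phie.
(* At this point each monomial takes the value [T (- qexp (val s))], which cancels the factor
   [T (qexp (val s))] of the coefficient and leaves a constant. *)
have -> : sparse_eval (fun s => hadamard la (e s)) (fun i => T (- delta_mx 0 i)) =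
    C (\sum_(s : S) c s * la (qexp (val s))).
  rewrite rmorph_sum; apply: eq_bigr => s _.
  have := Tprod s (fun=> 1) (fun i => - delta_mx 0 i).
  under eq_bigr => i _ do rewrite mulr1.
  have -> : \prod_i (1 : K) ^+ (val s) i = 1 by apply: big1 => i _; rewrite expr1n.
  move=> ->.
  have -> : \sum_i - delta_mx 0 i *+ (val s) i = - qexp (val s).
    by rewrite qexpE -sumrN; apply: eq_bigr => i _; rewrite mulNrn.
  rewrite mulr1 /e hadamardCM hadamardT -!mulrA [T _ * T _]mulrC lcTVK mulr1.
  by rewrite -rmorphM.
rewrite -[0](rmorph0 C) (rcf_mono C) leNgt.
by rewrite neg.
Qed.
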